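(* Let $\mathcal{E}$ be a Frobenius cluster category with a (basic) cluster-tilting object $T=\bigoplus_{i=1}^n T_i$, where the $T_i$ are pairwise non-isomorphic and indecomposable and $T_i$ is projective-injective if and only if $i>r$, such that $\Lambda=\operatorname{End}_{\mathcal{E}}(T)^{\mathrm{op}}$ is Noetherian. (i) The Grothendieck group $\mathrm{K}_0(\mathcal{E})$ of $\mathcal{E}$ as an exact category is isomorphic to the quotient of $\mathrm{K}_0(\operatorname{add} T)$ by the relations $[X_k]-[Y_k]$ for $1\le k\le r$, where $$0\to T_k^*\to Y_k\to T_k\to 0\qquad\text{and}\qquad 0\to T_k\to X_k\to T_k^*\to 0$$ are the exchange sequences associated to the summand $T_k$ of $T$. (ii) For every abelian group $\mathbb{A}$, the space of $\mathbb{A}$-gradings of $\mathcal{E}$ (a subgroup of $\mathrm{K}_0(\operatorname{fd}\Lambda)\otimes_{\mathbb{Z}}\mathbb{A}$) is isomorphic to $\operatorname{Hom}_{\mathbb{Z}}(\mathrm{K}_0(\mathcal{E}),\mathbb{A})$, via the map $G\mapsto \deg_G$.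
   Context: All categories and algebras are over $\mathbb{C}$; all modules are left modules. A Frobenius category is an exact category with enough projectives and enough injectives in which these two classes of objects coincide; its stable category $\underline{\mathcal{E}}$ is the quotient by the morphisms factoring through projective-injective objects, a triangulated category. $\mathcal{E}$ is stably 2-Calabi--Yau if $\underline{\mathcal{E}}$ is Hom-finite and there is a functorial duality $\mathrm{D}\operatorname{Ext}^1_{\mathcal{E}}(X,Y)=\operatorname{Ext}^1_{\mathcal{E}}(Y,X)$ for all $X,Y$. An object $T$ is cluster-tilting if $\operatorname{add}T=\{X\in\mathcal{E}:\operatorname{Ext}^1_{\mathcal{E}}(T,X)=0\}$. A Frobenius cluster category is a Frobenius category that is Krull--Schmidt, stably 2-Calabi--Yau, has at least one cluster-tilting object, and satisfies $\operatorname{gldim}(\operatorname{End}_{\mathcal{E}}(T)^{\mathrm{op}})\le 3$ for all cluster-tilting objects $T$. Exchange sequences: for a non-projective indecomposable summand $T_k$ of $T$, these are non-split exact sequences $0\to T_k^*\to Y_k\to T_k\to 0$ and $0\to T_k\to X_k\to T_k^*\to 0$ in $\mathcal{E}$ with $X_k,Y_k\in\operatorname{add}T$, lifting the exchange triangles of $T_k$ in $\underline{\mathcal{E}}$, which glue to an Auslander--Reiten 4-angle $T_k\to X_k\to Y_k\to T_k$ (in particular $Y_k\to T_k$ is right almost split in $\operatorname{add}T$ and $T_k\to X_k$ is left almost split in $\operatorname{add}T$). Notation: $\underline{\Lambda}=\operatorname{End}_{\underline{\mathcal{E}}}(T)^{\mathrm{op}}$, a finite dimensional quotient of $\Lambda$;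 $\operatorname{mod}\Lambda$ and $\operatorname{fd}\Lambda$ are the categories of finitely generated and finite dimensional $\Lambda$-modules; $F=\operatorname{Hom}_{\mathcal{E}}(T,-)\colon\mathcal{E}\to\operatorname{mod}\Lambda$. $\operatorname{add}T$ is the full subcategory of summands of finite direct sums of copies of $T$; its Grothendieck group $\mathrm{K}_0(\operatorname{add}T)$ is free on the $[T_i]$. The Euler form is $\langle M,N\rangle_e=\sum_{i\ge0}(-1)^i\dim\operatorname{Ext}^i_\Lambda(M,N)$, a bilinear map $\mathrm{K}_0(\operatorname{mod}\Lambda)\times\mathrm{K}_0(\operatorname{fd}\Lambda)\to\mathbb{Z}$, extended to $\mathrm{K}_0(\operatorname{mod}\Lambda)\times(\mathrm{K}_0(\operatorname{fd}\Lambda)\otimes_{\mathbb{Z}}\mathbb{A})\to\mathbb{A}$ by $\langle x,\sum y_i\otimes a_i\rangle_e=\sum\langle x,y_i\rangle_e a_i$. An $\mathbb{A}$-grading for $\mathcal{E}$ (with respect to $T$) is an element $G\in\mathrm{K}_0(\operatorname{fd}\Lambda)\otimes_{\mathbb{Z}}\mathbb{A}$ with $\langle M,G\rangle_e=0$ for all $M\in\operatorname{mod}\underline{\Lambda}$. Its degree function is $\deg_G(X)=\langle FX,G\rangle_e\in\mathbb{A}$ for $X\in\mathcal{E}$.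
   Formalization: Part (ii) additionally assumes that all simple Λ-modules are finite dimensional over C; without this it fails, e.g. for finite-dimensional C(t)-vector spaces with the split exact structure and T = C(t), where fd Λ = 0 but Hom(K_0(E), A) = A. *)

(* Defs.v *)
From HB Require Import structures.
From mathcomp Require Import all_boot all_order all_algebra.
From mathcomp Require Import generic_quotient ring_quotient freeg complex.
From mathcomp Require Import boolp classical_sets cardinality fsbigop reals.

Set Implicit Arguments.
Unset Strict Implicit.
Unset Printing Implicit Defensive.

Import GRing.Theory.
Local Open Scope ring_scope.
Local Open Scope quotient_scope.

Definition zspan (V : zmodType) (rel : V -> Prop) (v : V) : Prop :=
  forall P : V -> Prop, P 0 -> (forall x y, P x -> P y -> P (x - y)) ->
    (forall x, rel x -> P x) -> P v.

Definition zspan_pred (V : zmodType) (rel : V -> Prop) : {pred V} :=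
  [pred v | `[< zspan rel v >]].

Lemma zspan_closed (V : zmodType) (rel : V -> Prop) :
  zmod_closed (zspan_pred rel).
Proof.
split=> [|x y]; rewrite !inE; first by move=> P.
move=> hx hy P P0 PB Prel.
by apply: (PB _ _ (hx P P0 PB Prel) (hy P P0 PB Prel)).
Qed.

HB.instance Definition _ (V : zmodType) (rel : V -> Prop) :=
  GRing.isZmodClosed.Build V (zspan_pred rel) (zspan_closed rel).

Definition zquot (V : zmodType) (rel : V -> Prop) : zmodType :=
  Quotient.quot (zspan_pred rel).

Definition zpi (V : zmodType) (rel : V -> Prop) (v : V) : zquot rel :=
  \pi_(Quotient.quot (zspan_pred rel)) v.

Lemma zpi_is_zmod_morphism (V : zmodType) (rel : V -> Prop) :
  zmod_morphism (@zpi V rel).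
Proof. by move=> x y; rewrite /zpi !piE. Qed.

HB.instance Definition _ (V : zmodType) (rel : V -> Prop) :=
  GRing.isZmodMorphism.Build V (zquot rel) (@zpi V rel)
    (@zpi_is_zmod_morphism V rel).

(* The map induced by h : V -> A on the quotient; it is meaningful when h is
   additive and kills rel, see zliftE. *)
Definition zlift (V : zmodType) (rel : V -> Prop) (A : Type) (h : V -> A)
  (q : zquot rel) : A := h (repr (q : Quotient.quot (zspan_pred rel))).

Lemma zliftE (V A : zmodType) (rel : V -> Prop) (h : {additive V -> A}) :
  (forall v, rel v -> h v = 0) -> forall v, zlift h (zpi rel v) = h v.
Proof.
move=> hrel v; rewrite /zlift /zpi; set w := repr _.
have /eqP : w = v %[mod Quotient.quot (zspan_pred rel)] by rewrite reprK.
rewrite -Quotient.idealrBE inE => H.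
apply/eqP; rewrite -subr_eq0 -raddfB; apply/eqP.
by apply: (H (fun x => h x = 0)) => // [|x y hx hy];
  rewrite ?raddf0 // raddfB hx hy subrr.
Qed.

Definition freeab (X : Type) : zmodType := {freeg {classic X}}.
Definition fgen (X : Type) (x : X) : freeab X := << (x : {classic X}) >>.
Definition fext (X : Type) (A : zmodType) (g : X -> A) : freeab X -> A :=
  fglift (g : {classic X} -> zmodule A).

Lemma fext_gen (X : Type) (A : zmodType) (g : X -> A) x : fext g (fgen x) = g x.
Proof. by rewrite /fext /fgen liftU scale1r. Qed.

Lemma fext_is_zmod_morphism (X : Type) (A : zmodType) (g : X -> A) :
  zmod_morphism (fext g).
Proof. exact: (@lift_is_additive _ {classic X} (zmodule A)). Qed.

HB.instance Definition _ (X : Type) (A : zmodType) (g : X -> A) :=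
  GRing.isZmodMorphism.Build (freeab X) A (fext g) (fext_is_zmod_morphism g).

Definition zmod_iso (V W : zmodType) : Prop :=
  exists f : {additive V -> W}, bijective f.

Section Tensor.
Variables V W : zmodType.

Definition pgen (v : V) (w : W) : freeab (V * W) := fgen (v, w).

Definition tensor_rel (u : freeab (V * W)) : Prop :=
  (exists v v' w, u = pgen (v + v') w - pgen v w - pgen v' w) \/
  (exists v w w', u = pgen v (w + w') - pgen v w - pgen v w').

Definition tensor : zmodType := zquot tensor_rel.
Definition tens (v : V) (w : W) : tensor := zpi tensor_rel (pgen v w).
Definition tensor_lift (A : zmodType) (b : V -> W -> A) : tensor -> A :=
  zlift (fext (fun p => b p.1 p.2)).
End Tensor.

Record submodule (K : pzRingType) (V : lmodType K) := Submodule {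
  submodule_mem :> V -> Prop;
  submodule0 : submodule_mem 0;
  submoduleD : forall x y, submodule_mem x -> submodule_mem y ->
    submodule_mem (x + y);
  submoduleZ : forall c x, submodule_mem x -> submodule_mem (c *: x) }.

Section LQuot.
Variables (K : pzRingType) (V : lmodType K) (S : submodule V).

Definition submodule_pred : {pred V} := [pred v | `[< S v >]].

Lemma submodule_pred_closed : zmod_closed submodule_pred.
Proof.
split=> [|x y]; rewrite !inE; first exact: submodule0.
move=> Sx Sy; apply: submoduleD => //.
by rewrite -scaleN1r; apply: submoduleZ.
Qed.

HB.instance Definition _ :=
  GRing.isZmodClosed.Build V submodule_pred submodule_pred_closed.

Definition lquot : Type := Quotient.quot submodule_pred.
HB.instance Definition _ := GRing.Zmodule.on lquot.

Definition lpi (v : V) : lquot := \pi_(Quotient.quot submodule_pred) v.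

Lemma lpiP v w : lpi v = lpi w <-> S (v - w).
Proof.
rewrite /lpi; split=> [/eqP|Svw].
  by rewrite -Quotient.idealrBE inE.
by apply/eqP; rewrite -Quotient.idealrBE inE.
Qed.

Definition lrepr (q : lquot) : V := repr (q : Quotient.quot submodule_pred).
Lemma lreprK q : lpi (lrepr q) = q. Proof. exact: reprK. Qed.

Lemma lpiD v w : lpi (v + w) = lpi v + lpi w.
Proof. by rewrite /lpi !piE. Qed.

Definition lscale (c : K) (q : lquot) : lquot := lpi (c *: lrepr q).

Lemma lscale_pi c v : lscale c (lpi v) = lpi (c *: v).
Proof.
by apply/lpiP; rewrite -scalerBr; apply/submoduleZ/lpiP/lreprK.
Qed.

Lemma lscaleA a b q : lscale a (lscale b q) = lscale (a * b) q.
Proof. by rewrite -[q]lreprK !lscale_pi scalerA. Qed.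
Lemma lscale1 : left_id 1 lscale.
Proof. by move=> q; rewrite -[q]lreprK lscale_pi scale1r. Qed.
Lemma lscaleDr : right_distributive lscale +%R.
Proof.
move=> c p q; rewrite -[p]lreprK -[q]lreprK -lpiD !lscale_pi scalerDr.
exact: lpiD.
Qed.
Lemma lscaleDl q : {morph lscale^~ q : a b / a + b}.
Proof. by move=> a b; rewrite -[q]lreprK !lscale_pi scalerDl lpiD. Qed.

HB.instance Definition _ := GRing.Zmodule_isLmodule.Build K lquot
  lscaleA lscale1 lscaleDr lscaleDl.
End LQuot.

Record linCat (K : fieldType) := LinCat {
  obj :> Type;
  hom : obj -> obj -> lmodType K;
  idm : forall X, hom X X;
  hcomp : forall X Y Z, hom Y Z -> hom X Y -> hom X Z;
  compA : forall X Y Z W (h : hom Z W) (g : hom Y Z) (f : hom X Y),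
    hcomp h (hcomp g f) = hcomp (hcomp h g) f;
  comp1m : forall X Y (f : hom X Y), hcomp (idm Y) f = f;
  compm1 : forall X Y (f : hom X Y), hcomp f (idm X) = f;
  comp_linl : forall X Y Z (f : hom X Y), linear (fun g : hom Y Z => hcomp g f);
  comp_linr : forall X Y Z (g : hom Y Z), linear (fun f : hom X Y => hcomp g f) }.

Arguments idm {K l} X.
Arguments hcomp {K l X Y Z} _ _.
Notation "g \c f" := (hcomp g f) (at level 40, left associativity).

Section LinCatTheory.
Variables (K : fieldType) (E : linCat K).
Implicit Types X Y Z W : E.

Lemma compDl X Y Z (g g' : hom Y Z) (f : hom X Y) :
  (g + g') \c f = g \c f + g' \c f.
Proof. by rewrite -[g]scale1r comp_linl !scale1r. Qed.
Lemma compDr X Y Z (g : hom Y Z) (f f' : hom X Y) :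
  g \c (f + f') = g \c f + g \c f'.
Proof. by rewrite -[f]scale1r comp_linr !scale1r. Qed.
Lemma comp0m X Y Z (f : hom X Y) : (0 : hom Y Z) \c f = 0.
Proof. by apply: (@addrI _ (0 \c f)); rewrite -compDl !addr0. Qed.
Lemma compm0 X Y Z (g : hom Y Z) : g \c (0 : hom X Y) = 0.
Proof. by apply: (@addrI _ (g \c 0)); rewrite -compDr !addr0. Qed.
Lemma compZl X Y Z c (g : hom Y Z) (f : hom X Y) :
  (c *: g) \c f = c *: (g \c f).
Proof. by rewrite -[c *: g]addr0 comp_linl comp0m addr0. Qed.
Lemma compZr X Y Z c (g : hom Y Z) (f : hom X Y) :
  g \c (c *: f) = c *: (g \c f).
Proof. by rewrite -[c *: f]addr0 comp_linr compm0 addr0. Qed.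
Lemma compBl X Y Z (g g' : hom Y Z) (f : hom X Y) :
  (g - g') \c f = g \c f - g' \c f.
Proof. by rewrite -scaleN1r compDl compZl scaleN1r. Qed.
Lemma compBr X Y Z (g : hom Y Z) (f f' : hom X Y) :
  g \c (f - f') = g \c f - g \c f'.
Proof. by rewrite -scaleN1r compDr compZr scaleN1r. Qed.

Definition is_iso X Y (f : hom X Y) : Prop :=
  exists g : hom Y X, g \c f = idm X /\ f \c g = idm Y.
Definition iso X Y : Prop := exists f : hom X Y, is_iso f.
Definition split_epi X Y (p : hom X Y) : Prop :=
  exists s : hom Y X, p \c s = idm Y.
Definition split_mono X Y (i : hom X Y) : Prop :=
  exists r : hom Y X, r \c i = idm X.
Definition is_zero X : Prop := idm X = 0.

Record biproduct X Y := Biproduct {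
  bsum : E;
  binl : hom X bsum; binr : hom Y bsum;
  bprl : hom bsum X; bprr : hom bsum Y;
  bprl_inl : bprl \c binl = idm X;
  bprr_inr : bprr \c binr = idm Y;
  bprl_inr : bprl \c binr = 0;
  bprr_inl : bprr \c binl = 0;
  bsum_id : binl \c bprl + binr \c bprr = idm bsum }.

Definition bmap X Y X' Y' (B : biproduct X Y) (B' : biproduct X' Y')
  (f : hom X X') (g : hom Y Y') : hom (bsum B) (bsum B') :=
  binl B' \c f \c bprl B + binr B' \c g \c bprr B.
Definition diag X (B : biproduct X X) : hom X (bsum B) := binl B + binr B.
Definition codiag X (B : biproduct X X) : hom (bsum B) X := bprl B + bprr B.

Definition additive_cat : Prop :=
  (exists Z, is_zero Z) /\ (forall X Y, inhabited (biproduct X Y)).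

Definition is_dsum n (F : 'I_n -> E) (S : E) : Prop :=
  exists (i : forall k, hom (F k) S) (p : forall k, hom S (F k)),
    [/\ forall k, p k \c i k = idm (F k),
        forall k l, k <> l -> p k \c i l = 0
      & \sum_k i k \c p k = idm S].

Definition in_add T X : Prop :=
  exists (m : nat) (Y : E) (B : biproduct X Y), is_dsum (fun _ : 'I_m => T) (bsum B).

Definition indecomposable X : Prop :=
  ~ is_zero X /\
  forall Y Z (B : biproduct Y Z), iso X (bsum B) -> is_zero Y \/ is_zero Z.

Definition local_end X : Prop :=
  ~ is_zero X /\
  forall f g : hom X X, ~ is_iso f -> ~ is_iso g -> ~ is_iso (f + g).

Definition krull_schmidt : Prop :=
  forall X, exists n (F : 'I_n -> E), is_dsum F X /\ forall k, local_end (F k).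

Definition is_kernel X Y Z (i : hom X Y) (p : hom Y Z) : Prop :=
  p \c i = 0 /\ forall W (f : hom W Y), p \c f = 0 -> exists! g, i \c g = f.
Definition is_cokernel X Y Z (i : hom X Y) (p : hom Y Z) : Prop :=
  p \c i = 0 /\ forall W (f : hom Y W), f \c i = 0 -> exists! g, g \c p = f.

Definition is_pushout X Y X' Y' (i : hom X Y) (f : hom X X')
    (f' : hom Y Y') (i' : hom X' Y') : Prop :=
  f' \c i = i' \c f /\
  forall W (u : hom Y W) (v : hom X' W), u \c i = v \c f ->
    exists! w : hom Y' W, w \c f' = u /\ w \c i' = v.
Definition is_pullback Y Z Y' Z' (p : hom Y Z) (f : hom Z' Z)
    (f' : hom Y' Y) (p' : hom Y' Z') : Prop :=
  p \c f' = f \c p' /\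
  forall W (u : hom W Y) (v : hom W Z'), p \c u = f \c v ->
    exists! w : hom W Y', f' \c w = u /\ p' \c w = v.

Definition min_right_approx (S : E -> Prop) X Y (p : hom Y X) : Prop :=
  [/\ S Y, forall W, S W -> forall f : hom W X, exists g, p \c g = f
    & forall g : hom Y Y, p \c g = p -> is_iso g].
Definition min_left_approx (S : E -> Prop) X Y (j : hom X Y) : Prop :=
  [/\ S Y, forall W, S W -> forall f : hom X W, exists g, g \c j = f
    & forall g : hom Y Y, g \c j = j -> is_iso g].

Definition right_almost_split (S : E -> Prop) X Y (p : hom Y X) : Prop :=
  [/\ S Y, ~ split_epi p
    & forall W, S W -> forall f : hom W X, ~ split_epi f ->
        exists g, p \c g = f].
Definition left_almost_split (S : E -> Prop) X Y (j : hom X Y) : Prop :=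
  [/\ S Y, ~ split_mono j
    & forall W, S W -> forall f : hom X W, ~ split_mono f ->
        exists g, g \c j = f].

End LinCatTheory.

(* Finite dimensional vector spaces (mathcomp's vectType comes with a choice
   of coordinates) *)
Definition fin_dim (K : fieldType) (V : lmodType K) : Prop :=
  exists (n : nat) (b : 'I_n -> V),
    forall x, exists c : 'I_n -> K, x = \sum_k c k *: b k.

(* Exact categories in the sense of Quillen, with Buehler's list of
   conditions; confl i p means that X --i--> Y --p--> Z is a conflation. *)
Section ExactStructure.
Variables (K : fieldType) (E : linCat K)
  (confl : forall X Y Z : E, hom X Y -> hom Y Z -> Prop).

Definition inflation (X Y : E) (i : hom X Y) : Prop :=
  exists Z (p : hom Y Z), confl i p.
Definition deflation (Y Z : E) (p : hom Y Z) : Prop :=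
  exists X (i : hom X Y), confl i p.

Record exact_structure : Prop := ExactStructure {
  confl_kernel : forall X Y Z (i : hom X Y) (p : hom Y Z),
    confl i p -> is_kernel i p;
  confl_cokernel : forall X Y Z (i : hom X Y) (p : hom Y Z),
    confl i p -> is_cokernel i p;
  confl_iso : forall X Y Z X' Y' Z' (i : hom X Y) (p : hom Y Z)
      (i' : hom X' Y') (p' : hom Y' Z')
      (a : hom X X') (b : hom Y Y') (c : hom Z Z'),
    is_iso a -> is_iso b -> is_iso c ->
    i' \c a = b \c i -> p' \c b = c \c p -> confl i p -> confl i' p';
  inflation_id : forall X : E, inflation (idm X);
  deflation_id : forall X : E, deflation (idm X);
  inflation_comp : forall X Y Z (i : hom X Y) (j : hom Y Z),
    inflation i -> inflation j -> inflation (j \c i);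
  deflation_comp : forall X Y Z (p : hom X Y) (q : hom Y Z),
    deflation p -> deflation q -> deflation (q \c p);
  inflation_pushout : forall X Y X' (i : hom X Y) (f : hom X X'),
    inflation i -> exists Y' (f' : hom Y Y') (i' : hom X' Y'),
      is_pushout i f f' i' /\ inflation i';
  deflation_pullback : forall Y Z Z' (p : hom Y Z) (f : hom Z' Z),
    deflation p -> exists Y' (f' : hom Y' Y) (p' : hom Y' Z'),
      is_pullback p f f' p' /\ deflation p' }.
End ExactStructure.

Record exactCat (K : fieldType) := ExactCat {
  exact_lin :> linCat K;
  confl : forall X Y Z : exact_lin, hom X Y -> hom Y Z -> Prop;
  exact_additive : additive_cat exact_lin;
  exact_exact : exact_structure confl }.
Arguments confl {K e X Y Z} _ _.

Section Exact.
Variables (K : fieldType) (E : exactCat K).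
Implicit Types X Y Z : E.

Definition projective X : Prop :=
  forall Y Z (p : hom Y Z), deflation (@confl K E) p ->
  forall f : hom X Z, exists g, p \c g = f.
Definition injective_obj X : Prop :=
  forall Y Z (i : hom Y Z), inflation (@confl K E) i ->
  forall f : hom Y X, exists g, g \c i = f.
Definition proj_inj X : Prop := projective X /\ injective_obj X.

Definition frobenius : Prop :=
  [/\ forall X, exists P (p : hom P X),
        projective P /\ deflation (@confl K E) p,
      forall X, exists I (i : hom X I),
        injective_obj I /\ inflation (@confl K E) i
    & forall X, projective X <-> injective_obj X].

Definition factors_proj X Y (f : hom X Y) : Prop :=
  exists (P : E) (g : hom X P) (h : hom P Y), proj_inj P /\ f = h \c g.

Lemma proj_inj_zero X : is_zero X -> proj_inj X.
Proof.
move=> X0; split=> Y Z p _ f; exists 0.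
  by rewrite compm0 -[f]compm1 X0 compm0.
by rewrite comp0m -[f]comp1m X0 comp0m.
Qed.

Lemma proj_inj_biproduct X Y (B : biproduct X Y) :
  proj_inj X -> proj_inj Y -> proj_inj (bsum B).
Proof.
move=> [pX iX] [pY iY]; split=> W Z p hp f.
  have [g hg] := pX _ _ p hp (f \c binl B).
  have [h hh] := pY _ _ p hp (f \c binr B).
  exists (g \c bprl B + h \c bprr B).
  by rewrite compDr !compA hg hh -!compA -compDr bsum_id compm1.
have [g hg] := iX _ _ p hp (bprl B \c f).
have [h hh] := iY _ _ p hp (bprr B \c f).
exists (binl B \c g + binr B \c h).
by rewrite compDl -!compA hg hh !compA -compDl bsum_id comp1m.
Qed.

Lemma factors_proj0 X Y : factors_proj (0 : hom X Y).
Proof.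
have [[Z Z0] _] := exact_additive E.
by exists Z, 0, 0; split; [exact: proj_inj_zero | rewrite comp0m].
Qed.
Lemma factors_projD X Y (f f' : hom X Y) :
  factors_proj f -> factors_proj f' -> factors_proj (f + f').
Proof.
move=> [P [g [h [hP ->]]]] [P' [g' [h' [hP' ->]]]].
have [_ /(_ P P') [B]] := exact_additive E.
exists (bsum B), (binl B \c g + binr B \c g'), (h \c bprl B + h' \c bprr B).
split; first exact: proj_inj_biproduct.
have idl (k : hom X P) : bprl B \c (binl B \c k) = k.
  by rewrite compA bprl_inl comp1m.
have idr (k : hom X P') : bprr B \c (binr B \c k) = k.
  by rewrite compA bprr_inr comp1m.
have zlr (k : hom X P') : bprl B \c (binr B \c k) = 0.
  by rewrite compA bprl_inr comp0m.
have zrl (k : hom X P) : bprr B \c (binl B \c k) = 0.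
  by rewrite compA bprr_inl comp0m.
by rewrite compDl -!compA !compDr idl idr zlr zrl !compm0 addr0 add0r.
Qed.
Lemma factors_projZ X Y c (f : hom X Y) :
  factors_proj f -> factors_proj (c *: f).
Proof.
by move=> [P [g [h [hP ->]]]]; exists P, g, (c *: h); split; rewrite ?compZl.
Qed.
Lemma factors_proj_compl X Y Z (g : hom Y Z) (f : hom X Y) :
  factors_proj f -> factors_proj (g \c f).
Proof.
by move=> [P [u [v [hP ->]]]]; exists P, u, (g \c v); split; rewrite ?compA.
Qed.
Lemma factors_proj_compr X Y Z (g : hom Y Z) (f : hom X Y) :
  factors_proj g -> factors_proj (g \c f).
Proof.
by move=> [P [u [v [hP ->]]]]; exists P, (u \c f), v; split; rewrite ?compA.
Qed.

Definition proj_ideal X Y : submodule (hom X Y) :=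
  Submodule (@factors_proj0 X Y) (@factors_projD X Y) (@factors_projZ X Y).

Definition stab_hom X Y : lmodType K := lquot (proj_ideal X Y).
Definition stab_pi X Y (f : hom X Y) : stab_hom X Y := lpi (proj_ideal X Y) f.
Definition stab_comp X Y Z (g : stab_hom Y Z) (f : stab_hom X Y) :
  stab_hom X Z := stab_pi (lrepr g \c lrepr f).

Lemma stab_comp_pi X Y Z (g : hom Y Z) (f : hom X Y) :
  stab_comp (stab_pi g) (stab_pi f) = stab_pi (g \c f).
Proof.
apply/lpiP; set g' := lrepr _; set f' := lrepr _.
have /lpiP hg : lpi (proj_ideal Y Z) g' = lpi _ g by exact: lreprK.
have /lpiP hf : lpi (proj_ideal X Y) f' = lpi _ f by exact: lreprK.
have -> : g' \c f' - g \c f = (g' - g) \c f' + g \c (f' - f).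
  by rewrite compBl compBr addrA subrK.
by apply: factors_projD; [exact: factors_proj_compr|exact: factors_proj_compl].
Qed.

Lemma stab_pi_linear X Y : linear (@stab_pi X Y).
Proof. by move=> c f g; rewrite /stab_pi lpiD -lscale_pi. Qed.

Lemma stab_piP X Y (q : stab_hom X Y) : exists f, q = stab_pi f.
Proof. by exists (lrepr q); rewrite /stab_pi lreprK. Qed.

Lemma stab_compA X Y Z W (h : stab_hom Z W) (g : stab_hom Y Z)
    (f : stab_hom X Y) :
  stab_comp h (stab_comp g f) = stab_comp (stab_comp h g) f.
Proof.
have [h' ->] := stab_piP h; have [g' ->] := stab_piP g.
by have [f' ->] := stab_piP f; rewrite !stab_comp_pi compA.
Qed.
Lemma stab_comp1m X Y (f : stab_hom X Y) : stab_comp (stab_pi (idm Y)) f = f.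
Proof. by have [f' ->] := stab_piP f; rewrite !stab_comp_pi comp1m. Qed.
Lemma stab_compm1 X Y (f : stab_hom X Y) : stab_comp f (stab_pi (idm X)) = f.
Proof. by have [f' ->] := stab_piP f; rewrite !stab_comp_pi compm1. Qed.
Lemma stab_comp_linl X Y Z (f : stab_hom X Y) :
  linear (fun g : stab_hom Y Z => stab_comp g f).
Proof.
move=> c g h; have [g' ->] := stab_piP g; have [h' ->] := stab_piP h.
have [f' ->] := stab_piP f.
by rewrite -stab_pi_linear !stab_comp_pi comp_linl stab_pi_linear.
Qed.
Lemma stab_comp_linr X Y Z (g : stab_hom Y Z) :
  linear (fun f : stab_hom X Y => stab_comp g f).
Proof.
move=> c f h; have [g' ->] := stab_piP g; have [h' ->] := stab_piP h.
have [f' ->] := stab_piP f.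
by rewrite -stab_pi_linear !stab_comp_pi comp_linr stab_pi_linear.
Qed.

Definition stable : linCat K :=
  LinCat stab_compA stab_comp1m stab_compm1 stab_comp_linl stab_comp_linr.

(* Ext^1 in the sense of Yoneda: extn X Y is the class of conflations
   Y -> M -> X, which represent the elements of Ext^1(X, Y). *)
Record extn X Y := Extn {
  emid : E;
  emono : hom Y emid;
  eepi : hom emid X;
  econfl : confl emono eepi }.

Definition esplit X Y (e : extn X Y) : Prop := split_epi (eepi e).

Definition ext_mor X Y X' Y' (e : extn X Y) (e' : extn X' Y')
    (a : hom Y Y') (c : hom X X') : Prop :=
  exists b : hom (emid e) (emid e'),
    b \c emono e = emono e' \c a /\ eepi e' \c b = c \c eepi e.

Definition ext_equiv X Y (e e' : extn X Y) : Prop :=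
  ext_mor e e' (idm Y) (idm X).

(* e' = a_* e, resp. e' = c^* e, in Ext^1 *)
Definition is_push X Y Y' (a : hom Y Y') (e : extn X Y) (e' : extn X Y') :
  Prop := ext_mor e e' a (idm X).
Definition is_pull X X' Y (c : hom X' X) (e : extn X Y) (e' : extn X' Y) :
  Prop := ext_mor e' e (idm Y) c.

(* e = e1 + e2 in Ext^1, i.e. e = codiag_* diag^* (e1 (+) e2) *)
Definition is_baer_sum X Y (e1 e2 e : extn X Y) : Prop :=
  exists (BX : biproduct X X) (BY : biproduct Y Y)
      (BM : biproduct (emid e1) (emid e2))
      (d : confl (bmap BY BM (emono e1) (emono e2))
                 (bmap BM BX (eepi e1) (eepi e2)))
      (e' : extn X (bsum BY)),
    is_pull (diag BX) (Extn d) e' /\ is_push (codiag BY) e' e.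

(* l represents an element of the dual space D Ext^1(X, Y). *)
Definition ext_dual X Y (l : extn X Y -> K) : Prop :=
  [/\ forall e e', ext_equiv e e' -> l e = l e',
      forall e1 e2 e, is_baer_sum e1 e2 e -> l e = l e1 + l e2
    & forall c e e', is_push (c *: idm Y) e e' -> l e' = c * l e].

(* A functorial duality Ext^1(Y, X) = D Ext^1(X, Y), given by linear
   bijections D X Y *)
Record ext_duality (D : forall X Y, extn Y X -> extn X Y -> K) : Prop :=
  ExtDuality {
  dual_wd : forall X Y (h : extn Y X), ext_dual (D X Y h);
  dual_lin : forall X Y (e : extn X Y), ext_dual (fun h => D X Y h e);
  dual_inj : forall X Y (h h' : extn Y X),
    (forall e, D X Y h e = D X Y h' e) -> ext_equiv h h';
  dual_surj : forall X Y (l : extn X Y -> K), ext_dual l ->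
    exists h, forall e, D X Y h e = l e;
  dual_nat1 : forall X X' Y (a : hom X X') (h : extn Y X) (h' : extn Y X')
      (e : extn X Y) (e' : extn X' Y),
    is_push a h h' -> is_pull a e' e -> D X' Y h' e' = D X Y h e;
  dual_nat2 : forall X Y Y' (b : hom Y Y') (h : extn Y X) (h' : extn Y' X)
      (e : extn X Y) (e' : extn X Y'),
    is_pull b h' h -> is_push b e e' -> D X Y' h' e' = D X Y h e }.

Definition stably_2CY : Prop :=
  (forall X Y, fin_dim (stab_hom X Y)) /\
  exists D : (forall X Y, extn Y X -> extn X Y -> K), ext_duality D.

Definition cluster_tilting (T : E) : Prop :=
  forall X, in_add T X <-> forall e : extn T X, esplit e.

End Exact.

Section Modules.
Variable A : pzRingType.

Definition left_ideal (I : A -> Prop) : Prop :=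
  [/\ I 0, forall x y, I x -> I y -> I (x + y) & forall a x, I x -> I (a * x)].

Definition left_noetherian : Prop :=
  forall I, left_ideal I -> exists (n : nat) (b : 'I_n -> A),
    (forall k, I (b k)) /\
    forall x, I x -> exists c : 'I_n -> A, x = \sum_k c k * b k.

Definition fin_gen (M : lmodType A) : Prop :=
  exists (n : nat) (b : 'I_n -> M),
    forall x, exists c : 'I_n -> A, x = \sum_k c k *: b k.

Definition simple_mod (M : lmodType A) : Prop :=
  (exists x : M, x <> 0) /\
  forall S : submodule M, (forall x, S x -> x = 0) \/ (forall x, S x).

Definition projmod (P : lmodType A) : Prop :=
  forall (M N : lmodType A) (p : {linear M -> N}), (forall y, exists x, p x = y) ->
  forall f : {linear P -> N}, exists g : {linear P -> M}, forall x, p (g x) = f x.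

Record proj_res (M : lmodType A) := ProjRes {
  pr_mod : nat -> lmodType A;
  pr_d : forall i, {linear pr_mod i.+1 -> pr_mod i};
  pr_aug : {linear pr_mod 0 -> M};
  pr_proj : forall i, projmod (pr_mod i);
  pr_surj : forall y, exists x, pr_aug x = y;
  pr_exact0 : forall x, pr_aug x = 0 <-> exists y, pr_d 0 y = x;
  pr_exactS : forall i x, pr_d i x = 0 <-> exists y, pr_d i.+1 y = x }.

Definition pd_le (d : nat) (M : lmodType A) : Prop :=
  exists P : proj_res M, forall i, (d < i)%N -> forall x : pr_mod P i, x = 0.

Definition gldim_le (d : nat) : Prop := forall M : lmodType A, pd_le d M.

End Modules.

Definition noetherian (A : pzRingType) : Prop :=
  left_noetherian A /\ left_noetherian A^c%type.

Definition restr (A B : pzRingType) (f : {rmorphism A -> B}) (M : lmodType B) :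
  Type := M.

Section Restr.
Variables (A B : pzRingType) (f : {rmorphism A -> B}) (M : lmodType B).
HB.instance Definition _ := GRing.Zmodule.on (restr f M).
Definition restr_scale (a : A) (x : restr f M) : restr f M :=
  f a *: (x : M).
Lemma restr_scaleA a b x : restr_scale a (restr_scale b x) = restr_scale (a * b) x.
Proof. by rewrite /restr_scale scalerA rmorphM. Qed.
Lemma restr_scale1 : left_id 1 restr_scale.
Proof. by move=> x; rewrite /restr_scale rmorph1 scale1r. Qed.
Lemma restr_scaleDr : right_distributive restr_scale +%R.
Proof. by move=> a x y; rewrite /restr_scale scalerDr. Qed.
Lemma restr_scaleDl x : {morph restr_scale^~ x : a b / a + b}.
Proof. by move=> a b; rewrite /restr_scale rmorphD scalerDl. Qed.
HB.instance Definition _ := GRing.Zmodule_isLmodule.Build A (restr f M)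
  restr_scaleA restr_scale1 restr_scaleDr restr_scaleDl.
End Restr.

(* Algebras; mathcomp's algType does not allow the zero ring, which may occur
   as a stable endomorphism algebra. *)
Record algebra (K : fieldType) := Algebra {
  alg_ring :> pzRingType;
  alg_unit : {rmorphism K -> alg_ring};
  alg_central : forall c a, alg_unit c * a = a * alg_unit c }.
Arguments alg_unit {K} {_} : rename.

Section Euler.
Variables (K : fieldType) (A : algebra K).

Definition fin_dim_mod (M : lmodType A) : Prop :=
  exists (n : nat) (b : 'I_n -> M),
    forall x, exists c : 'I_n -> K, x = \sum_k alg_unit (c k) *: b k.

(* Finite dimensional left A-modules, presented as matrix representations: this
   makes them a small type, so that K_0(fd A) exists. *)
Record fdmod := Fdmod {
  fd_dim : nat;
  fd_act : {rmorphism A -> 'M[K]_fd_dim};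
  fd_unit : forall c, fd_act (alg_unit c) = c%:M }.

Definition fd_mod (N : fdmod) : Type := 'cV[K]_(fd_dim N).

Section FdMod.
Variable N : fdmod.
HB.instance Definition _ := GRing.Zmodule.on (fd_mod N).
Definition fd_scale (a : A) (x : fd_mod N) : fd_mod N :=
  (fd_act N a *m (x : 'cV[K]_(fd_dim N)))%R.
Lemma fd_scaleA a b x : fd_scale a (fd_scale b x) = fd_scale (a * b) x.
Proof. by rewrite /fd_scale rmorphM mulmxA. Qed.
Lemma fd_scale1 : left_id 1 fd_scale.
Proof. by move=> x; rewrite /fd_scale rmorph1 mul1mx. Qed.
Lemma fd_scaleDr : right_distributive fd_scale +%R.
Proof. by move=> a x y; rewrite /fd_scale mulmxDr. Qed.
Lemma fd_scaleDl x : {morph fd_scale^~ x : a b / a + b}.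
Proof. by move=> a b; rewrite /fd_scale rmorphD mulmxDl. Qed.
HB.instance Definition _ := GRing.Zmodule_isLmodule.Build A (fd_mod N)
  fd_scaleA fd_scale1 fd_scaleDr fd_scaleDl.
End FdMod.

Definition short_exact (N' N N'' : lmodType A)
    (f : {linear N' -> N}) (g : {linear N -> N''}) : Prop :=
  [/\ injective f, forall y, g y = 0 <-> exists x, f x = y
    & forall z, exists y, g y = z].

Definition K0fd_rel (u : freeab fdmod) : Prop :=
  exists (N' N N'' : fdmod) (f : {linear fd_mod N' -> fd_mod N})
      (g : {linear fd_mod N -> fd_mod N''}),
    short_exact f g /\ u = fgen N - fgen N' - fgen N''.
Definition K0fd : zmodType := zquot K0fd_rel.
Definition K0fd_class (N : fdmod) : K0fd := zpi K0fd_rel (fgen N).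

(* Ext^i_A(M, N) as the i-th cohomology of Hom_A(P, N), for a projective
   resolution P of M *)
Section Ext.
Variables (M N : lmodType A) (P : proj_res M).

Definition is_cocycle i (f : pr_mod P i -> N) : Prop :=
  linear f /\ forall x, f (pr_d P i x) = 0.

Definition is_coboundary i : (pr_mod P i -> N) -> Prop :=
  match i with
  | 0 => fun f => forall x, f x = 0
  | j.+1 => fun f => exists g : {linear pr_mod P j -> N},
              forall x, f x = g (pr_d P j x)
  end.

Definition cohom_dim i (d : nat) : Prop :=
  exists b : 'I_d -> pr_mod P i -> N, (forall k, is_cocycle (b k)) /\
    forall f, is_cocycle f -> exists! c : 'rV[K]_d,
      is_coboundary (fun x => f x - \sum_k alg_unit (c 0 k) *: b k x).
End Ext.

Definition is_ext_dim (M N : lmodType A) i (d : nat) : Prop :=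
  exists P : proj_res M, cohom_dim N P i d.

(* dim Ext^i_A(M, N) when it is finite (and 0 otherwise) *)
Definition ext_dim (M N : lmodType A) i : nat :=
  xget 0%N (is_ext_dim M N i : set nat).

Definition euler (M N : lmodType A) : int :=
  \sum_(i \in [set: nat]) (-1) ^+ i * (ext_dim M N i)%:Z.

Definition euler_K0 (M : lmodType A) : K0fd -> int :=
  zlift (fext (fun N : fdmod => euler M (fd_mod N))).

Definition euler_tensor (B : zmodType) (M : lmodType A) : tensor K0fd B -> B :=
  tensor_lift (fun y b => b *~ euler_K0 M y).

End Euler.

Section EndAlg.
Variables (K : fieldType) (E : linCat K) (T : E).

Definition endo : Type := hom T T.
HB.instance Definition _ := GRing.Zmodule.on endo.

Definition endo_mul (g f : endo) : endo := (g : hom T T) \c (f : hom T T).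
Lemma endo_mulA : associative endo_mul.
Proof. by move=> h g f; apply: compA. Qed.
Lemma endo_mul1 : left_id (idm T : endo) endo_mul.
Proof. by move=> f; apply: comp1m. Qed.
Lemma endo_1mul : right_id (idm T : endo) endo_mul.
Proof. by move=> f; apply: compm1. Qed.
Lemma endo_mulDl : left_distributive endo_mul +%R.
Proof. by move=> f g h; apply: compDl. Qed.
Lemma endo_mulDr : right_distributive endo_mul +%R.
Proof. by move=> f g h; apply: compDr. Qed.
HB.instance Definition _ := GRing.Zmodule_isPzRing.Build endo
  endo_mulA endo_mul1 endo_1mul endo_mulDl endo_mulDr.

Definition endo_unit (c : K) : (endo)^c%type := c *: idm T.
Lemma endo_unit_zmod : zmod_morphism endo_unit.
Proof. by move=> a b; rewrite /endo_unit scalerBl. Qed.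
Lemma endo_unit_mon : monoid_morphism endo_unit.
Proof.
split; first exact: scale1r.
by move=> a b; apply: esym; rewrite [LHS]compZl compZr comp1m scalerA mulrC.
Qed.
HB.instance Definition _ :=
  GRing.isZmodMorphism.Build K (endo)^c%type endo_unit endo_unit_zmod.
HB.instance Definition _ :=
  GRing.isMonoidMorphism.Build K (endo)^c%type endo_unit endo_unit_mon.

Lemma endo_unit_central c (f : (endo)^c%type) :
  endo_unit c * f = f * endo_unit c.
Proof. by rewrite [LHS]compZr [RHS]compZl comp1m compm1. Qed.

Definition end_op : algebra K := Algebra endo_unit_central.

Definition Fobj (X : E) : Type := hom T X.
Section Fobj.
Variable X : E.
HB.instance Definition _ := GRing.Zmodule.on (Fobj X).
Definition Fscale (a : end_op) (x : Fobj X) : Fobj X :=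
  (x : hom T X) \c (a : hom T T).
Lemma FscaleA a b x : Fscale a (Fscale b x) = Fscale (a * b) x.
Proof. by rewrite /Fscale -compA. Qed.
Lemma Fscale1 : left_id 1 Fscale.
Proof. by move=> x; apply: compm1. Qed.
Lemma FscaleDr : right_distributive Fscale +%R.
Proof. by move=> a x y; apply: compDl. Qed.
Lemma FscaleDl x : {morph Fscale^~ x : a b / a + b}.
Proof. by move=> a b; apply: compDr. Qed.
HB.instance Definition _ := GRing.Zmodule_isLmodule.Build end_op (Fobj X)
  FscaleA Fscale1 FscaleDr FscaleDl.
End Fobj.
End EndAlg.

Section Frobenius.
Variables (K : fieldType) (E : exactCat K).

Definition frobenius_cluster : Prop :=
  [/\ frobenius E, krull_schmidt E, stably_2CY E,
      exists T : E, cluster_tilting T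
    & forall T : E, cluster_tilting T -> gldim_le (end_op T) 3].

Definition stab_end_pi (T : E) (f : end_op T) : end_op (T : stable E) :=
  stab_pi (f : hom T T).
Lemma stab_end_pi_zmod (T : E) : zmod_morphism (@stab_end_pi T).
Proof.
move=> f g; rewrite /stab_end_pi -[f - g]addrC -scaleN1r.
by rewrite stab_pi_linear scaleN1r addrC.
Qed.
Lemma stab_end_pi_mon (T : E) : monoid_morphism (@stab_end_pi T).
Proof. by split=> // f g; apply: esym; apply: stab_comp_pi. Qed.
HB.instance Definition _ (T : E) := GRing.isZmodMorphism.Build
  (end_op T) (end_op (T : stable E)) (@stab_end_pi T) (@stab_end_pi_zmod T).
HB.instance Definition _ (T : E) := GRing.isMonoidMorphism.Build
  (end_op T) (end_op (T : stable E)) (@stab_end_pi T) (@stab_end_pi_mon T).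

Section Exchange.
Variables (n : nat) (T_ : 'I_n -> E) (T : E) (k : 'I_n).

(* add(T/T_k), in the stable category *)
Definition stab_add_others (X : stable E) : Prop :=
  exists U : stable E,
    is_dsum (fun j : 'I_n.-1 => T_ (fintype.lift k j) : stable E) U /\ in_add U X.

(* A pair of exchange sequences Tk' -> Y -> T_k and T_k -> X -> Tk'. An exchange
   triangle of T_k is a triangle in the stable category whose map to (from) T_k
   is a minimal right (left) add(T/T_k)-approximation, and the triangles of the
   stable category are those isomorphic to images of conflations. *)
Record exchange := Exchange {
  ex_star : E; ex_X : E; ex_Y : E;
  ex_i : hom ex_star ex_Y; ex_p : hom ex_Y (T_ k);
  ex_j : hom (T_ k) ex_X; ex_q : hom ex_X ex_star;
  ex_conflY : confl ex_i ex_p;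
  ex_conflX : confl ex_j ex_q;
  ex_nonsplitY : ~ split_epi ex_p;
  ex_nonsplitX : ~ split_epi ex_q;
  ex_addX : in_add T ex_X;
  ex_addY : in_add T ex_Y;
  ex_stabY : min_right_approx (E := stable E) stab_add_others (stab_pi ex_p);
  ex_stabX : min_left_approx (E := stable E) stab_add_others (stab_pi ex_j);
  ex_sink : right_almost_split (in_add T) ex_p;
  ex_source : left_almost_split (in_add T) ex_j }.
End Exchange.

Definition K0_rel (u : freeab E) : Prop :=
  exists (X Y Z : E) (i : hom X Y) (p : hom Y Z),
    confl i p /\ u = fgen Y - fgen X - fgen Z.
Definition K0 : zmodType := zquot K0_rel.
Definition K0_class (X : E) : K0 := zpi K0_rel (fgen X).

Variable T : E.

Definition addT : Type := {X : E | in_add T X}.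

Definition K0add_rel (u : freeab addT) : Prop :=
  exists (X Y Z : addT) (B : biproduct (sval X) (sval Y)),
    iso (sval Z) (bsum B) /\ u = fgen Z - fgen X - fgen Y.
Definition K0add : zmodType := zquot K0add_rel.
Definition K0add_class (X : E) (hX : in_add T X) : K0add :=
  zpi K0add_rel (fgen (exist (in_add T) X hX : addT)).

Variables (n r : nat) (T_ : 'I_n -> E).

Definition exchange_rel (ex : forall k : 'I_n, (k < r)%N -> exchange T_ T k)
    (u : K0add) : Prop :=
  exists (k : 'I_n) (hk : (k < r)%N),
    u = K0add_class (ex_addX (ex k hk)) - K0add_class (ex_addY (ex k hk)).

Variable B : zmodType.

Definition is_grading (G : tensor (K0fd (end_op T)) B) : Prop :=
  forall M : lmodType (end_op (T : stable E)), fin_gen M ->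
    euler_tensor (restr (@stab_end_pi T) M) G = 0.

Definition degree (G : tensor (K0fd (end_op T)) B) (X : E) : B :=
  euler_tensor (Fobj T X) G.

End Frobenius.

(* Main.v *)
(** Every X in E has a conflation T1 -> T0 -> X with T0, T1 in add T, unique up
    to Schanuel, and so an index [T0] - [T1] in K_0(add T).  On a conflation
    X -> Y -> Z the index fails to be additive by the class of the cokernel of
    Hom(T, Y) -> Hom(T, Z), a finite dimensional module over the stable
    endomorphism algebra.

    For (i), that cokernel is filtered by simple modules on which only some T_k
    with k < r acts, and each of them contributes the defect of the exchange
    sequence ending in T_k, which is [X_k] - [Y_k].  So the index is a
    well-defined inverse of the obvious map from K_0(add T) modulo the exchange
    relations to K_0(E).

    For (ii), a grading is orthogonal to these cokernels, so its degree function
    is additive on conflations.  Conversely every finitely generated module over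
    the stable endomorphism algebra has the form
    coker(Hom(T, T1) -> Hom(T, T0)) for a conflation X -> T1 -> T0, hence class
    [T0] - [T1] + [X], which additive functions on K_0(E) annihilate.  The
    simple modules S_k are one-dimensional because C is algebraically closed,
    they span K_0(fd), and they are dual to the Hom(T, T_k) for the Euler form;
    this turns additive functions into gradings and conversely.  The Euler form
    itself is computed from the fact that the dimension of
    Hom(Hom(T, X), N), for X in add T, is Hattori's trace of the identity of X,
    which is visibly additive in X and in N. *)

From HB Require Import structures.
From mathcomp Require Import freeg.
From mathcomp Require Import all_boot all_order all_algebra complex reals.
From mathcomp Require Import generic_quotient ring_quotient.
From mathcomp Require Import boolp classical_sets fsbigop.
From mathcomp Require Import zify.
Require Import Defs.

Set Implicit Arguments.
Unset Strict Implicit.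
Unset Printing Implicit Defensive.

Import GRing.Theory Num.Theory.
Local Open Scope ring_scope.

(** [ext_dim] has the value 0 where no finite dimension exists, and [zlift] says something only
    about maps known to kill the relations. The tool is [has_euler_class M v]: one class v in
    K_0(add T) computes the pairing of M with every finite dimensional N, as a trace. Such a v is
    produced by an explicit resolution of M by modules Hom(T, P) with P in add T, and bilinearity
    then comes from the additivity of [hattori N v] in v and in N. Traces take values in the field
    and Euler characteristics in the integers; characteristic 0 allows the return.

    In (i) no filtration of a cokernel is constructed. The index is composed at once with an
    additive map [phi] that equates [X_k] and [Y_k], and Y is enlarged by summands T_k until the
    deflation becomes surjective on Hom(T, -). *)

(** * Free abelian groups, their quotients, and dependent families *)

Lemma freeab_ind (X : Type) (P : freeab X -> Prop) :
  P 0 -> (forall x y, P x -> P y -> P (x - y)) -> (forall x, P (fgen x)) ->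
  forall u, P u.
Proof.
move=> P0 PB Pg u.
have PN x : P x -> P (- x) by move=> Px; rewrite -[- x]add0r; exact: PB.
have PD x y : P x -> P y -> P (x + y).
  by move=> Px Py; rewrite -[y]opprK; apply: PB => //; exact: PN.
have PMn x m : P x -> P (x *+ m).
  by move=> Px; elim: m => [|m IH]; rewrite ?mulr0n ?mulrS //; exact: PD.
have PMz x (m : int) : P x -> P (x *~ m).
  by move=> Px; case: m => m; [exact: PMn | apply/PN/PMn].
elim/(@freeg_ind_dom0 int {classic X}) : u => // k x D _ _ PD'.
apply: PD => //; have -> : << k *g x >> = fgen (x : X) *~ k.
  by rewrite /fgen freegU_mulz intz.
exact: PMz.
Qed.

Lemma zquot_ind (V : zmodType) (rel : V -> Prop) (P : zquot rel -> Prop) :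
  (forall v, P (zpi rel v)) -> forall q, P q.
Proof. by move=> H q; rewrite -[q]reprK; exact: H. Qed.

Lemma zpi_rel (V : zmodType) (rel : V -> Prop) v : rel v -> zpi rel v = 0.
Proof.
move=> hv; rewrite -(raddf0 (zpi rel)); apply/eqP.
rewrite /zpi -Quotient.idealrBE subr0 inE => P _ _ Prel.
exact: Prel.
Qed.

Lemma zquot_map (V A : zmodType) (rel : V -> Prop) (h : {additive V -> A}) :
  (forall v, rel v -> h v = 0) ->
  exists g : {additive zquot rel -> A}, forall v, g (zpi rel v) = h v.
Proof.
move=> hrel.
have add : zmod_morphism (zlift h : zquot rel -> A).
  elim/zquot_ind=> v; elim/zquot_ind=> w.
  by rewrite -raddfB !zliftE // raddfB.
pose M := GRing.isZmodMorphism.Build (zquot rel) A _ add.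
pose g : {additive zquot rel -> A} := HB.pack (zlift h : zquot rel -> A) M.
by exists g => v; exact: zliftE.
Qed.

Lemma additive_zquot_ext (X : Type) (rel : freeab X -> Prop) (A : zmodType)
    (f g : {additive zquot rel -> A}) :
  (forall x, f (zpi rel (fgen x)) = g (zpi rel (fgen x))) -> f =1 g.
Proof.
move=> fg; elim/zquot_ind; elim/freeab_ind => [|x y hx hy|//].
  by rewrite !raddf0.
by rewrite !raddfB hx hy.
Qed.

Lemma zquot_gen_ind (X : Type) (rel : freeab X -> Prop) (P : zquot rel ->
  Prop) :
  P 0 -> (forall x y, P x -> P y -> P (x - y)) ->
  (forall x, P (zpi rel (fgen x))) -> forall u, P u.
Proof.
move=> P0 PB Pg; elim/zquot_ind; elim/freeab_ind => [|x y hx hy|//].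
  by rewrite raddf0.
by rewrite raddfB; exact: PB.
Qed.

(** The entries live in types that depend on the index, such as [hom (F k) S], so head and tail are
    joined by transport along equalities of ordinals, which are proof-irrelevant. *)
Lemma ord_cons n (P : 'I_n.+1 -> Type) (x0 : P ord0)
    (xS : forall j, P (lift ord0 j)) :
  exists x : forall k, P k, x ord0 = x0 /\ forall j, x (lift ord0 j) = xS j.
Proof.
have D (k : 'I_n.+1) : (k = ord0) + {j | k = lift ord0 j}.
  by case: (unliftP ord0 k) => [j|] ->; [right; exists j | left].
exists (fun k => match D k with
  | inl e => eq_rect_r P x0 e
  | inr (exist j e) => eq_rect_r P (xS j) e end); split=> [|j].
  by case: (D ord0) => [e|[j /eqP]] //; rewrite (eq_irrelevance e erefl).
case: (D (lift ord0 j)) => [/eqP //|[j' e]].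
have ejj := lift_inj e; move: e; rewrite -ejj => e.
by rewrite (eq_irrelevance e erefl).
Qed.

(** * Direct sums and local endomorphism rings *)

Section LinCat.
Variables (K : fieldType) (E : linCat K).
Implicit Types X Y Z W : E.

Lemma comp_sumr X Y Z n (g : hom Y Z) (f : 'I_n -> hom X Y) :
  g \c (\sum_k f k) = \sum_k g \c f k.
Proof. by apply: (big_morph _ (fun x y => compDr g x y)); exact: compm0. Qed.

Lemma comp_suml X Y Z n (g : hom X Y) (f : 'I_n -> hom Y Z) :
  (\sum_k f k) \c g = \sum_k f k \c g.
Proof. by apply: (big_morph _ (fun x y => compDl x y g)); exact: comp0m. Qed.

Lemma compNl X Y Z (g : hom Y Z) (f : hom X Y) : (- g) \c f = - (g \c f).
Proof. by rewrite -sub0r compBl comp0m sub0r. Qed.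

Lemma compNr X Y Z (g : hom Y Z) (f : hom X Y) : g \c (- f) = - (g \c f).
Proof. by rewrite -sub0r compBr compm0 sub0r. Qed.

Lemma zero_src X Y (f : hom X Y) : is_zero X -> f = 0.
Proof. by move=> X0; rewrite -[f]compm1 X0 compm0. Qed.

Lemma zero_tgt X Y (f : hom X Y) : is_zero Y -> f = 0.
Proof. by move=> Y0; rewrite -[f]comp1m Y0 comp0m. Qed.

Lemma is_iso_id X : is_iso (idm X).
Proof. by exists (idm X); rewrite comp1m. Qed.

Lemma is_iso_comp X Y Z (g : hom Y Z) (f : hom X Y) :
  is_iso g -> is_iso f -> is_iso (g \c f).
Proof.
move=> [g' [g1 g2]] [f' [f1 f2]]; exists (f' \c g'); split.
  by rewrite compA -(compA f') g1 compm1.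
by rewrite compA -(compA g) f2 compm1.
Qed.

Lemma iso_refl X : iso X X.
Proof. by exists (idm X); exact: is_iso_id. Qed.

Lemma iso_sym X Y : iso X Y -> iso Y X.
Proof. by move=> [f [g [fg gf]]]; exists g, f. Qed.

Lemma iso_trans X Y Z : iso X Y -> iso Y Z -> iso X Z.
Proof. by move=> [f fi] [g gi]; exists (g \c f); exact: is_iso_comp. Qed.

Lemma is_iso_split_epi X Y (f : hom X Y) : is_iso f -> split_epi f.
Proof. by move=> [g [_ fg]]; exists g. Qed.

Lemma split_epi_compl X Y Z (g : hom Y Z) (f : hom X Y) :
  split_epi (g \c f) -> split_epi g.
Proof. by move=> [s hs]; exists (f \c s); rewrite compA. Qed.

Lemma is_iso_split_epi_comp X Y Z (g : hom Y Z) (f : hom X Y) :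
  is_iso (g \c f) -> split_epi g.
Proof. by move/is_iso_split_epi/split_epi_compl. Qed.

Definition bswap X Y (B : biproduct X Y) : biproduct Y X.
Proof.
apply: (@Biproduct _ _ Y X (bsum B) (binr B) (binl B) (bprr B) (bprl B)).
- exact: bprr_inr.
- exact: bprl_inl.
- exact: bprr_inl.
- exact: bprl_inr.
- by rewrite addrC; exact: bsum_id.
Defined.

(** For a section s of r, the endomorphism [s \c r] of Y is idempotent, and in a local ring it or
    its complement is invertible. An invertible idempotent is the identity; the complement
    annihilates s, so if it is invertible then s = 0 and X = 0. *)
Lemma local_split_epi_iso X Y (r : hom Y X) :
  local_end Y -> ~ is_zero X -> split_epi r -> is_iso r.
Proof.
move=> [_ lY] nX [s rs].
have [srI|nI] := pselect (is_iso (s \c r)).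
  exists s; split => //; have [t [_ t2]] := srI.
  have e : (s \c r) \c (s \c r) = s \c r by rewrite compA -(compA s) rs compm1.
  have : (s \c r) \c (s \c r) \c t = (s \c r) \c t by rewrite e.
  by rewrite -compA t2 compm1.
have [tI|nI'] := pselect (is_iso (idm Y - s \c r)).
  have [t [t1 _]] := tI; case: nX.
  suff s0 : s = 0 by rewrite /is_zero -rs s0 compm0.
  by rewrite -[s]comp1m -t1 -compA compBl comp1m -compA rs compm1 subrr compm0.
by case: (lY _ _ nI nI'); rewrite addrC subrK; exact: is_iso_id.
Qed.

(** Composing with a section moves the sum into the local ring End X. Maps into X that are not split
    epi thus form the radical of Hom(-, X), and radicals are expressed in this way throughout. *)
Lemma local_split_epiD X W (f g : hom W X) :
  local_end X -> ~ split_epi f -> ~ split_epi g -> ~ split_epi (f + g).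
Proof.
move=> [_ lX] nf ng [s]; rewrite compDl => fgs.
have nf' : ~ is_iso (f \c s) by move/is_iso_split_epi_comp.
have ng' : ~ is_iso (g \c s) by move/is_iso_split_epi_comp.
by case: (lX _ _ nf' ng'); rewrite fgs; exact: is_iso_id.
Qed.

Lemma local_nonsplit0 X W : local_end X -> ~ split_epi (0 : hom W X).
Proof. by move=> [nX _] [s]; rewrite comp0m => h; apply: nX. Qed.

Lemma local_split_epi_sum X W n (f : 'I_n -> hom W X) :
  local_end X -> (forall k, ~ split_epi (f k)) -> ~ split_epi (\sum_k f k).
Proof.
move=> lX nf; elim/big_ind : _ => //; first exact: local_nonsplit0.
by move=> x y; exact: local_split_epiD.
Qed.

Lemma local_split_epiZ X W c (f : hom W X) :
  local_end X -> ~ split_epi f -> ~ split_epi (c *: f).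
Proof.
move=> lX nf [s]; rewrite compZl => h; apply: nf; exists (c *: s).
by rewrite compZr.
Qed.

Lemma local_is_iso_1B X (f : hom X X) :
  local_end X -> ~ is_iso f -> is_iso (idm X - f).
Proof.
move=> [_ lX] nf; apply: contrapT => nf'; apply: (lX _ _ nf nf').
by rewrite addrC subrK; exact: is_iso_id.
Qed.

Lemma dsum_exists (hadd : additive_cat E) n (F : 'I_n -> E) :
  exists S, is_dsum F S.
Proof.
have [[Z Z0] hB] := hadd.
elim: n F => [|n IH] F.
  exists Z, (fun=> 0), (fun=> 0); split=> [[]//|[]//|].
  by rewrite big_ord0 Z0.
have [S [i [p [h1 h2 h3]]]] := IH (fun j => F (lift ord0 j)).
have [B] := hB (F ord0) S.
have [x [x0 xS]] := @ord_cons n (fun k => hom (F k) (bsum B))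
  (binl B) (fun j => binr B \c i j).
have [y [y0 yS]] := @ord_cons n (fun k => hom (bsum B) (F k))
  (bprl B) (fun j => p j \c bprr B).
exists (bsum B), x, y; split.
- move=> k; case: (unliftP ord0 k) => [j|] ->.
    by rewrite xS yS compA -(compA (p j)) bprr_inr compm1 h1.
  by rewrite x0 y0 bprl_inl.
- move=> k l; case: (unliftP ord0 k) => [j|] ->;
    case: (unliftP ord0 l) => [j'|] -> nkl.
  + rewrite xS yS compA -(compA (p j)) bprr_inr compm1 h2 //.
    by move=> e; apply: nkl; rewrite e.
  + by rewrite x0 yS -compA bprr_inl compm0.
  + by rewrite xS y0 compA bprl_inr comp0m.
  + by case: nkl.
- rewrite big_ord_recl x0 y0.
  under eq_bigr => j _ do rewrite xS yS compA -(compA (binr B)).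
  by rewrite -comp_suml -comp_sumr h3 compm1 bsum_id.
Qed.

(** The object of the biproduct is X itself, by an equality and not an isomorphism, so that facts
    about X transfer by rewriting. *)
Lemma dsum_split (hadd : additive_cat E) n (F : 'I_n.+1 -> E) X :
  is_dsum F X -> exists S (B : biproduct (F ord0) S),
    is_dsum (fun j => F (lift ord0 j)) S /\ bsum B = X.
Proof.
move=> [i [p [h1 h2 h3]]].
have [S dS] := dsum_exists hadd (fun j => F (lift ord0 j)).
have [i' [p' [h1' h2' h3']]] := dS.
pose ir := \sum_j i (lift ord0 j) \c p' j.
pose pr := \sum_j i' j \c p (lift ord0 j).
have pi j l : p (lift ord0 j) \c i (lift ord0 l) \c p' l =
    if j == l then p' j else 0.
  case: eqP => [->|njl]; first by rewrite h1 comp1m.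
  by rewrite h2 ?comp0m // => /lift_inj.
have pi' j l : p' j \c i' l \c p (lift ord0 l) =
    if j == l then p (lift ord0 j) else 0.
  case: eqP => [->|njl]; first by rewrite h1' comp1m.
  by rewrite h2' ?comp0m.
have sumif (Y W : E) (j : 'I_n) (f : hom Y W) :
    \sum_(l < n) (if j == l then f else 0) = f.
  by rewrite (bigD1 j) //= eqxx big1 ?addr0 // => l;
    rewrite eq_sym => /negbTE->.
exists S.
unshelve eexists (@Biproduct _ _ _ _ X (i ord0) ir (p ord0) pr _ _ _ _ _).
- exact: h1.
- rewrite /ir /pr comp_suml -[RHS]h3'; apply: eq_bigr => j _.
  rewrite -compA comp_sumr; congr (_ \c _).
  rewrite -[RHS](sumif _ _ j (p' j)); apply: eq_bigr => l _.
  by rewrite compA pi.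
- rewrite /ir comp_sumr big1 // => j _; rewrite compA h2 ?comp0m //.
- rewrite /pr comp_suml big1 // => j _; rewrite -compA h2 ?compm0 //.
- rewrite -[RHS]h3 big_ord_recl; congr (_ + _).
  rewrite /ir /pr comp_suml; apply: eq_bigr => j _.
  rewrite -compA comp_sumr; congr (_ \c _).
  rewrite -[RHS](sumif _ _ j (p (lift ord0 j))).
  by apply: eq_bigr => l _; rewrite compA pi'.
- by split.
Qed.

(** A Krull-Schmidt decomposition of an indecomposable object has one nonzero summand, isomorphic to
    X; conjugation carries its locality over to X. *)
Lemma indecomposable_local (hadd : additive_cat E) (hKS : krull_schmidt E) X :
  indecomposable X -> local_end X.
Proof.
move=> [nX iX]; have [[|n] [F [dF lF]]] := hKS X.
  case: dF => [i [p [_ _]]]; rewrite big_ord0 => /esym h;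
    exact: False_ind (nX h).
have [S [B [_ eB]]] := dsum_split hadd dF.
have XB : iso X (bsum B) by rewrite eB; exact: iso_refl.
have [nF0 lF0] := lF ord0.
have [//|S0] := iX _ _ B XB.
have {XB} [f [g [gf fg]]] : iso (F ord0) X.
  rewrite -eB; exists (binl B), (bprl B); split; first exact: bprl_inl.
  by rewrite -(bsum_id B) (zero_tgt (bprr B) S0) compm0 addr0.
have iso_conj (h : hom X X) : is_iso h <-> is_iso (g \c h \c f).
  split=> [hi|hi].
    apply: is_iso_comp; last by exists g.
    by apply: is_iso_comp => //; exists f.
  have -> : h = f \c (g \c h \c f) \c g.
    by rewrite !compA fg comp1m -compA fg compm1.
  apply: is_iso_comp; last by exists f.
  by apply: is_iso_comp => //; exists g.
split=> // u v nu nv /iso_conj; rewrite compDr compDl; apply: lF0.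
  by move/iso_conj.
by move/iso_conj.
Qed.

Lemma ker_mono X Y Z W (i : hom X Y) (p : hom Y Z) (g h : hom W X) :
  is_kernel i p -> i \c g = i \c h -> g = h.
Proof.
move=> [pi0 ki] e; have [|k [_ uk]] := ki W (i \c h).
  by rewrite compA pi0 comp0m.
by rewrite -(uk g) // (uk h).
Qed.

Lemma ker_fact X Y Z W (i : hom X Y) (p : hom Y Z) (f : hom W Y) :
  is_kernel i p -> p \c f = 0 -> exists g, i \c g = f.
Proof. by move=> [_ ki] /ki [g [hg _]]; exists g. Qed.

Lemma coker_epi X Y Z W (i : hom X Y) (p : hom Y Z) (g h : hom Z W) :
  is_cokernel i p -> g \c p = h \c p -> g = h.
Proof.
move=> [pi0 ki] e; have [|k [_ uk]] := ki W (h \c p).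
  by rewrite -compA pi0 compm0.
by rewrite -(uk g) // (uk h).
Qed.

Lemma coker_fact X Y Z W (i : hom X Y) (p : hom Y Z) (f : hom Y W) :
  is_cokernel i p -> f \c i = 0 -> exists g, g \c p = f.
Proof. by move=> [_ ki] /ki [g [hg _]]; exists g. Qed.

Lemma kernel_unique X X' Y Z (i : hom X Y) (i' : hom X' Y) (p : hom Y Z) :
  is_kernel i p -> is_kernel i' p ->
  exists a : hom X' X, is_iso a /\ i \c a = i'.
Proof.
move=> ki ki'; have [a ha] := ker_fact ki (proj1 ki').
have [b hb] := ker_fact ki' (proj1 ki).
exists a; split=> //; exists b; split.
  by apply: (ker_mono ki'); rewrite compA hb ha compm1.
by apply: (ker_mono ki); rewrite compA ha hb compm1.
Qed.

Lemma cokernel_unique X Y Z Z' (i : hom X Y) (p : hom Y Z) (p' : hom Y Z') :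
  is_cokernel i p -> is_cokernel i p' ->
  exists a : hom Z Z', is_iso a /\ a \c p = p'.
Proof.
move=> ki ki'; have [a ha] := coker_fact ki (proj1 ki').
have [b hb] := coker_fact ki' (proj1 ki).
exists a; split=> //; exists b; split.
  by apply: (coker_epi ki); rewrite -compA ha hb comp1m.
by apply: (coker_epi ki'); rewrite -compA hb ha comp1m.
Qed.

Lemma is_pullback_sym X Y Z W (p : hom Y Z) (f : hom W Z)
    (f' : hom X Y) (p' : hom X W) :
  is_pullback p f f' p' -> is_pullback f p p' f'.
Proof.
move=> [e h]; split=> // V u v uv; have [w [[w1 w2] uw]] := h V v u (esym uv).
by exists w; split=> // w' [w1' w2']; apply: uw.
Qed.

Lemma pullback_ext X Y Z W V (p : hom Y Z) (f : hom W Z)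
    (f' : hom X Y) (p' : hom X W) (g h : hom V X) :
  is_pullback p f f' p' -> f' \c g = f' \c h -> p' \c g = p' \c h -> g = h.
Proof.
move=> [e u] e1 e2; have [|w [_ uw]] := u V (f' \c h) (p' \c h).
  by rewrite !compA e.
by rewrite -(uw g) // (uw h).
Qed.

Lemma pullback_fact X Y Z W V (p : hom Y Z) (f : hom W Z)
    (f' : hom X Y) (p' : hom X W) (u : hom V Y) (v : hom V W) :
  is_pullback p f f' p' -> p \c u = f \c v ->
  exists g, f' \c g = u /\ p' \c g = v.
Proof. by move=> [_ h] /h [w [hw _]]; exists w. Qed.

Lemma pullback_unique X X1 Y Z W (p : hom Y Z) (f : hom W Z)
    (f' : hom X Y) (p' : hom X W) (f1 : hom X1 Y) (p1 : hom X1 W) :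
  is_pullback p f f' p' -> is_pullback p f f1 p1 ->
  exists a : hom X1 X, is_iso a /\ p' \c a = p1.
Proof.
move=> P Q; have [a [a1 a2]] := pullback_fact P (proj1 Q).
have [b [b1 b2]] := pullback_fact Q (proj1 P).
exists a; split=> //; exists b; split.
  by apply: (pullback_ext Q); rewrite compA ?b1 ?b2 ?a1 ?a2 compm1.
by apply: (pullback_ext P); rewrite compA ?a1 ?a2 ?b1 ?b2 compm1.
Qed.

End LinCat.

(** * Exact categories *)

Section ExactCat.
Variables (K : fieldType) (E : exactCat K).
Implicit Types X Y Z W : E.

Let ex := exact_exact E.
Let hadd := exact_additive E.

Lemma confl_ker X Y Z (i : hom X Y) (p : hom Y Z) : confl i p -> is_kernel i p.
Proof. exact: (confl_kernel ex). Qed.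

Lemma confl_coker X Y Z (i : hom X Y) (p : hom Y Z) :
  confl i p -> is_cokernel i p.
Proof. exact: (confl_cokernel ex). Qed.

Lemma confl_comp0 X Y Z (i : hom X Y) (p : hom Y Z) : confl i p -> p \c i = 0.
Proof. by case/confl_ker. Qed.

Lemma confl_of_ker X Y Z (i : hom X Y) (p : hom Y Z) :
  deflation (@confl K E) p -> is_kernel i p -> confl i p.
Proof.
move=> [X0 [i0 c0]] ki; have [a [ai ha]] := kernel_unique ki (confl_ker c0).
apply: (confl_iso ex ai (is_iso_id Y) (is_iso_id Z) _ _ c0).
  by rewrite comp1m.
by rewrite comp1m compm1.
Qed.

Lemma confl_of_coker X Y Z (i : hom X Y) (p : hom Y Z) :
  inflation (@confl K E) i -> is_cokernel i p -> confl i p.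
Proof.
move=> [Z0 [p0 c0]] ki; have [a [ai ha]] := cokernel_unique (confl_coker c0) ki.
apply: (confl_iso ex (is_iso_id X) (is_iso_id Y) ai _ _ c0).
  by rewrite comp1m compm1.
by rewrite compm1.
Qed.

Lemma deflation_iso X X' Z (p : hom X Z) (p' : hom X' Z) (a : hom X X') :
  is_iso a -> p' \c a = p -> deflation (@confl K E) p ->
    deflation (@confl K E) p'.
Proof.
move=> ai e [Y [i c]]; exists Y, (a \c i).
apply: (confl_iso ex (is_iso_id Y) ai (is_iso_id Z) _ _ c).
  by rewrite compm1.
by rewrite comp1m.
Qed.

Lemma pullback_deflation X Y Z W (p : hom Y Z) (f : hom W Z) (f' : hom X Y)
    (p' : hom X W) :
  is_pullback p f f' p' -> deflation (@confl K E) p ->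
    deflation (@confl K E) p'.
Proof.
move=> P dp; have [Q [f1 [p1 [P1 dp1]]]] := deflation_pullback ex f dp.
have [a [ai ha]] := pullback_unique P P1.
exact: (deflation_iso ai ha dp1).
Qed.

Lemma pullback_confl X Y Z W V (i : hom V Y) (p : hom Y Z) (f : hom W Z)
    (f' : hom X Y) (p' : hom X W) :
  is_pullback p f f' p' -> confl i p -> exists i', confl i' p' /\ f' \c i' = i.
Proof.
move=> P c; have [|i' [e1 e2]] := pullback_fact P (u := i) (v := 0 : hom V W).
  by rewrite compm0 (confl_comp0 c).
exists i'; split=> //; apply: confl_of_ker.
  by apply: (pullback_deflation P); exists V, i.
split=> // U g pg; have [|h hh] := ker_fact (confl_ker c) (f := f' \c g).
  by rewrite compA (proj1 P) -compA pg compm0.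
exists h; split=> [|h' hh'].
  by apply: (pullback_ext P); rewrite compA ?e1 // e2 comp0m pg.
apply: (ker_mono (confl_ker c)).
by rewrite -e1 -!compA hh' -hh compA e1.
Qed.

Lemma pullback_exists Y Z W (p : hom Y Z) (f : hom W Z) :
  deflation (@confl K E) p ->
  exists X (f' : hom X Y) (p' : hom X W), is_pullback p f f' p'.
Proof.
by move=> /(deflation_pullback ex f) [X [f' [p' [P _]]]]; exists X, f', p'.
Qed.

Lemma pushout_confl X Y Z W (i : hom X Y) (p : hom Y Z) (f : hom X W) :
  confl i p -> exists V (f' : hom Y V) (i' : hom W V) (p' : hom V Z),
    [/\ confl i' p', p' \c f' = p & f' \c i = i' \c f].
Proof.
move=> c; have [|V [f' [i' [[e u] di']]]] := inflation_pushout ex f (i := i).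
  by exists Z, p.
have uni U (g h : hom V U) : g \c f' = h \c f' -> g \c i' = h \c i' -> g = h.
  move=> e1 e2; have [|w [_ uw]] := u U (h \c f') (h \c i').
    by rewrite -!compA e.
  by rewrite -(uw g) // (uw h).
have [|p' [[e1 e2] _]] := u Z p (0 : hom W Z).
  by rewrite comp0m (confl_comp0 c).
exists V, f', i', p'; split=> //; apply: confl_of_coker => //.
split=> // U g gi; have [|h hh] := coker_fact (confl_coker c) (f := g \c f').
  by rewrite -compA e compA gi comp0m.
exists h; split=> [|h' hh'].
  by apply: uni; rewrite -compA ?e1 // e2 compm0 gi.
by apply: (coker_epi (confl_coker c)); rewrite -e1 !compA hh' -compA e1 hh.
Qed.

Lemma biproduct_is_kernel X Y (B : biproduct X Y) :
  is_kernel (binl B) (bprr B).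
Proof.
split=> [|W f fB]; first exact: bprr_inl.
exists (bprl B \c f); split=> [|g <-]; last by rewrite compA bprl_inl comp1m.
by rewrite -[RHS]comp1m -(bsum_id B) compDl -(compA (binr B)) fB compm0 addr0
  compA.
Qed.

(** [bprr B] is the pullback of the deflation X -> 0 along Y -> 0, and X -> 0 is a deflation because
    it is the cokernel of the inflation [idm X]. *)
Lemma biproduct_confl X Y (B : biproduct X Y) : confl (binl B) (bprr B).
Proof.
apply: confl_of_ker (biproduct_is_kernel B).
have [Z [q c]] := inflation_id ex X.
have Z0 : is_zero Z.
  apply: (coker_epi (confl_coker c)).
  by rewrite comp0m comp1m -[q]compm1 (confl_comp0 c).
have dq : deflation (@confl K E) q by exists X, (idm X).
apply: (pullback_deflation (f := (0 : hom Y Z)) (f' := bprl B) _ dq).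
split=> [|W u v _]; first by rewrite comp0m (zero_tgt q Z0) comp0m.
exists (binl B \c u + binr B \c v); split=> [|w [<- <-]].
  by rewrite !compDr !compA bprl_inl bprl_inr bprr_inl bprr_inr
    !comp1m !comp0m addr0 add0r.
by rewrite !compA -compDl bsum_id comp1m.
Qed.

Lemma confl_split_biproduct X Y Z (i : hom X Y) (p : hom Y Z) :
  confl i p -> split_epi p -> exists B : biproduct X Z, bsum B = Y.
Proof.
move=> c [s ps]; have [|r hr] := ker_fact (confl_ker c) (f := idm Y - s \c p).
  by rewrite compBr compA ps compm1 comp1m subrr.
have ri : r \c i = idm X.
  apply: (ker_mono (confl_ker c)); rewrite compA hr compBl -compA.
  by rewrite (confl_comp0 c) compm0 subr0 comp1m compm1.
have rs : r \c s = 0.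
  apply: (ker_mono (confl_ker c)); rewrite compA hr compBl -compA ps.
  by rewrite comp1m compm1 subrr compm0.
have e : i \c r + s \c p = idm Y by rewrite hr subrK.
by exists (Biproduct ri ps rs (confl_comp0 c) e).
Qed.

Lemma confl_split_mono X Y Z (i : hom X Y) (p : hom Y Z) :
  confl i p -> split_mono i -> split_epi p.
Proof.
move=> c [r ri]; have [|s hs] := coker_fact (confl_coker c) (f := idm Y - i \c
  r).
  by rewrite compBl -compA ri compm1 comp1m subrr.
exists s; apply: (coker_epi (confl_coker c)).
by rewrite -compA hs compBr compA (confl_comp0 c) comp0m subr0 compm1 comp1m.
Qed.

Lemma confl_split_retract X Y Z (i : hom X Y) (p : hom Y Z) :
  confl i p -> split_epi p -> split_mono i.
Proof.
move=> c [s ps]; have [|r hr] := ker_fact (confl_ker c) (f := idm Y - s \c p).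
  by rewrite compBr compA ps compm1 comp1m subrr.
exists r; apply: (ker_mono (confl_ker c)).
by rewrite compA hr compBl -compA (confl_comp0 c) compm0 subr0 comp1m compm1.
Qed.

(* U is the pullback of V -> W along Q -> W. *)
Lemma confl_comp A Q W V Y (a : hom A Q) (q : hom Q W) (j : hom V W)
    (t : hom W Y) :
  confl a q -> confl j t -> exists U (k : hom U Q) (a' : hom A U) (q' : hom U
    V),
    confl k (t \c q) /\ confl a' q'.
Proof.
move=> caq cjt.
have [|U [k [q' P]]] := pullback_exists j (p := q); first by exists A, a.
have [a' [ca' _]] := pullback_confl P caq.
exists U, k, a', q'; split=> //; apply: confl_of_ker.
  by apply: (deflation_comp ex); [exists A, a | exists V, j].
split=> [|S g tg].
  by rewrite -compA (proj1 P) compA (confl_comp0 cjt) comp0m.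
have [|h hh] := ker_fact (confl_ker cjt) (f := q \c g); first by rewrite compA.
have [w [w1 w2]] := pullback_fact P (esym hh).
exists w; split=> // w' hw'; apply: (pullback_ext P); first by rewrite w1.
apply: (ker_mono (confl_ker cjt)).
by rewrite !compA -(proj1 P) -!compA w1 hw'.
Qed.

(** The map (p, f) factors as p + id : Y + W -> Z + W, a pullback of p, followed by (id, f) : Z + W
    -> Z, which a shear automorphism of Z + W turns into the projection. *)
Lemma deflation_sum Y Z W (B : biproduct Y W) (p : hom Y Z) (f : hom W Z) :
  deflation (@confl K E) p ->
  deflation (@confl K E) (p \c bprl B + f \c bprr B).
Proof.
move=> dp; have [_ /(_ Z W) [C]] := hadd.
pose t := binl C \c p \c bprl B + binr C \c bprr B.
pose q := bprl C + f \c bprr C.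
have tl : bprl C \c t = p \c bprl B.
  by rewrite /t compDr !compA bprl_inl bprl_inr comp1m comp0m addr0.
have tr : bprr C \c t = bprr B.
  by rewrite /t compDr !compA bprr_inl bprr_inr comp1m !comp0m add0r.
have -> : p \c bprl B + f \c bprr B = q \c t.
  by rewrite /q compDl -compA tl tr.
apply: (deflation_comp ex).
  apply: (pullback_deflation (f := bprl C) (f' := bprl B) _ dp).
  split=> [|S u v uv]; first by rewrite tl.
  have ext U (g h : hom U (bsum C)) :
      bprl C \c g = bprl C \c h -> bprr C \c g = bprr C \c h -> g = h.
    by move=> e1 e2; rewrite -[g]comp1m -[h]comp1m -(bsum_id C) !compDl
      -!compA e1 e2.
  exists (binl B \c u + binr B \c (bprr C \c v)); split=> [|w [wu wv]].
    have e1 : bprl B \c (binl B \c u + binr B \c (bprr C \c v)) = u.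
      by rewrite compDr !compA bprl_inl bprl_inr comp1m !comp0m addr0.
    have e2 : bprr B \c (binl B \c u + binr B \c (bprr C \c v)) = bprr C \c v.
      by rewrite compDr !compA bprr_inl bprr_inr comp1m !comp0m add0r.
    split=> //; apply: ext; first by rewrite compA tl -compA e1 uv.
    by rewrite compA tr e2.
  have e3 : bprr C \c (t \c w) = bprr B \c w by rewrite compA tr.
  by rewrite -wv e3 -wu !compA -compDl bsum_id comp1m.
have dl : deflation (@confl K E) (bprl C).
  by exists W, (binr C); exact: (biproduct_confl (bswap C)).
pose a g := idm (bsum C) - binl C \c g \c bprr C.
have ra g : bprr C \c a g = bprr C.
  by rewrite /a compBr !compA bprr_inl !comp0m subr0 compm1.
have aK g : a g \c a (- g) = idm _.
  by rewrite {1}/a compBl comp1m -compA ra /a compNr compNl opprK addrK.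
have ai : is_iso (a f).
  by exists (a (- f)); split; [rewrite -{2}[f]opprK aK | rewrite aK].
apply: (deflation_iso ai _ dl).
rewrite /q compDl -compA ra /a compBr compm1 !compA bprl_inl comp1m.
by rewrite subrK.
Qed.

Lemma is_zero_confl X : exists Z (i : hom Z X), is_zero Z /\ confl i (idm X).
Proof.
have [Z [i c]] := deflation_id ex X; exists Z, i; split=> //.
by apply: (ker_mono (confl_ker c)); rewrite compm0 compm1 -(comp1m i)
  (confl_comp0 c).
Qed.

End ExactCat.

(** * Cluster-tilting approximations and the index *)

Section PowerRetract.
Variables (K : fieldType) (E : linCat K).
Implicit Types T W : E.

(* W is a summand of a finite power of T, without reference to a complement. *)
Definition power_retract (T W : E) : Prop :=
  exists m (u : 'I_m -> hom W T) (v : 'I_m -> hom T W),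
    \sum_k v k \c u k = idm W.

Lemma in_add_power_retract T W : in_add T W -> power_retract T W.
Proof.
move=> [m [Y [B [i [p [_ _ h]]]]]].
exists m, (fun k => p k \c binl B), (fun k => bprl B \c i k).
under eq_bigr => k _ do rewrite compA -(compA _ (i k)).
by rewrite -comp_suml -comp_sumr h compm1 bprl_inl.
Qed.

End PowerRetract.

Section ClusterTilting.
Variables (K : fieldType) (E : exactCat K).
Implicit Types T X Y Z W : E.

Let hadd := exact_additive E.

Lemma stab_pi_sum X Y n (c : 'I_n -> K) (f : 'I_n -> hom X Y) :
  stab_pi (\sum_k c k *: f k) = \sum_k c k *: stab_pi (f k).
Proof.
elim: n c f => [|n IH] c f; last by rewrite !big_ord_recl stab_pi_linear IH.
rewrite !big_ord0; have := stab_pi_linear (-1) (0 : hom X Y) 0.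
by rewrite scaler0 addr0 scaleN1r => ->; rewrite addNr.
Qed.

Lemma stab_pi_eq X Y (f g : hom X Y) :
  stab_pi f = stab_pi g <-> factors_proj (f - g).
Proof. exact: lpiP. Qed.

Lemma factors_proj_lift X Y Z (p : hom Y Z) (f : hom X Z) :
  deflation (@confl K E) p -> factors_proj f -> exists h, p \c h = f.
Proof.
move=> dp [P [u [v [[pP _] ->]]]]; have [w hw] := pP _ _ p dp v.
by exists (w \c u); rewrite compA hw.
Qed.

Lemma in_add_self T : in_add T T.
Proof.
have [[Z Z0] /(_ T Z) [B]] := hadd.
have e : binl B \c bprl B = idm _.
  by rewrite -(bsum_id B) (zero_src (binr B) Z0) comp0m addr0.
exists 1%N, Z, B, (fun=> binl B), (fun=> bprl B); split=> [_|k l|].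
- exact: bprl_inl.
- by rewrite !ord1.
- by rewrite big_ord1.
Qed.

Variable T : E.
Hypothesis hT : cluster_tilting T.

Lemma add_ext_split W X (i : hom W X) (p : hom X T) :
  in_add T W -> confl i p -> split_epi p.
Proof. by move=> /(hT W) h c; apply: (h (Extn c)). Qed.

(** [in_add] asks for a complement, which a retract does not supply. The cluster-tilting condition
    replaces it: in an extension M of T by W, each component W -> T extends to M, since the pushout
    extension of T by T splits, and these extensions assemble to a retraction. *)
Lemma addP W : in_add T W <-> power_retract T W.
Proof.
split; first exact: in_add_power_retract.
move=> [m [u [v uv]]]; apply/hT => [[M i p c]];
  apply: (confl_split_mono c) => /=.
have ext k : exists w : hom M T, w \c i = u k.
  have [V [f' [i' [p' [c' _ e]]]]] := pushout_confl (u k) c.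
  have [r hr] := confl_split_retract c' (add_ext_split (in_add_self T) c').
  by exists (r \c f'); rewrite -compA e compA hr comp1m.
have [w hw] := choice ext; exists (\sum_k v k \c w k).
rewrite comp_suml -[RHS]uv; apply: eq_bigr => k _.
by rewrite -compA hw.
Qed.

Lemma add_lift X Y W (p : hom X Y) (f : hom W Y) :
  in_add T W -> (forall g : hom T W, exists h, p \c h = f \c g) ->
  exists h, p \c h = f.
Proof.
move=> /addP [m [u [v uv]]] H; have [w hw] := choice (fun k => H (v k)).
exists (\sum_k w k \c u k); rewrite comp_sumr -[RHS]compm1 -uv comp_sumr.
by apply: eq_bigr => k _; rewrite !compA hw.
Qed.

Lemma add_confl_split W X Y (i : hom W X) (p : hom X Y) :
  in_add T W -> in_add T Y -> confl i p -> split_epi p.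
Proof.
move=> hW hY c; have dp : deflation (@confl K E) p by exists W, i.
apply: (@add_lift _ _ Y p (idm Y) hY) => g; rewrite comp1m.
have [Q [f' [p' P]]] := pullback_exists g dp.
have [i' [c' _]] := pullback_confl P c.
have [s hs] := add_ext_split hW c'.
by exists (f' \c s); rewrite compA (proj1 P) -compA hs compm1.
Qed.

Lemma add_retract X W (s : hom X W) (r : hom W X) :
  in_add T W -> r \c s = idm X -> in_add T X.
Proof.
move=> /addP [m [u [v uv]]] rs; apply/addP.
exists m, (fun k => u k \c s), (fun k => r \c v k).
under eq_bigr => k _ do rewrite compA -(compA r).
by rewrite -comp_suml -comp_sumr uv compm1.
Qed.

Lemma add_iso X Y : iso X Y -> in_add T X -> in_add T Y.
Proof.
by move=> [f [g [_ gf]]] hX; apply: (@add_retract _ _ g f hX gf).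
Qed.

Lemma add_zero Z : is_zero Z -> in_add T Z.
Proof.
by move=> Z0; apply: (@add_retract _ _ 0 0 (in_add_self T)); rewrite comp0m Z0.
Qed.

Lemma add_bsum X Y (B : biproduct X Y) :
  in_add T X -> in_add T Y -> in_add T (bsum B).
Proof.
move=> /addP [m [u [v uv]]] /addP [m' [u' [v' uv']]]; apply/addP.
exists (m + m')%N, (fun k => match split k with
  | inl j => u j \c bprl B | inr j => u' j \c bprr B end),
  (fun k => match split k with
  | inl j => binl B \c v j | inr j => binr B \c v' j end).
rewrite big_split_ord /= -(bsum_id B); congr (_ + _).
  rewrite -[in RHS](compm1 (binl B)) -uv comp_sumr comp_suml.
  apply: eq_bigr => k _; case: split_ordP => j /eqP; last by rewrite eq_lrshift.
  by rewrite eq_lshift => /eqP <-; rewrite !compA.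
rewrite -[in RHS](compm1 (binr B)) -uv' comp_sumr comp_suml.
apply: eq_bigr => k _; case: split_ordP => j /eqP; first by rewrite eq_rlshift.
by rewrite eq_rshift => /eqP <-; rewrite !compA.
Qed.

Lemma injective_in_add X : injective_obj X -> in_add T X.
Proof.
move=> iX; apply/hT => [[M i p c]]; apply: (confl_split_mono c) => /=.
by apply: (iX _ _ i) => //; exists T, p.
Qed.

Definition Tsurj X Y (p : hom X Y) : Prop :=
  forall g : hom T Y, exists h, p \c h = g.

Lemma Tsurj_add X Y W (p : hom X Y) (f : hom W Y) :
  Tsurj p -> in_add T W -> exists h, p \c h = f.
Proof. by move=> sp hW; apply: add_lift => // g. Qed.

(** This is the exact sequence Hom(T, W) -> Hom(T, Y) -> Ext^1(T, X) -> Ext^1(T, W) = 0 traced on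
    one extension M: i extends to M, and the induced map T -> Y is lifted to W in order to correct
    that extension. *)
Lemma add_kernel X W Y (i : hom X W) (p : hom W Y) :
  in_add T W -> Tsurj p -> confl i p -> in_add T X.
Proof.
move=> hW sp c; apply/hT => [[M j q cj]]; apply: (confl_split_mono cj) => /=.
have [V [f' [i' [p' [c' e' e]]]]] := pushout_confl i cj.
have [r hr] := confl_split_retract c' (add_ext_split hW c').
have rj : r \c f' \c j = i by rewrite -compA e compA hr comp1m.
have [|t ht] := coker_fact (confl_coker cj) (f := p \c r \c f').
  by rewrite -!compA (compA r) rj (confl_comp0 c).
have [t' ht'] := sp t.
have [|s hs] := ker_fact (confl_ker c) (f := r \c f' - t' \c q).
  by rewrite compBr !compA ht' ht subrr.
exists s; apply: (ker_mono (confl_ker c)).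
by rewrite compA hs compBl rj -compA (confl_comp0 cj) compm0 subr0 compm1.
Qed.

Hypothesis hfrob : frobenius E.
Hypothesis hfin : forall X Y, fin_dim (stab_hom X Y).

(** Source of all finiteness: maps that vanish stably lift along a deflation, so the cokernel of
    Hom(T, p) is a quotient of a finite dimensional stable Hom space. *)
Lemma stab_span X Y (p : hom X Y) : deflation (@confl K E) p ->
  exists m (b : 'I_m -> hom T Y), forall g : hom T Y,
    exists (c : 'I_m -> K) h, g = \sum_k c k *: b k + p \c h.
Proof.
move=> dp; have [m [b hb]] := hfin T Y.
exists m, (fun k => lrepr (b k)) => g.
have [c hc] := hb (stab_pi g).
have /stab_pi_eq /(factors_proj_lift dp) [h hh] :
    stab_pi g = stab_pi (\sum_k c k *: lrepr (b k)).
  rewrite stab_pi_sum hc; apply: eq_bigr => k _.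
  by rewrite -[in LHS](lreprK (b k)).
by exists c, h; rewrite hh addrC subrK.
Qed.

(** One copy of T is added to W for each b k. The image on Hom(T, -) is recorded exactly, since
    presenting a given module later requires prescribing it. *)
Lemma deflation_extend Y m (b : 'I_m -> hom T Y) W (p : hom W Y) :
  in_add T W -> deflation (@confl K E) p ->
  exists W' (p' : hom W' Y), [/\ in_add T W', deflation (@confl K E) p'
    & forall g : hom T Y, (exists h, p' \c h = g) <->
        exists (f : 'I_m -> hom T T) h, g = \sum_k b k \c f k + p \c h].
Proof.
elim: m b W p => [|m IH] b W p hW dp.
  exists W, p; split=> // g; split=> [[h <-]|[f [h ->]]].
    by exists (fun=> 0), h; rewrite big_ord0 add0r.
  by exists h; rewrite big_ord0 add0r.
have [_ /(_ W T) [B]] := hadd.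
have [W' [p' [hW' dp' H]]] := IH (fun k => b (lift ord0 k)) (bsum B)
  (p \c bprl B + b ord0 \c bprr B) (add_bsum B hW (in_add_self T))
  (deflation_sum B (b ord0) dp).
exists W', p'; split=> // g; rewrite H; split=> [[f [h ->]]|[f [h ->]]].
  have [x [x0 xS]] := @ord_cons m (fun=> hom T T) (bprr B \c h) f.
  exists x, (bprl B \c h); rewrite big_ord_recl x0.
  under [in RHS]eq_bigr do rewrite xS.
  by rewrite compDl !compA [RHS]addrC [_ + \sum_k _]addrC addrCA.
exists (fun k => f (lift ord0 k)), (binl B \c h + binr B \c f ord0).
rewrite big_ord_recl; set s := binl B \c h + _.
have el : bprl B \c s = h.
  by rewrite compDr !compA bprl_inl bprl_inr comp1m comp0m addr0.
have er : bprr B \c s = f ord0.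
  by rewrite compDr !compA bprr_inl bprr_inr comp1m comp0m add0r.
by rewrite compDl -!compA el er addrC addrA addrC.
Qed.

Lemma Tsurj_extend Y m (b : 'I_m -> hom T Y) W (p : hom W Y) :
  in_add T W -> deflation (@confl K E) p ->
  (forall g : hom T Y, exists (c : 'I_m -> K) h,
     g = \sum_k c k *: b k + p \c h) ->
  exists W' (p' : hom W' Y),
    [/\ in_add T W', deflation (@confl K E) p' & Tsurj p'].
Proof.
move=> hW dp H; have [W' [p' [hW' dp' H']]] := deflation_extend b hW dp.
exists W', p'; split=> // g; apply/H'; have [c [h ->]] := H g.
exists (fun k => c k *: idm T), h; congr (_ + _); apply: eq_bigr => k _.
by rewrite compZr compm1.
Qed.

(** Finitely many copies of T added to a projective P -> X make it surjective on Hom(T, -);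
    [add_kernel] then puts the kernel in add T. *)
Lemma add_approx X : exists T1 T0 (i : hom T1 T0) (p : hom T0 X),
  [/\ in_add T T1, in_add T T0 & confl i p].
Proof.
have [/(_ X) [P [p [pP dp]]] _ h] := hfrob.
have [m [b hb]] := stab_span dp.
have [W [p' [hW [T1 [i c]] sp]]] :=
  Tsurj_extend (injective_in_add (proj1 (h P) pP)) dp hb.
by exists T1, W, i, p'; split=> //; exact: add_kernel sp c.
Qed.

Lemma confl_add_Tsurj W X Y (i : hom W X) (p : hom X Y) :
  in_add T W -> confl i p -> Tsurj p.
Proof.
move=> hW c g.
have [|Q [f' [p' P]]] := pullback_exists g (p := p); first by exists W, i.
have [i' [c' _]] := pullback_confl P c.
have [s hs] := add_ext_split hW c'.
by exists (f' \c s); rewrite compA (proj1 P) -compA hs compm1.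
Qed.

End ClusterTilting.

Section Index.
Variables (K : fieldType) (E : exactCat K) (T : E).
Implicit Types X Y Z W : E.

Let hadd := exact_additive E.

(* The class of X in K_0(add T), with the junk value 0 if X is not in add T. *)
Definition cl X : K0add T :=
  if pselect (in_add T X) is left h then K0add_class h else 0.

(* Palu's index of X. *)
Definition is_index X (v : K0add T) : Prop :=
  exists T1 T0 (i : hom T1 T0) (p : hom T0 X),
    [/\ in_add T T1, in_add T T0, confl i p & v = cl T0 - cl T1].

Definition index X : K0add T := xget 0 (is_index X : set (K0add T)).

Lemma clE X (h : in_add T X) : cl X = K0add_class h.
Proof.
by rewrite /cl; case: pselect => // h'; congr K0add_class;
  exact: Prop_irrelevance.
Qed.

Lemma cl_iso_bsum X Y Z (B : biproduct X Y) :
  in_add T X -> in_add T Y -> in_add T Z -> iso Z (bsum B) ->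
  cl Z = cl X + cl Y.
Proof.
move=> hX hY hZ e; rewrite (clE hX) (clE hY) (clE hZ).
apply/eqP; rewrite -subr_eq0 opprD addrA -!raddfB /=; apply/eqP/zpi_rel.
by exists (exist _ X hX), (exist _ Y hY), (exist _ Z hZ), B.
Qed.

Lemma cl_zero Z : is_zero Z -> in_add T Z -> cl Z = 0.
Proof.
move=> Z0 hZ; have [_ /(_ Z Z) [B]] := hadd.
have e : iso Z (bsum B).
  exists (binl B), (bprl B); split; first exact: bprl_inl.
  by rewrite -(bsum_id B) (zero_src (binr B) Z0) comp0m addr0.
have /eqP := cl_iso_bsum hZ hZ hZ e.
by rewrite -subr_eq0 opprD addrA subrr sub0r oppr_eq0 => /eqP.
Qed.

Hypothesis hT : cluster_tilting T.

Lemma cl_iso X Y : in_add T X -> iso X Y -> cl X = cl Y.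
Proof.
move=> hX e; have [[Z Z0] /(_ Y Z) [B]] := hadd.
have hY := add_iso hT e hX; have hZ := add_zero hT Z0.
rewrite -[RHS]addr0 -(cl_zero Z0 hZ); apply: (cl_iso_bsum hY hZ hX (B := B)).
apply: (iso_trans e); exists (binl B), (bprl B); split; first exact: bprl_inl.
by rewrite -(bsum_id B) (zero_src (binr B) Z0) comp0m addr0.
Qed.

Lemma cl_bsum X Y (B : biproduct X Y) :
  in_add T X -> in_add T Y -> cl (bsum B) = cl X + cl Y.
Proof.
move=> hX hY; apply: (cl_iso_bsum hX hY (add_bsum hT B hX hY)).
exact: iso_refl.
Qed.

Lemma add_confl W X Y (i : hom W X) (p : hom X Y) :
  in_add T W -> in_add T Y -> confl i p ->
  in_add T X /\ cl X = cl W + cl Y.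
Proof.
move=> hW hY c.
have [B <-] := confl_split_biproduct c (add_confl_split hT hW hY c).
by split; [exact: add_bsum | exact: cl_bsum].
Qed.

Lemma is_index_unique X v w : is_index X v -> is_index X w -> v = w.
Proof.
move=> [A [B [i [p [hA hB c ->]]]]] [A' [B' [i' [p' [hA' hB' c' ->]]]]].
have [|Q [f [g P]]] := pullback_exists p' (p := p); first by exists A, i.
have [j [cj _]] := pullback_confl P c.
have [j' [cj' _]] := pullback_confl (is_pullback_sym P) c'.
have [_ e] := add_confl hA hB' cj; have [_ e'] := add_confl hA' hB cj'.
apply/eqP; rewrite subr_eq addrAC eq_sym subr_eq; apply/eqP.
by rewrite -[RHS]addrC -e' e addrC.
Qed.

Hypotheses (hfrob : frobenius E) (hfin : forall X Y, fin_dim (stab_hom X Y)).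

Lemma indexP X : is_index X (index X).
Proof.
apply: (xgetPex 0 (P := is_index X : set (K0add T))).
have [A [B [i [p [hA hB c]]]]] := add_approx hT hfrob hfin X.
by exists (cl B - cl A); exists A, B, i, p.
Qed.

Lemma indexE X v : is_index X v -> index X = v.
Proof. by apply: is_index_unique; exact: indexP. Qed.

Lemma index_confl_add A B X (i : hom A B) (p : hom B X) :
  in_add T A -> in_add T B -> confl i p -> index X = cl B - cl A.
Proof. by move=> hA hB c; apply: indexE; exists A, B, i, p. Qed.

Lemma index_add X : in_add T X -> index X = cl X.
Proof.
move=> hX; have [Z [i [Z0 c]]] := is_zero_confl X.
have hZ := add_zero hT Z0.
by rewrite (index_confl_add hZ hX c) (cl_zero Z0 hZ) subr0.
Qed.

(** An approximation B0 -> X followed by X -> Y approximates Y, and its kernel is an extension of A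
    by B1. *)
Lemma index_confl_kernel A X Y (i : hom A X) (p : hom X Y) :
  in_add T A -> confl i p -> index X = index Y + cl A.
Proof.
move=> hA c; have [B1 [B0 [j [q [hB1 hB0 cj e]]]]] := indexP X.
have [U [k [a' [q' [ck ca']]]]] := confl_comp cj c.
have [hU eU] := add_confl hB1 hA ca'.
by rewrite (index_confl_add hU hB0 ck) eU e opprD addrA subrK.
Qed.

(** Let A -> B -> Z compute the index of Z. As B -> Z lifts to Y, the pullback of Y and B over Z is
    X + B; it is also an extension of Y by A, and the two descriptions give two values of its
    index. *)
Lemma index_Tsurj X Y Z (i : hom X Y) (p : hom Y Z) :
  confl i p -> Tsurj T p -> index Y = index X + index Z.
Proof.
move=> c sp; have [A [B [j [q [hA hB cj e]]]]] := indexP Z.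
have [s ps] := Tsurj_add hT q sp hB.
have [|Q [f [g P]]] := pullback_exists q (p := p); first by exists X, i.
have [i' [ci' _]] := pullback_confl P c.
have [j' [cj' _]] := pullback_confl (is_pullback_sym P) cj.
have [|t [_ gt]] := pullback_fact P (u := s) (v := idm B).
  by rewrite compm1.
have [C eC] := confl_split_biproduct ci' (ex_intro _ t gt).
have cC := biproduct_confl (bswap C); move: cC; rewrite /bswap /=.
move=> /(index_confl_kernel hB); rewrite eC => eQ.
by rewrite e addrA -eQ (index_confl_kernel hA cj') addrK.
Qed.

Lemma index_bsum X Y (B : biproduct X Y) :
  index (bsum B) = index X + index Y.
Proof.
apply: index_Tsurj (biproduct_confl B) _ => g; exists (binr B \c g).
by rewrite compA bprr_inr comp1m.
Qed.

(* The defect of additivity of the index on X -> Y -> Z depends only on the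
   image of Hom(T, Y) in Hom(T, Z). *)
Lemma index_same_image X Y Z X' Y' (i : hom X Y) (p : hom Y Z)
    (i' : hom X' Y') (p' : hom Y' Z) :
  confl i p -> confl i' p' ->
  (forall g : hom T Y, exists h, p' \c h = p \c g) ->
  (forall g : hom T Y', exists h, p \c h = p' \c g) ->
  index X + index Y' = index X' + index Y.
Proof.
move=> c c' H H'.
have [|Q [f [g P]]] := pullback_exists p' (p := p); first by exists X, i.
have [j [cj _]] := pullback_confl P c.
have [j' [cj' _]] := pullback_confl (is_pullback_sym P) c'.
rewrite -(index_Tsurj cj) -?(index_Tsurj cj') // => u.
  have [h ph] := H u; have [w [w1 _]] := pullback_fact P (esym ph).
  by exists w.
have [h ph] := H' u; have [w [_ w2]] := pullback_fact P ph.
by exists w.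
Qed.

End Index.

(** * Socles of finite dimensional modules *)

Section FinDimMod.
Variables (K : fieldType) (A : algebra K) (M : lmodType A).

Definition kcomb m (b : 'I_m -> M) (w : 'rV[K]_m) : M :=
  \sum_l alg_unit (w 0 l) *: b l.

Lemma kcombD m (b : 'I_m -> M) u v : kcomb b (u + v) = kcomb b u + kcomb b v.
Proof.
rewrite /kcomb -big_split; apply: eq_bigr => l _.
by rewrite mxE rmorphD scalerDl.
Qed.

Lemma kcombZ m (b : 'I_m -> M) c v :
  kcomb b (c *: v) = alg_unit c *: kcomb b v.
Proof.
rewrite /kcomb scaler_sumr; apply: eq_bigr => l _.
by rewrite mxE rmorphM scalerA.
Qed.

Lemma kcomb0 m (b : 'I_m -> M) : kcomb b 0 = 0.
Proof. by rewrite -(scale0r (0 : 'rV_m)) kcombZ rmorph0 scale0r. Qed.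

End FinDimMod.

Section EndAction.
Variables (K : fieldType) (E : linCat K) (T : E) (M : lmodType (end_op T)).
Implicit Types (f g : hom T T) (x y : M).

(** Scaling with the scalar typed as a morphism, so that laws of composition rewrite inside it. The
    opposite multiplication shows in [actA]. *)
Definition act f x : M := (f : end_op T) *: x.

Lemma actA f g x : act f (act g x) = act (g \c f) x.
Proof. exact: scalerA. Qed.

Lemma actDl f g x : act (f + g) x = act f x + act g x.
Proof. exact: scalerDl. Qed.

Lemma actBl f g x : act (f - g) x = act f x - act g x.
Proof. exact: scalerBl. Qed.

Lemma act_suml m (f : 'I_m -> hom T T) x :
  act (\sum_k f k) x = \sum_k act (f k) x.
Proof. exact: (@scaler_suml (end_op T)). Qed.

Lemma act1 x : act (idm T) x = x.
Proof. exact: scale1r. Qed.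

Lemma act0 f : act f 0 = 0.
Proof. exact: scaler0. Qed.

Lemma act0l x : act 0 x = 0.
Proof. exact: scale0r. Qed.

End EndAction.

Section Socle.
Variables (K : fieldType) (E : linCat K) (n : nat) (T_ : 'I_n -> E) (T : E).
Variables (i_ : forall k, hom (T_ k) T) (p_ : forall k, hom T (T_ k)).
Hypotheses (hpi : forall k, p_ k \c i_ k = idm (T_ k))
  (hsum : \sum_k i_ k \c p_ k = idm T) (hloc : forall k, local_end (T_ k)).

(** Nakayama's argument: in the local ring End T_k the element 1 - w is invertible, and it
    annihilates x. *)
Lemma local_radical_cancel (M : lmodType (end_op T)) k (x : M)
    (w : hom (T_ k) (T_ k)) :
  act (i_ k \c p_ k) x = x -> ~ is_iso w ->
  act (i_ k \c w \c p_ k) x = x -> x = 0.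
Proof.
move=> ekx nw wx; have [t [_ t2]] := local_is_iso_1B (hloc k) nw.
have h : act (i_ k \c (idm _ - w) \c p_ k) x = 0.
  by rewrite compBr compm1 compBl actBl ekx wx subrr.
suff : act (i_ k \c t \c p_ k) (act (i_ k \c (idm _ - w) \c p_ k) x) = x.
  by rewrite h act0.
rewrite actA -[RHS]ekx !compA -(compA _ (p_ k)) hpi compm1.
by rewrite -(compA (i_ k)) t2 compm1.
Qed.

(** Otherwise there is an endless strict descent: from x one reaches y in the radical times x such
    that x is not in the submodule generated by y. The vectors left behind, kept as coordinate rows
    W, stay independent modulo the submodule generated by the current x. With m+1 rows of length m
    this is absurd. *)
Lemma socle_exists (M : lmodType (end_op T)) :
  fin_dim_mod M -> (exists x : M, x <> 0) ->
  exists k (x : M), [/\ x <> 0, act (i_ k \c p_ k) x = x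
    & forall g : hom T (T_ k), ~ split_epi g ->
        act (i_ k \c g) x = 0].
Proof.
move=> [m [b hb]] [x0 nx0]; apply: contrapT => nS.
have comp (x : M) : x <> 0 -> exists k, act (i_ k \c p_ k) x <> 0.
  move=> nx; apply: contrapT => /forallNP H; apply: nx.
  rewrite -[x]act1 -hsum act_suml big1 // => k _.
  by apply: contrapT; exact: H.
have coord x : exists w, kcomb b w = x.
  have [c hc] := hb x; exists (\row_l c l); rewrite hc.
  by apply: eq_bigr => l _; rewrite mxE.
suff P s : exists k (x : M) (W : 'M[K]_(s, m)), [/\ x <> 0,
    act (i_ k \c p_ k) x = x &
    forall c : 'rV_s, (exists a, kcomb b (c *m W) = act a x) -> c = 0].
  have [k [x [W [_ _ H]]]] := P m.+1.
  have : kermx W != 0.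
    by rewrite kermx_eq0 /row_free neq_ltn ltnS rank_leq_col.
  case/rowV0Pn => v /sub_kermxP vW /eqP; apply.
  by apply: H; exists 0; rewrite vW kcomb0 act0l.
elim: s => [|s [k [x [W [nx ekx H]]]]].
  have [k nk] := comp _ nx0; exists k, (act (i_ k \c p_ k) x0), 0; split=> //.
    by rewrite actA compA -(compA (i_ k)) hpi compm1.
  by move=> c _; exact: thinmx0.
have [g [ng gx]] : exists g : hom T (T_ k),
    ~ split_epi g /\ act (i_ k \c g) x <> 0.
  apply: contrapT => nG; apply: nS; exists k, x; split=> // g ng.
  by apply: contrapT => gx; apply: nG; exists g.
have [j yj] := comp _ gx; pose y := act (i_ j \c p_ j) (act (i_ k \c g) x).
have [w hw] := coord x.
(* If x came back from y, it would be fixed by an endomorphism of T_k that factors through the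
   radical map g. *)
have nxy a : act a y <> x.
  rewrite /y !actA => e; apply: nx.
  pose u := g \c i_ j \c p_ j \c a \c i_ k.
  apply: (local_radical_cancel (w := u) ekx).
    by rewrite /u -!compA => /is_iso_split_epi_comp.
  by rewrite -[RHS]ekx -[in RHS]e actA /u !compA.
exists j, y, (col_mx w W : 'M_(1 + s, m)); split=> //.
  by rewrite /y actA compA -(compA (i_ j)) hpi compm1.
move=> c [a]; change 'rV[K]_(1 + s) in c.
rewrite -[X in kcomb b X](_ : lsubmx c *m w + rsubmx c *m W = _); last first.
  by rewrite -mul_row_col hsubmxK.
rewrite kcombD [lsubmx c]mx11_scalar mul_scalar_mx.
rewrite kcombZ hw => ea.
have c0 : rsubmx c = 0.
  pose u : hom T T := (alg_unit (lsubmx c 0 0) : end_op T).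
  apply: H; exists (i_ k \c g \c (i_ j \c p_ j) \c a - u).
  by rewrite actBl -!actA -/y -ea addrC addKr.
move: ea; rewrite c0 mul0mx kcomb0 addr0 => ea.
have [r0|nr] := eqVneq (lsubmx c 0 0) 0.
  by rewrite -(hsubmxK c) c0 [lsubmx c]mx11_scalar r0 raddf0 row_mx0.
case: (nxy ((alg_unit (lsubmx c 0 0)^-1 : end_op T) * a)).
rewrite /act -scalerA -/(act a y) -ea scalerA -rmorphM mulVf //.
by rewrite rmorph1 scale1r.
Qed.

End Socle.

(** * Exchange relations *)

Section Cokernel.
Variables (K : fieldType) (E : linCat K) (T Y Z : E) (p : hom Y Z).

Definition im_mem (x : Fobj T Z) : Prop := exists h : hom T Y, p \c h = x.

Lemma im_mem0 : im_mem 0.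
Proof. by exists 0; rewrite compm0. Qed.

Lemma im_memD x y : im_mem x -> im_mem y -> im_mem (x + y).
Proof. by move=> [h <-] [h' <-]; exists (h + h'); rewrite compDr. Qed.

Lemma im_memZ (a : end_op T) x : im_mem x -> im_mem (a *: x).
Proof. by move=> [h <-]; exists (h \c (a : hom T T)); rewrite compA. Qed.

Definition im_submodule : submodule (Fobj T Z) :=
  Submodule im_mem0 im_memD im_memZ.

Lemma Fobj_alg_unit c (x : Fobj T Z) :
  (alg_unit c : end_op T) *: x = (c *: (x : hom T Z) : hom T Z).
Proof. by rewrite [LHS]compZr compm1. Qed.

End Cokernel.

Section LquotSum.
Variables (A : pzRingType) (V : lmodType A) (S : submodule V).

Lemma lpiZ a v : lpi S (a *: v) = a *: lpi S v.
Proof. by rewrite -lscale_pi. Qed.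

Lemma lpi_eq0 v : lpi S v = 0 <-> S v.
Proof.
have e0 : lpi S 0 = 0 by apply: (@addrI _ (lpi S 0)); rewrite -lpiD !addr0.
by rewrite -e0 lpiP subr0.
Qed.

Lemma lpi_sum m (f : 'I_m -> V) : lpi S (\sum_k f k) = \sum_k lpi S (f k).
Proof. by apply: (big_morph _ (@lpiD _ _ S)); apply/lpi_eq0;
  exact: submodule0. Qed.

End LquotSum.

Section Exchange.
Variables (K : fieldType) (E : exactCat K) (T : E).
Hypotheses (hT : cluster_tilting T) (hfrob : frobenius E)
  (hfin : forall X Y : E, fin_dim (stab_hom X Y)).
Variables (n : nat) (T_ : 'I_n -> E).
Variables (i_ : forall k, hom (T_ k) T) (p_ : forall k, hom T (T_ k)).
Hypotheses (hpi : forall k, p_ k \c i_ k = idm (T_ k))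
  (hsum : \sum_k i_ k \c p_ k = idm T) (hloc : forall k, local_end (T_ k)).

Lemma summand_in_add k : in_add T (T_ k).
Proof. exact: add_retract (in_add_self T) (hpi k). Qed.

Lemma coker_fin_dim (Y Z : E) (p : hom Y Z) : deflation (@confl K E) p ->
  fin_dim_mod (A := end_op T) (lquot (im_submodule T p)).
Proof.
move=> dp; have [m [b hb]] := stab_span T hfin dp.
exists m, (fun k => lpi (im_submodule T p) (b k)) => x.
have [c [h e]] := hb (lrepr x); exists c.
have e0 : lpi (im_submodule T p) (p \c h : Fobj T Z) = 0.
  by apply/lpi_eq0; exists h.
rewrite -[LHS]lreprK e lpiD lpi_sum e0 addr0.
by apply: eq_bigr => k _; rewrite -[RHS]lpiZ Fobj_alg_unit.
Qed.

(** A socle vector of the cokernel, lifted to a map f : T_k -> Z: outside the image of p, but pushed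
    into it by every radical map. *)
Lemma coker_socle (Y Z : E) (p : hom Y Z) :
  deflation (@confl K E) p -> ~ Tsurj T p ->
  exists k (f : hom (T_ k) Z), ~ (exists h, p \c h = f) /\
    forall g : hom T (T_ k), ~ split_epi g -> exists h, p \c h = f \c g.
Proof.
move=> dp np; pose S := im_submodule T p.
have [|k [x [nx ekx hx]]] :=
    socle_exists hpi hsum hloc (M := lquot S) (coker_fin_dim dp).
  apply: contrapT => /forallNP H; apply: np => g.
  have /lpi_eq0 // : lpi S (g : Fobj T Z) = 0 by apply: contrapT; exact: H.
have actE (a : hom T T) : act a x = lpi S ((lrepr x : hom T Z) \c a).
  by rewrite -[in LHS](lreprK x) /act -lpiZ.
exists k, ((lrepr x : hom T Z) \c i_ k); split=> [[h ph]|g ng].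
  apply: nx; rewrite -ekx actE; apply/lpi_eq0; exists (h \c p_ k).
  by rewrite !compA ph.
by have := hx g ng; rewrite actE => /lpi_eq0 [h ph]; exists h; rewrite ph compA.
Qed.

Variable r : nat.
Hypothesis hproj : forall i : 'I_n, proj_inj (T_ i) <-> (r <= i)%N.
Variable ex : forall k : 'I_n, (k < r)%N -> exchange T_ T k.
Variables (A : zmodType) (phi : {additive K0add T -> A}).
Hypothesis hphi : forall (k : 'I_n) (hk : (k < r)%N),
  phi (cl T (ex_X (ex hk))) = phi (cl T (ex_Y (ex hk))).

(** On Hom(T, -) both q and the exchange deflation onto T_k have the radical as image, so
    [index_same_image] equates their defects, and [phi] kills the defect of the exchange
    sequence. *)
Lemma index_simple (X Q : E) (k : 'I_n) (hk : (k < r)%N) (j : hom X Q)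
    (q : hom Q (T_ k)) :
  confl j q -> ~ split_epi q ->
  (forall g : hom T (T_ k), ~ split_epi g -> exists h, q \c h = g) ->
  phi (index T Q) = phi (index T X) + phi (cl T (T_ k)).
Proof.
move=> c nq hq; have [_ ny hy] := ex_sink (ex hk).
have : index T X + index T (ex_Y (ex hk)) = index T (ex_star (ex hk)) + index T
  Q.
  apply: (index_same_image hT hfrob hfin c (ex_conflY (ex hk))) => g.
    by apply: hy; [exact: in_add_self | move/split_epi_compl].
  by apply: hq => /split_epi_compl.
have -> : index T (ex_Y (ex hk)) = cl T (ex_Y (ex hk)).
  by apply: index_add => //; exact: ex_addY.
have -> : index T (ex_star (ex hk)) = cl T (ex_X (ex hk)) - cl T (T_ k).
  apply: (index_confl_add hT hfrob hfin (summand_in_add k) _ (ex_conflX (ex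
    hk))).
  exact: ex_addX.
move=> H.
apply: (@addrI _ (phi (cl T (ex_X (ex hk)) - cl T (T_ k)))).
rewrite -[LHS]raddfD -H raddfD raddfB hphi.
by rewrite [RHS]addrCA subrK.
Qed.

(* Induction on the dimension m of coker Hom(T, p): enlarging Y by a summand T_k
   that maps onto a simple submodule of the cokernel lowers m, and the defect
   is that of the exchange sequence ending in T_k. *)
Lemma index_additive (X Y Z : E) (i : hom X Y) (p : hom Y Z) :
  confl i p -> phi (index T Y) = phi (index T X) + phi (index T Z).
Proof.
move=> c; have [|m [b hb]] := stab_span T hfin (p := p); first by exists X, i.
elim: m X Y i p c b hb => [|m IH] X Y i p c b hb.
  rewrite -raddfD; congr (phi _); apply: (index_Tsurj hT hfrob hfin c) => g.
  by have [c' [h ->]] := hb g; exists h; rewrite big_ord0 add0r.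
have [sp|np] := pselect (Tsurj T p).
  by rewrite -raddfD (index_Tsurj hT hfrob hfin c sp).
have dp : deflation (@confl K E) p by exists X, i.
have [k [f [nf hf]]] := coker_socle dp np.
have hk : (k < r)%N.
  rewrite ltnNge; apply/negP => /hproj [pT _]; apply: nf.
  exact: (pT _ _ p dp f).
have hTk := summand_in_add k.
have [_ /(_ Y (T_ k)) [B]] := exact_additive E.
(* The kernel of (p, f) : Y + T_k -> Z is the pullback Q, which is at the same time an extension of
   T_k by X to which [index_simple] applies. *)
have dB := deflation_sum B f dp.
have [Q [f' [q P]]] := pullback_exists f dp.
have [j [cj _]] := pullback_confl P c.
have nq : ~ split_epi q.
  by move=> [s qs]; apply: nf; exists (f' \c s);
    rewrite compA (proj1 P) -compA qs compm1.
have hq (g : hom T (T_ k)) : ~ split_epi g -> exists h, q \c h = g.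
  by move=> /hf [h ph]; have [w [_ w2]] := pullback_fact P ph; exists w.
have eQ := index_simple hk cj nq hq.
have cQ : confl (binl B \c f' - binr B \c q) (p \c bprl B + f \c bprr B).
  apply: confl_of_ker => //.
  have el W (u : hom W Y) (v : hom W (T_ k)) :
      bprl B \c (binl B \c u - binr B \c v) = u.
    by rewrite compBr !compA bprl_inl bprl_inr comp1m comp0m subr0.
  have er W (u : hom W Y) (v : hom W (T_ k)) :
      bprr B \c (binl B \c u - binr B \c v) = - v.
    by rewrite compBr !compA bprr_inl bprr_inr comp1m comp0m sub0r.
  split=> [|W g]; first by rewrite compDl -!compA el er compNr (proj1 P) subrr.
  rewrite compDl -!compA => /eqP; rewrite addr_eq0 => /eqP.
  rewrite -[RHS]compNr => e.
  have [w [w1 w2]] := pullback_fact P e; exists w; split=> [|w' hw'].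
    rewrite compBl -!compA w1 w2 compNr opprK !compA -compDl bsum_id.
    by rewrite comp1m.
  apply: (pullback_ext P).
    by rewrite w1 -hw' compBl -!compA el.
  by rewrite w2 -hw' compBl -!compA er opprK.
(* As f does not lift, some b l0 occurs in [f \c p_ k] with nonzero coefficient; once f is part of
   the deflation, b l0 can be eliminated from the spanning family. *)
have {c} [c [h e]] := hb (f \c p_ k).
have [l0 /eqP nl0] : exists l, c l <> 0.
  apply: contrapT => /forallNP H; apply: nf; exists (h \c i_ k).
  rewrite compA; have -> : p \c h = f \c p_ k.
    by rewrite e big1 ?add0r // => l _; rewrite (contrapT (H l)) scale0r.
  by rewrite -compA hpi compm1.
have H : phi (index T (bsum B)) = phi (index T Q) + phi (index T Z).
  apply: (IH _ _ _ _ cQ (fun l => b (lift l0 l))) => g.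
  have [d [h' ->]] := hb g; pose t := d l0 / c l0.
  exists (fun l => d (lift l0 l) - t * c (lift l0 l)),
    (binl B \c (h' - t *: h) + binr B \c (t *: p_ k)).
  have -> : (p \c bprl B + f \c bprr B) \c
      (binl B \c (h' - t *: h) + binr B \c (t *: p_ k)) =
      p \c h' - t *: (p \c h) + t *: (f \c p_ k).
    have el : bprl B \c (binl B \c (h' - t *: h) + binr B \c (t *: p_ k)) =
        h' - t *: h.
      by rewrite compDr !compA bprl_inl bprl_inr comp1m comp0m addr0.
    have er : bprr B \c (binl B \c (h' - t *: h) + binr B \c (t *: p_ k)) =
        t *: p_ k.
      by rewrite compDr !compA bprr_inl bprr_inr comp1m comp0m add0r.
    by rewrite compDl -!compA el er compBr !compZr.
  rewrite e !(bigD1_ord l0) //= !scalerDr scalerA divfK // scaler_sumr.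
  under [X in _ = X + _]eq_bigr do rewrite scalerBl -scalerA.
  rewrite sumrB; set S1 := \sum_(_ < _) _; set S2 := \sum_(_ < _) _.
  set u := d l0 *: _; set v := p \c h'; set w := t *: _.
  rewrite [v - w + _]addrC -[u + S2 + w + _]addrA [w + (v - w)]addrC subrK.
  by rewrite addrA [u + S2]addrC addrA subrK [S1 + u]addrC.
rewrite (index_bsum hT hfrob hfin) (index_add hT hfrob hfin hTk) in H.
by move: H; rewrite eQ raddfD addrAC => /addIr.
Qed.


End Exchange.

(** * K_0(E) as a quotient of K_0(add T) *)

Section K0.
Variables (K : fieldType) (E : exactCat K).

Lemma K0_class_confl (X Y Z : E) (i : hom X Y) (p : hom Y Z) :
  confl i p -> K0_class Y = K0_class X + K0_class Z.
Proof.
move=> c; apply/eqP; rewrite -subr_eq0 opprD addrA /K0_class -!raddfB.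
by apply/eqP/zpi_rel; exists X, Y, Z, i, p.
Qed.

Lemma K0_map (A : zmodType) (g : E -> A) :
  (forall (X Y Z : E) (i : hom X Y) (p : hom Y Z),
    confl i p -> g Y = g X + g Z) ->
  exists f : {additive K0 E -> A}, forall X, f (K0_class X) = g X.
Proof.
move=> hg; have [|f hf] := @zquot_map _ A (@K0_rel K E) (fext g).
  move=> _ [X [Y [Z [i [p [c ->]]]]]].
  by rewrite !raddfB /= !fext_gen (hg _ _ _ _ _ c) -addrA -opprD subrr.
by exists f => X; rewrite hf /= fext_gen.
Qed.

Lemma K0add_map (T : E) (A : zmodType) (g : E -> A) :
  (forall X Y Z (B : biproduct X Y), in_add T X -> in_add T Y -> in_add T Z ->
     iso Z (bsum B) -> g Z = g X + g Y) ->
  exists f : {additive K0add T -> A}, forall X, in_add T X -> f (cl T X) = g X.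
Proof.
move=> hg.
have [|f hf] := @zquot_map _ A (@K0add_rel K E T) (fext (fun X => g (sval X))).
  move=> _ [[X hX] [[Y hY] [[Z hZ] [B [e ->]]]]].
  by rewrite !raddfB /= !fext_gen (hg _ _ _ B) //= -addrA -opprD subrr.
by exists f => X hX; rewrite (clE hX) hf /= fext_gen.
Qed.

Lemma K0add_ext (T : E) (A : zmodType) (f g : {additive K0add T -> A}) :
  (forall X, in_add T X -> f (cl T X) = g (cl T X)) -> f =1 g.
Proof.
by move=> fg; apply: additive_zquot_ext => -[X hX]; have := fg X hX;
  rewrite (clE hX).
Qed.

Lemma K0_class_iso_bsum (X Y Z : E) (B : biproduct X Y) :
  iso Z (bsum B) -> K0_class Z = K0_class X + K0_class Y.
Proof.
move=> [f [g [gf fg]]].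
apply: (@K0_class_confl _ _ _ (g \c binl B) (bprr B \c f)).
have gi : is_iso g by exists f.
apply: (confl_iso (exact_exact E) (is_iso_id X) gi (is_iso_id Y) _ _
  (biproduct_confl B)); first by rewrite compm1.
by rewrite comp1m -compA fg compm1.
Qed.

End K0.

Section K0Exchange.
Variables (K : fieldType) (E : exactCat K) (T : E).
Hypotheses (hT : cluster_tilting T) (hfrob : frobenius E)
  (hfin : forall X Y : E, fin_dim (stab_hom X Y)).
Variables (n : nat) (T_ : 'I_n -> E).
Variables (i_ : forall k, hom (T_ k) T) (p_ : forall k, hom T (T_ k)).
Hypotheses (hpi : forall k, p_ k \c i_ k = idm (T_ k))
  (hsum : \sum_k i_ k \c p_ k = idm T) (hloc : forall k, local_end (T_ k)).
Variable r : nat.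
Hypothesis hproj : forall i : 'I_n, proj_inj (T_ i) <-> (r <= i)%N.
Variable ex : forall k : 'I_n, (k < r)%N -> exchange T_ T k.

Lemma K0_exchange_iso : zmod_iso (K0 E) (zquot (exchange_rel ex)).
Proof.
pose pi := @zpi _ (exchange_rel ex).
have hphi (k : 'I_n) (hk : (k < r)%N) :
    pi (cl T (ex_X (ex hk))) = pi (cl T (ex_Y (ex hk))).
  apply/eqP; rewrite -subr_eq0 -raddfB; apply/eqP/zpi_rel; exists k, hk.
  by rewrite (clE (ex_addX (ex hk))) (clE (ex_addY (ex hk))).
have [f hf] := K0_map (fun X Y Z i p c =>
  index_additive hT hfrob hfin hpi hsum hloc hproj (ex := ex) (phi := pi) hphi
    c).
have [g0 hg0] := @K0add_map K E T (K0 E) (@K0_class K E)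
  (fun X Y Z B _ _ _ e => K0_class_iso_bsum e).
have [|g hg] := @zquot_map _ _ (exchange_rel ex) g0.
  move=> _ [k [hk ->]]; set e := ex hk.
  rewrite -(clE (ex_addX e)) -(clE (ex_addY e)) raddfB !hg0; try exact: ex_addX;
    try exact: ex_addY.
  by rewrite (K0_class_confl (ex_conflX e)) (K0_class_confl (ex_conflY e))
    [K0_class (ex_star e) + _]addrC subrr.
exists f, g => [|q].
  apply: zquot_gen_ind => [|x y hx hy|X]; rewrite ?raddf0 // ?raddfB ?hx ?hy //.
  rewrite -[zpi _ _]/(K0_class X) hf hg.
  have [A [B [i [p [hA hB c ->]]]]] := indexP hT hfrob hfin X.
  rewrite raddfB !hg0 //; apply/eqP; rewrite subr_eq addrC; apply/eqP.
  exact: K0_class_confl c.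
elim/zquot_ind : q; apply: zquot_gen_ind => [|x y hx hy|[X hX]].
- by rewrite !raddf0.
- by rewrite !raddfB hx hy.
rewrite -[zpi _ (fgen _)]/(K0add_class hX) -(clE hX) hg hg0 // hf.
by rewrite (index_add hT hfrob hfin).
Qed.

End K0Exchange.

Lemma linear_pack (A : pzRingType) (U V : lmodType A) (f : U -> V) :
  linear f -> exists g : {linear U -> V}, g =1 f.
Proof.
move=> lf; pose M := GRing.isLinear.Build A U V *:%R f lf.
by pose g : {linear U -> V} := HB.pack f M; exists g.
Qed.

(** * Independence of Ext of the projective resolution *)

Section Comparison.
Variables (A : pzRingType).

(** [projmod] lifts along surjections, but d is only known to reach the image of f. So C is replaced
    by B / ker d, in which the class of a chosen preimage of [f x] depends linearly on x. *)
Lemma projmod_lift (P B C : lmodType A) (d : {linear B -> C})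
    (f : {linear P -> C}) :
  projmod P -> (forall x, exists y, d y = f x) ->
  exists g : {linear P -> B}, forall x, d (g x) = f x.
Proof.
move=> hP H.
have S0 : d 0 = 0 by rewrite linear0.
have SD x y : d x = 0 -> d y = 0 -> d (x + y) = 0.
  by move=> dx dy; rewrite linearD dx dy addr0.
have SZ c x : d x = 0 -> d (c *: x) = 0.
  move=> dx; rewrite linearZZ.
  by rewrite dx scaler0.
pose S := Submodule S0 SD SZ.
have [q hq] := @linear_pack A B (lquot S) (lpi S)
  (fun c x y => etrans (lpiD S (c *: x) y) (congr1 (fun z =>
    z + _) (lpiZ S c x))).
have [y hy] := choice H.
have lf : linear (fun x => lpi S (y x)).
  move=> c x x'; rewrite -lpiZ -lpiD; apply/lpiP => /=.
  by rewrite linearB linearD linearZZ !hy linearP subrr.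
have [f' hf'] := linear_pack lf.
have [|g hg] := hP _ _ q _ f'.
  by move=> z; exists (lrepr z); rewrite hq lreprK.
exists g => x; have := hg x; rewrite hq hf' => /lpiP /=.
by rewrite linearB hy => /eqP; rewrite subr_eq0 => /eqP.
Qed.

Variable M : lmodType A.
Implicit Types P Q : proj_res M.

(** Only the component in degree n is named; the lower ones are hidden behind existentials, so that
    an induction on n handles no dependent family. *)
Fixpoint chain_map P Q n : {linear pr_mod P n -> pr_mod Q n} -> Prop :=
  match n with
  | 0 => fun f => forall x, pr_aug Q (f x) = pr_aug P x
  | m.+1 => fun f => exists g : {linear pr_mod P m -> pr_mod Q m},
      chain_map g /\ forall x, pr_d Q m (f x) = g (pr_d P m x)
  end.

Lemma pr_dd P n x : pr_d P n (pr_d P n.+1 x) = 0.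
Proof. by apply/pr_exactS; exists x. Qed.

Lemma pr_augd P x : pr_aug P (pr_d P 0 x) = 0.
Proof. by apply/pr_exact0; exists x. Qed.

Lemma chain_map_boundary P Q n (f : {linear pr_mod P n -> pr_mod Q n}) :
  chain_map f -> forall x, exists y, pr_d Q n y = f (pr_d P n x).
Proof.
case: n f => [|n] f hf x.
  by apply/pr_exact0; rewrite hf pr_augd.
by have [g [_ e]] := hf; apply/pr_exactS; rewrite e pr_dd linear0.
Qed.

Lemma chain_map_exists P Q n :
  exists f : {linear pr_mod P n -> pr_mod Q n}, chain_map f.
Proof.
elim: n => [|n [f hf]].
  by have [f hf] := projmod_lift (d := pr_aug Q) (f := pr_aug P)
    (@pr_proj _ _ P 0) (fun x => pr_surj Q _); exists f.
have [g hg] := projmod_lift (d := pr_d Q n) (f := f \o pr_d P n)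
  (@pr_proj _ _ P n.+1) (chain_map_boundary hf).
by exists g, f.
Qed.

Lemma chain_map_comp P Q n (f : {linear pr_mod P n -> pr_mod Q n})
    (g : {linear pr_mod Q n -> pr_mod P n}) :
  chain_map f -> chain_map g ->
  chain_map (P := P) (Q := P) (g \o f : {linear pr_mod P n -> pr_mod P n}).
Proof.
elim: n f g => [|n IH] f g; first by move=> hf hg x; rewrite /= hg hf.
move=> [f' [hf' ef]] [g' [hg' eg]]; exists (g' \o f'); split; first exact: IH.
by move=> x; rewrite /= eg ef.
Qed.

(** Homotopy between u and the identity, both lifting the identity of M. Degree 0 has no term coming
    from below, hence the case distinction in the statement. *)
Lemma chain_map_homotopic P n (u : {linear pr_mod P n -> pr_mod P n}) :
  chain_map u ->
  match n return (pr_mod P n -> pr_mod P n) -> Prop with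
  | 0 => fun u => exists s : {linear pr_mod P 0 -> pr_mod P 1},
      forall x, u x - x = pr_d P 0 (s x)
  | m.+1 => fun u => exists (t : {linear pr_mod P m -> pr_mod P m.+1})
      (s : {linear pr_mod P m.+1 -> pr_mod P m.+2}),
      forall x, u x - x = t (pr_d P m x) + pr_d P m.+1 (s x)
  end u.
Proof.
elim: n u => [|n IH] u.
  move=> hu; have [|s hs] := projmod_lift (d := pr_d P 0) (f := u \- idfun)
      (@pr_proj _ _ P 0); last by exists s => x; rewrite hs.
  by move=> x; apply/pr_exact0; rewrite linearB hu subrr.
move=> [g [hg e]].
(* On boundaries the term t of the previous homotopy vanishes because d d = 0, which leaves g - 1 =
   d s there. *)
have [s hs] : exists s : {linear pr_mod P n -> pr_mod P n.+1},
    forall x, g (pr_d P n x) - pr_d P n x = pr_d P n (s (pr_d P n x)).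
  case: n g IH u e hg => [|n] g IH u e hg.
    by have [s hs] := IH _ hg; exists s => x.
  have [t [s hs]] := IH _ hg; exists s => x.
  by rewrite hs pr_dd linear0 add0r.
have [|s' hs'] := projmod_lift (d := pr_d P n.+1)
    (f := u \- idfun \- (s \o pr_d P n)) (@pr_proj _ _ P n.+1).
  by move=> x; apply/pr_exactS; rewrite !linearB /= e hs subrr.
by exists s, s' => x; rewrite hs' /= [RHS]addrC subrK.
Qed.

End Comparison.

Section ExtDim.
Variables (K : fieldType) (A : algebra K) (M N : lmodType A).
Implicit Types P Q : proj_res M.

Lemma coboundary_ext P i (f g : pr_mod P i -> N) :
  f =1 g -> is_coboundary f -> is_coboundary g.
Proof. by move=> /funext ->. Qed.

Lemma coboundaryB P i (f g : pr_mod P i -> N) :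
  is_coboundary f -> is_coboundary g -> is_coboundary (fun x => f x - g x).
Proof.
case: i f g => [|i] f g /=; first by move=> hf hg x; rewrite hf hg subrr.
move=> [f' hf] [g' hg]; exists (f' \- g') => x.
by rewrite /= hf hg.
Qed.

Lemma linear_alg_unit (U : lmodType A) c (f : U -> N) :
  linear f -> linear (fun x => alg_unit c *: f x).
Proof.
by move=> lf a x y; rewrite lf scalerDr !scalerA (alg_central c).
Qed.

Lemma linear_sum_fun (U : lmodType A) m (f : 'I_m -> U -> N) :
  (forall k, linear (f k)) -> linear (fun x => \sum_k f k x).
Proof.
move=> lf a x y; rewrite scaler_sumr -big_split /=; apply: eq_bigr => k _.
exact: lf.
Qed.

Lemma coboundary_sum P i m (c : 'I_m -> K) (f : 'I_m -> pr_mod P i -> N) :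
  (forall k, is_coboundary (f k)) ->
  is_coboundary (fun x => \sum_k alg_unit (c k) *: f k x).
Proof.
case: i f => [|i] f /= hf.
  by move=> x; rewrite big1 // => k _; rewrite hf scaler0.
have [g hg] := choice hf.
have [h hh] := linear_pack (linear_sum_fun (fun k =>
  linear_alg_unit (c k) (linearP (g k)))).
by exists h => x; rewrite hh; apply: eq_bigr => k _; rewrite hg.
Qed.

Lemma coboundary_chain_map P Q i (f : {linear pr_mod P i -> pr_mod Q i})
    (c : pr_mod Q i -> N) :
  chain_map f -> is_coboundary c -> is_coboundary (c \o f).
Proof.
case: i f c => [|i] f c /=; first by move=> _ hc x.
by move=> [g [_ e]] [h hh]; exists (h \o g) => x; rewrite /= hh e.
Qed.

Lemma cocycle_chain_map P Q i (f : {linear pr_mod P i -> pr_mod Q i})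
    (c : pr_mod Q i -> N) :
  chain_map f -> is_cocycle c -> is_cocycle (c \o f).
Proof.
move=> hf [lc hc]; split=> [a x y|x] /=; first by rewrite linearP lc.
by have [y <-] := chain_map_boundary hf x.
Qed.

Lemma cocycle_homotopic P i (u : {linear pr_mod P i -> pr_mod P i})
    (c : pr_mod P i -> N) :
  chain_map u -> is_cocycle c -> is_coboundary (fun x => c (u x) - c x).
Proof.
move=> hu [lc hc]; have [c' hc'] := linear_pack lc.
have e x : c (u x) - c x = c' (u x - x) by rewrite linearB !hc'.
apply: (coboundary_ext (fun x => esym (e x))) => {e}.
case: i u c lc hc c' hc' hu => [|i] u c lc hc c' hc' hu /=.
  by have [s hs] := chain_map_homotopic hu => x; rewrite hs hc' hc.
have [t [s hs]] := chain_map_homotopic hu.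
by exists (c' \o t) => x; rewrite hs linearD /= [X in _ + X]hc' hc addr0.
Qed.

(** Comparison maps in both directions express each basis of cohomology in the other, by matrices a
    and a'. The composite Q -> P -> Q is homotopic to the identity, so [a *m a'] is the identity of
    size e, which forces e <= d. *)
Lemma cohom_dim_leq P Q i d e :
  cohom_dim N P i d -> cohom_dim N Q i e -> (e <= d)%N.
Proof.
move=> [b [cb hb]] [b' [cb' hb']].
have [f hf] := chain_map_exists P Q i; have [g hg] := chain_map_exists Q P i.
have [a ha] : exists a : 'M[K]_(e, d), forall k, is_coboundary (fun x =>
    b' k (f x) - \sum_l alg_unit (a k l) *: b l x).
  have [v hv] := choice (fun k => hb _ (cocycle_chain_map hf (cb' k))).
  exists (\matrix_k v k) => k; have [h _] := hv k.
  by apply: (coboundary_ext _ h) => x; congr (_ - _); apply: eq_bigr => l _;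
    rewrite mxE.
have [a' ha'] : exists a' : 'M[K]_(d, e), forall k, is_coboundary (fun x =>
    b k (g x) - \sum_l alg_unit (a' k l) *: b' l x).
  have [v hv] := choice (fun k => hb' _ (cocycle_chain_map hg (cb k))).
  exists (\matrix_k v k) => k; have [h _] := hv k.
  by apply: (coboundary_ext _ h) => x; congr (_ - _); apply: eq_bigr => l _;
    rewrite mxE.
apply: (@mulmx1_min K e d a a'); apply/row_matrixP => k.
have [w [_ uw]] := hb' _ (cb' k).
have e1 : w = row k 1%:M.
  apply: uw; have h0 : is_coboundary (fun _ : pr_mod Q i => 0 : N).
    have h := cocycle_homotopic (chain_map_comp hg hf) (cb' k).
    by apply: (coboundary_ext _ (coboundaryB h h)) => x; rewrite subrr.
  apply: (coboundary_ext _ h0) => x; rewrite (bigD1 k) //= !mxE eqxx rmorph1.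
  rewrite scale1r big1 ?addr0 ?subrr // => l; rewrite !mxE eq_sym => /negbTE ->.
  by rewrite rmorph0 scale0r.
rewrite -e1; apply: esym; apply: uw.
have h1 := cocycle_homotopic (chain_map_comp hg hf) (cb' k).
have h2 := coboundary_chain_map hg (ha k).
have h3 := coboundary_sum (a k) ha'.
apply: (coboundary_ext _ (coboundaryB h3 (coboundaryB h1 h2))) => x.
rewrite ![(_ \o g) x]/=.
set u := b' k (f (g x)); set v := b' k x.
set t := \sum_l alg_unit (a k l) *: b l (g x).
rewrite (_ : u - v - (u - t) = t - v); last by rewrite opprB addrC addrA subrK.
under eq_bigr do rewrite scalerBr.
rewrite sumrB -/t opprB addrC addrA subrK; congr (_ - _).
under eq_bigr do rewrite scaler_sumr.
rewrite exchange_big; apply: eq_bigr => l _; rewrite !mxE rmorph_sum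
  scaler_suml.
by apply: eq_bigr => j _; rewrite rmorphM scalerA.
Qed.


Lemma cohom_dim_unique P Q i d e :
  cohom_dim N P i d -> cohom_dim N Q i e -> d = e.
Proof.
by move=> hd he; apply/eqP; rewrite eqn_leq (cohom_dim_leq he hd)
  (cohom_dim_leq hd he).
Qed.

(** [ext_dim] selects a value by [xget]; uniqueness lets any one resolution compute it. *)
Lemma ext_dimE P i d : cohom_dim N P i d -> ext_dim M N i = d.
Proof.
move=> hd; have hP : is_ext_dim M N i d by exists P.
have [Q hQ] : is_ext_dim M N i (ext_dim M N i).
  by apply: (xgetPex 0%N (P := is_ext_dim M N i : set nat)); exists d.
exact: cohom_dim_unique hQ hd.
Qed.

End ExtDim.

(** * Euler characteristics of complexes of matrices *)

Lemma mx_homology_basis (K : fieldType) a h c (D' : 'M[K]_(a, h))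
    (D : 'M[K]_(h, c)) : D' *m D = 0 ->
  exists q (B : 'M[K]_(q, h)), [/\ (q + \rank D + \rank D')%N = h, B *m D = 0
    & forall u : 'rV_h, u *m D = 0 -> exists! x : 'rV_q, (u - x *m B <= D')%MS].
Proof.
move=> DD; have D'k : (D' <= kermx D)%MS by apply/sub_kermxP.
pose Z := (kermx D :\: D')%MS; exists (\rank Z), (row_base Z); split.
- have := mxrank_cap_compl (kermx D) D'; rewrite (capmx_idPr D'k) -/Z
  mxrank_ker.
  by move=> e; rewrite addnAC [(\rank Z + _)%N]addnC e subnK ?rank_leq_row.
- by apply/sub_kermxP; rewrite eq_row_base diffmxSl.
move=> u /sub_kermxP; rewrite -(addsmx_diff_cap_eq (kermx D) D') -/Z.
case/sub_addsmxP => -[x y] /= ->; set z := x *m _.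
have /submxP [w ew] : (z <= row_base Z)%MS by rewrite eq_row_base submxMl.
exists w; split=> [|w' hw'].
  rewrite -ew addrC addKr (submx_trans (submxMl _ _)) //.
  exact: capmxSr.
have : ((w - w') *m row_base Z <= Z :&: D')%MS.
  rewrite sub_capmx -{1}(eq_row_base Z) submxMl /= mulmxBl -ew.
  have -> : z - w' *m row_base Z = (z + y *m (kermx D :&: D')%MS - w' *m
    row_base Z)
      - y *m (kermx D :&: D')%MS by rewrite [RHS]addrAC addrK.
  rewrite addmx_sub // eqmx_opp (submx_trans (submxMl _ _)) //; exact: capmxSr.
rewrite capmx_diff submx0 mulmx_free_eq0 ?row_base_free // subr_eq0.
by move/eqP.
Qed.

Section CohomBases.
Variables (K : fieldType) (A : algebra K).

Definition hom_basis (U N : lmodType A) h (e : 'I_h -> U -> N) : Prop :=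
  (forall k, linear (e k)) /\
  forall f, linear f -> exists! c : 'rV[K]_h, forall x, f x = kcomb (e^~ x) c.

Lemma linear_kcomb (U N : lmodType A) h (e : 'I_h -> U -> N) c :
  (forall k, linear (e k)) -> linear (fun x => kcomb (e^~ x) c).
Proof.
move=> le; apply: (linear_sum_fun (f := fun k x =>
  alg_unit (c 0 k) *: e k x)) => k.
exact: linear_alg_unit.
Qed.

Lemma hom_basis_inj (U N : lmodType A) h (e : 'I_h -> U -> N) c c' :
  hom_basis e -> (forall x, kcomb (e^~ x) c = kcomb (e^~ x) c') -> c = c'.
Proof.
move=> [le he] H; have [d [_ ud]] := he _ (linear_kcomb c le).
by rewrite -(ud c) // (ud c').
Qed.

Lemma kcomb_mul (N : lmodType A) h h' (b : 'I_h -> N) (b' : 'I_h' -> N)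
    (D : 'M[K]_(h, h')) c :
  (forall k, b k = kcomb b' (row k D)) -> kcomb b c = kcomb b' (c *m D).
Proof.
move=> hb; rewrite /kcomb.
under eq_bigr => k _ do rewrite hb /kcomb scaler_sumr.
rewrite exchange_big; apply: eq_bigr => l _; rewrite !mxE rmorph_sum
  scaler_suml.
by apply: eq_bigr => k _; rewrite mxE rmorphM scalerA.
Qed.

Variables (M N : lmodType A) (P : proj_res M).
Variables (h : nat -> nat) (e : forall i, 'I_(h i) -> pr_mod P i -> N).
Hypothesis he : forall i, hom_basis (@e i).
Variable D : forall i, 'M[K]_(h i, h i.+1).
Hypothesis hD : forall i k x,
  @e i k (pr_d P i x) = kcomb ((@e i.+1)^~ x) (row k (D i)).

Lemma kcomb_d i c x :
  kcomb ((@e i)^~ (pr_d P i x)) c = kcomb ((@e i.+1)^~ x) (c *m D i).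
Proof. by apply: kcomb_mul => k; exact: hD. Qed.

Lemma differential_mul0 i : D i *m D i.+1 = 0.
Proof.
apply/row_matrixP => k; rewrite row_mul row0.
apply: (hom_basis_inj (he i.+2)) => x; rewrite -kcomb_d -hD pr_dd.
rewrite kcomb0; have [/(_ k) le _] := he i.
by have [g hg] := linear_pack le; rewrite -hg linear0.
Qed.

Lemma cocycle_kcomb i (c : 'rV_(h i)) :
  is_cocycle (fun x => kcomb ((@e i)^~ x) c) <-> c *m D i = 0.
Proof.
have [le _] := he i; split=> [[_ H]|H].
  apply: (hom_basis_inj (he i.+1)) => x; rewrite -kcomb_d H kcomb0 //.
by split=> [|x]; [exact: linear_kcomb | rewrite kcomb_d H kcomb0].
Qed.

Lemma cohom_dim_of_boundaries i a (D' : 'M[K]_(a, h i)) :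
  D' *m D i = 0 ->
  (forall c, is_coboundary (fun x => kcomb ((@e i)^~ x) c) <-> (c <= D')%MS) ->
  exists q, (q + \rank (D i) + \rank D')%N = h i /\ cohom_dim N P i q.
Proof.
move=> DD hB; have [q [B [eq BD hq]]] := mx_homology_basis DD.
exists q; split=> //; exists (fun k x => kcomb ((@e i)^~ x) (row k B)).
split=> [k|f [lf hf]]; first by apply/cocycle_kcomb; rewrite -row_mul BD row0.
have [_ H] := he i; have [u [fu _]] := H _ lf.
have eB x v : kcomb (fun k => kcomb ((@e i)^~ x) (row k B)) v =
  kcomb ((@e i)^~ x) (v *m B) by apply: kcomb_mul.
have cE (v : 'rV_q) : is_coboundary (fun x => f x - \sum_k alg_unit (v 0 k) *:
    kcomb ((@e i)^~ x) (row k B)) <-> (u - v *m B <= D')%MS.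
  rewrite -hB; set g := (X in is_coboundary X <-> _).
  rewrite (_ : g = (fun x => kcomb ((@e i)^~ x) (u - v *m B))) //.
  apply/funext => x; rewrite /g -/(kcomb _ _) eB fu.
  by rewrite -[- (v *m B)]scaleN1r kcombD kcombZ rmorphN1 scaleN1r.
have uD : u *m D i = 0.
  apply/cocycle_kcomb; split=> [|x]; first by apply: linear_kcomb; case: (he i).
  by rewrite -fu hf.
have [w [hw uw]] := hq _ uD; exists w; split=> [|w' hw']; first exact/cE.
exact/uw/cE.
Qed.

Lemma cohom_dim_bases0 :
  exists q, (q + \rank (D 0))%N = h 0 /\ cohom_dim N P 0 q.
Proof.
have [||q [hq hd]] := @cohom_dim_of_boundaries 0 (h 0) 0.
- by rewrite mul0mx.
- move=> c; rewrite submx0; split=> [H|/eqP -> x]; last exact: kcomb0.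
  by apply/eqP/(hom_basis_inj (he 0)) => x; rewrite H kcomb0.
by exists q; rewrite mxrank0 addn0 in hq.
Qed.

Lemma cohom_dim_basesS i :
  exists q, (q + \rank (D i.+1) + \rank (D i))%N = h i.+1 /\ cohom_dim N P i.+1
    q.
Proof.
apply: cohom_dim_of_boundaries; first exact: differential_mul0.
move=> c /=; split=> [[g hg]|/submxP [v ->]].
  have [_ H] := he i; have [v [gv _]] := H _ (linearP g).
  apply/submxP; exists v; apply: (hom_basis_inj (he i.+1)) => x.
  by rewrite hg gv kcomb_d.
have [le _] := he i; have [g hg] := linear_pack (linear_kcomb v le).
by exists g => x; rewrite hg kcomb_d.
Qed.

Hypothesis h4 : forall i, (3 < i)%N -> h i = 0%N.

(** Each h i is the dimension of the cohomology plus the ranks of the two adjacent differentials.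
    The ranks telescope, the last one being 0 because h 4 = 0. *)
Lemma euler_bases : euler M N = \sum_(i < 4) (-1) ^+ i * (h i)%:Z.
Proof.
have [q0 [e0 c0]] := cohom_dim_bases0.
have [q hq] := choice (fun i => cohom_dim_basesS i).
have r3 : \rank (D 3) = 0%N.
  by have := rank_leq_col (D 3); rewrite [X in (_ <= X)%N]h4 // leqn0 => /eqP.
(* [q i] is the dimension in degree i+1, so it vanishes from i = 3 on. *)
have qS i : (2 < i)%N -> q i = 0%N.
  move=> i2; have [E _] := hq i; have : (q i <= h i.+1)%N.
    by rewrite -[X in (_ <= X)%N]E -addnA leq_addr.
  by rewrite h4 // leqn0 => /eqP.
rewrite /euler -(fsbig_widen `I_4) //; last first.
  move=> [|i] [_ /= /negP]; rewrite -?leqNgt // => i4.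
  have [_ ci] := hq i; rewrite (ext_dimE ci) qS // mulr0 //.
rewrite -fsbig_ord !big_ord_recl !big_ord0 /= (ext_dimE c0).
rewrite (ext_dimE (proj2 (hq 0))) (ext_dimE (proj2 (hq 1))) (ext_dimE (proj2
  (hq 2))).
rewrite /bump /= expr0 expr1 sqrrN expr1n exprS sqrrN expr1n.
move: e0 (proj1 (hq 0)) (proj1 (hq 1)) (proj1 (hq 2)); rewrite r3.
move: (\rank (D 0)) (\rank (D 1)) (\rank (D 2)) => r0 r1 r2.
by move: (h 0) (h 1) (h 2) (h 3); lia.
Qed.

End CohomBases.

(** In a full rank factorisation P = C R idempotence forces R C = 1, and the trace of R C is the
    rank. *)
Lemma mxtrace_idempotent (K : fieldType) n (P : 'M[K]_n) :
  P *m P = P -> \tr P = (\rank P)%:R.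
Proof.
have aux q (C : 'M[K]_(n, q)) (R : 'M[K]_(q, n)) :
    row_full C -> row_free R -> C *m R *m (C *m R) = C *m R -> R *m C = 1%:M.
  move=> /row_fullP [L LC] /row_freeP [S RS] /(congr1 (fun M => L *m M *m S)).
  by rewrite !mulmxA LC !mul1mx -(mulmxA _ R) RS mulmx1.
move=> PP; rewrite -{1}(mulmx_base P) mxtrace_mulC aux ?mxtrace1 //.
- exact: col_base_full.
- exact: row_base_free.
- by rewrite mulmx_base.
Qed.

(** * Euler forms and Hattori traces *)

Section HomBasis.
Variables (K : fieldType) (E : linCat K) (T : E) (N : fdmod (end_op T)).
Local Notation d := (fd_dim N).

Definition rho (f : hom T T) : 'M[K]_d := fd_act N (f : end_op T).

Lemma rhoM g f : rho (g \c f) = rho f *m rho g.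
Proof. exact: (rmorphM (fd_act N) (f : end_op T) (g : end_op T)). Qed.

Lemma rhoD f g : rho (f + g) = rho f + rho g.
Proof. exact: (rmorphD (fd_act N) (f : end_op T) (g : end_op T)). Qed.

Lemma act_rho f (x : fd_mod N) : act f x = (rho f *m (x : 'cV_d) : 'cV_d).
Proof. by []. Qed.

Lemma fd_alg_unit c (x : fd_mod N) :
  (alg_unit c : end_op T) *: x = (c *: (x : 'cV_d) : 'cV_d).
Proof. by rewrite -mul_scalar_mx -fd_unit. Qed.

Lemma kcomb_fd m (b : 'I_m -> fd_mod N) w :
  kcomb b w = (\sum_k w 0 k *: (b k : 'cV_d) : 'cV_d).
Proof. by apply: eq_bigr => k _; exact: fd_alg_unit. Qed.

Variables (X : E) (m : nat) (u : 'I_m -> hom X T) (v : 'I_m -> hom T X).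
Hypothesis uv : \sum_k v k \c u k = idm X.

(* A linear map FX -> N is determined by its values on the v_k, that is by the
   rows of W; conversely every W defines a map, and W |-> lift_mx W is the
   resulting projection of N^m onto Hom(FX, N). *)
Let ev (W : 'M[K]_(m, d)) (x : Fobj T X) : fd_mod N :=
  (\sum_k rho (u k \c (x : hom T X)) *m (row k W)^T : 'cV_d).

Let lift_mx (W : 'M[K]_(m, d)) : 'M[K]_(m, d) :=
  \matrix_(l, j) (ev W (v l) : 'cV_d) j 0.

Let evE W x j : (ev W x : 'cV_d) j 0 =
  \sum_k \sum_i rho (u k \c (x : hom T X)) j i * W k i.
Proof.
rewrite /ev summxE; apply: eq_bigr => k _; rewrite mxE.
by apply: eq_bigr => i _; rewrite !mxE.
Qed.

Let ev_linear W : linear (ev W).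
Proof.
move=> a x y; rewrite -[a *: ev W x]/(act a (ev W x)) act_rho /ev mulmx_sumr.
rewrite -big_split; apply: eq_bigr => k _.
rewrite (compDr (u k)) rhoD mulmxDl; congr (_ + _).
by rewrite mulmxA -rhoM compA.
Qed.

Let evZ c W x : ev (c *: W) x = (c *: (ev W x : 'cV_d) : 'cV_d).
Proof.
rewrite /ev scaler_sumr; apply: eq_bigr => k _.
by rewrite !linearZZ.
Qed.

Let evD W W' x : ev (W + W') x = ev W x + ev W' x.
Proof.
by rewrite /ev -big_split; apply: eq_bigr => k _; rewrite /= !linearD.
Qed.

Let act_v (x : Fobj T X) : x = \sum_k act (u k \c (x : hom T X)) (v k : Fobj T
  X).
Proof.
rewrite -[LHS]comp1m -uv comp_suml; apply: eq_bigr => k _.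
by rewrite -compA.
Qed.

Let ev_rows (f : Fobj T X -> fd_mod N) : linear f ->
  forall x, f x = ev (\matrix_k (f (v k) : 'cV_d)^T) x.
Proof.
move=> lf x; have [g hg] := linear_pack lf.
rewrite -!hg [in LHS](act_v x) linear_sum; apply: eq_bigr => k _.
by rewrite linearZZ -/(act _ _) act_rho rowK trmxK hg.
Qed.

Let ev_lift W x : ev (lift_mx W) x = ev W x.
Proof.
rewrite [RHS](ev_rows (ev_linear W)); congr (ev _ _).
by apply/matrixP => l j; rewrite !mxE.
Qed.

Let lift_eq W W' : (forall x, ev W x = ev W' x) -> lift_mx W = lift_mx W'.
Proof. by move=> H; apply/matrixP => l j; rewrite !mxE H. Qed.

(** The dimension of Hom(FX, N) is the rank of the projection [lift_mx], hence its trace; the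
    diagonal entries of that projection are those of the matrices [rho (u k \c v k)]. *)
Lemma hom_basis_trace : exists h (e : 'I_h -> Fobj T X -> fd_mod N),
  hom_basis e /\ h%:R = \sum_k \tr (rho (u k \c v k)).
Proof.
have [g hg] : exists g : {linear 'M[K]_(m, d) -> 'M[K]_(m, d)}, g =1 lift_mx.
  apply: linear_pack => c W W'; apply/matrixP => l j.
  by rewrite !mxE evD evZ !mxE.
pose P := lin_mx g.
have PE W : mxvec W *m P = mxvec (lift_mx W) by rewrite mul_vec_lin hg.
have liftK W : lift_mx (lift_mx W) = lift_mx W.
  by apply: lift_eq => x; rewrite ev_lift.
have PP : P *m P = P.
  apply/row_matrixP => i; rewrite row_mul !rowE.
  by rewrite -(vec_mxK (delta_mx 0 i)) !PE liftK.
pose b k := vec_mx (row k (row_base P)).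
have bE (c : 'rV_(\rank P)) : \sum_k c 0 k *: b k = vec_mx (c *m row_base P).
  rewrite mulmx_sum_row linear_sum; apply: eq_bigr => k _.
  by rewrite linearZ.
have eE (c : 'rV_(\rank P)) x : kcomb (fun k => ev (b k) x) c = ev (vec_mx (c
  *m row_base P)) x.
  rewrite kcomb_fd -bE.
  elim/big_ind2 : _ => [|x1 x2 y1 y2 -> ->|k _].
  - by rewrite -(scale0r (0 : 'M[K]_(m, d))) evZ scale0r.
  - by rewrite evD.
  - by rewrite evZ.
exists (\rank P), (fun k => ev (b k)); split; last first.
  rewrite -mxtrace_idempotent // /mxtrace.
  rewrite (reindex _ (curry_mxvec_bij _ _)) /=.
  transitivity (\sum_k \sum_j P (mxvec_index k j) (mxvec_index k j)).
    by rewrite pair_bigA; apply: eq_bigr => -[k j] _.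
  apply: eq_bigr => k _; rewrite /mxtrace.
  apply: eq_bigr => j _.
  have -> : P (mxvec_index k j) (mxvec_index k j) =
      ((delta_mx 0 (mxvec_index k j) : 'rV[K]_(m * d)) *m P) 0 (mxvec_index k
        j).
    by rewrite -rowE [RHS]mxE.
  rewrite -mxvec_delta PE mxvecE mxE evE.
  rewrite (bigD1 k) //= (bigD1 j) //= !mxE !eqxx mulr1 !big1 ?addr0 //.
    move=> k' nk; rewrite big1 // => i _.
    by rewrite mxE (negbTE nk) mulr0.
  by move=> i ni; rewrite mxE (negbTE ni) andbF mulr0.
split=> [k|f lf]; first exact: ev_linear.
pose W := \matrix_k (f (v k) : 'cV_d)^T.
have fW := ev_rows lf; rewrite -/W in fW.
have WP : lift_mx W = W by apply/matrixP => l j; rewrite !mxE -fW.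
have /submxP [c ec] : (mxvec W <= row_base P)%MS.
  by rewrite eq_row_base -WP -PE submxMl.
exists c; split=> [x|c' hc'].
  by rewrite eE -ec mxvecK fW.
apply: (row_free_inj (row_base_free P)).
have fixed c0 : mxvec (lift_mx (vec_mx (c0 *m row_base P))) = c0 *m row_base P.
  have /submxP [w ew] : (c0 *m row_base P <= P)%MS.
    by rewrite (submx_trans (submxMl _ _)) // eq_row_base.
  by rewrite -PE vec_mxK ew -mulmxA PP.
rewrite -(fixed c) -(fixed c'); congr mxvec; apply: lift_eq => x.
by rewrite -!eE -hc' eE -ec mxvecK fW.
Qed.

End HomBasis.

Section Fmap.
Variables (K : fieldType) (E : linCat K) (T : E).

Definition Fmap X Y (f : hom X Y) (x : Fobj T X) : Fobj T Y := f \c (x : hom T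
  X).

Lemma Fmap_linear X Y (f : hom X Y) : linear (Fmap f).
Proof. by move=> a x y; rewrite /Fmap [LHS]compDr compA. Qed.

HB.instance Definition _ X Y (f : hom X Y) :=
  GRing.isLinear.Build (end_op T) (Fobj T X) (Fobj T Y) *:%R (Fmap f)
    (Fmap_linear f).

Lemma Fobj_projmod X : power_retract T X -> projmod (Fobj T X).
Proof.
move=> [m [u [v uv]]] M N p sp f.
have [y hy] := choice (fun k => sp (f (v k))).
have lg : linear (fun x : Fobj T X => \sum_k act (u k \c (x : hom T X)) (y k)).
  move=> a x x'; rewrite scaler_sumr -big_split; apply: eq_bigr => k _ /=.
  rewrite -[a *: act _ _]/(act a _) actA -actDl.
  by rewrite [u k \c _]compDr compA.
have [g hg] := linear_pack lg; exists g => x; rewrite hg linear_sum.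
rewrite -[in RHS](comp1m (x : hom T X)) -uv comp_suml -[RHS]/(f (\sum_k _)).
rewrite [RHS]linear_sum; apply: eq_bigr => k _.
by rewrite linearZZ hy -linearZZ; congr (f _); rewrite -compA.
Qed.

End Fmap.

Section HattoriTrace.
Variables (K : fieldType) (E : linCat K) (T : E) (N : fdmod (end_op T)).
Implicit Types X Y Z : E.

(** An arbitrary finite index type lets the trace of a biproduct be indexed by I + J. *)
Definition is_trace X (t : K) : Prop :=
  exists (I : finType) (u : I -> hom X T) (v : I -> hom T X),
    \sum_k v k \c u k = idm X /\ t = \sum_k \tr (rho N (u k \c v k)).

Lemma comp_bigr (I : finType) X Y Z (g : hom Y Z) (f : I -> hom X Y) :
  g \c (\sum_k f k) = \sum_k g \c f k.
Proof. by apply: (big_morph _ (fun x y => compDr g x y)); exact: compm0. Qed.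

Lemma comp_bigl (I : finType) X Y Z (g : hom X Y) (f : I -> hom Y Z) :
  (\sum_k f k) \c g = \sum_k f k \c g.
Proof. by apply: (big_morph _ (fun x y => compDl x y g)); exact: comp0m. Qed.

Lemma rho_big (I : finType) (f : I -> hom T T) :
  rho N (\sum_k f k) = \sum_k rho N (f k).
Proof. exact: (rmorph_sum (fd_act N)). Qed.

(* Hattori's trace of the identity of FX, which does not depend on the way X is
   written as a summand of a power of T. *)
Lemma is_trace_unique X t t' : is_trace X t -> is_trace X t' -> t = t'.
Proof.
move=> [I [u [v [uv ->]]]] [J [u' [v' [uv' ->]]]].
transitivity (\sum_k \sum_l \tr (rho N (u k \c v' l \c (u' l \c v k)))).
  apply: eq_bigr => k _; rewrite -raddf_sum -rho_big; congr (\tr (rho N _)).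
  rewrite -[in LHS](compm1 (u k)) -uv' comp_bigr comp_bigl.
  by apply: eq_bigr => l _; rewrite !compA.
rewrite exchange_big; apply: eq_bigr => l _.
under eq_bigr do rewrite rhoM mxtrace_mulC -rhoM.
rewrite -raddf_sum -rho_big; congr (\tr (rho N _)).
rewrite -[in RHS](compm1 (u' l)) -uv comp_bigr comp_bigl.
by apply: eq_bigr => k _; rewrite !compA.
Qed.

Lemma is_trace_iso_bsum X Y Z (B : biproduct X Y) t t' :
  iso Z (bsum B) -> is_trace X t -> is_trace Y t' -> is_trace Z (t + t').
Proof.
move=> [f [g [gf fg]]] [I [u [v [uv ->]]]] [J [u' [v' [uv' ->]]]].
exists (I + J)%type, (fun k => match k with
  | inl j => u j \c bprl B \c f | inr j => u' j \c bprr B \c f end),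
  (fun k => match k with
  | inl j => g \c binl B \c v j | inr j => g \c binr B \c v' j end).
split; rewrite big_sumType /=; last first.
  congr (_ + _); apply: eq_bigr => k _; congr (\tr (rho N _)).
    by rewrite !compA -(compA _ f) fg compm1 -(compA (u k)) bprl_inl compm1.
  by rewrite !compA -(compA _ f) fg compm1 -(compA (u' k)) bprr_inr compm1.
rewrite -gf -[in RHS](compm1 g) -(bsum_id B) compDr compDl; congr (_ + _).
  rewrite -[in RHS](compm1 (binl B)) -uv !comp_bigr !comp_bigl comp_bigr
    comp_bigl.
  by apply: eq_bigr => k _; rewrite !compA.
rewrite -[in RHS](compm1 (binr B)) -uv' !comp_bigr !comp_bigl comp_bigr
  comp_bigl.
by apply: eq_bigr => k _; rewrite !compA.
Qed.

Lemma in_add_is_trace X : in_add T X -> exists t, is_trace X t.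
Proof.
move=> /in_add_power_retract [m [u [v uv]]].
by exists (\sum_k \tr (rho N (u k \c v k))); exists 'I_m, u, v.
Qed.

End HattoriTrace.

Section Hattori.
Variables (K : fieldType) (E : exactCat K) (T : E) (N : fdmod (end_op T)).

Lemma hattori_exists : exists f : {additive K0add T -> K},
  forall X t, in_add T X -> is_trace N X t -> f (cl T X) = t.
Proof.
pose g X := xget 0 (is_trace N X : set K).
have gP X : in_add T X -> is_trace N X (g X).
  by move=> /(in_add_is_trace N) h; apply: (xgetPex 0 (P := is_trace N X : set
    K)).
have [|f hf] := @K0add_map K E T K g.
  move=> X Y Z B hX hY hZ e; apply: is_trace_unique (gP _ hZ) _.
  exact: is_trace_iso_bsum e (gP _ hX) (gP _ hY).
exists f => X t hX ht; rewrite hf //.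
exact: is_trace_unique (gP _ hX) ht.
Qed.

Definition hattori : {additive K0add T -> K} := sval (cid hattori_exists).

Lemma hattoriE X t : in_add T X -> is_trace N X t -> hattori (cl T X) = t.
Proof. exact: (svalP (cid hattori_exists)). Qed.

End Hattori.

Section EulerResolution.
Variables (K : numFieldType) (E : exactCat K) (T : E).
Hypothesis hT : cluster_tilting T.

Definition has_euler_class (M : lmodType (end_op T)) (v : K0add T) : Prop :=
  forall N : fdmod (end_op T), (euler M (fd_mod N))%:~R = hattori N v.

Lemma euler_class_resolution (M : lmodType (end_op T)) (P : nat -> E)
    (d : forall i, hom (P i.+1) (P i)) (aug : {linear Fobj T (P 0) -> M}) :
  (forall i, in_add T (P i)) -> (forall i, (3 < i)%N -> is_zero (P i)) ->
  (forall y, exists x, aug x = y) ->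
  (forall x, aug x = 0 <-> exists y : hom T (P 1), d 0 \c y = x) ->
  (forall i (x : hom T (P i.+1)), d i \c x = 0 <->
     exists y : hom T (P i.+2), d i.+1 \c y = x) ->
  has_euler_class M (\sum_(i < 4) cl T (P i) *~ (-1) ^+ i).
Proof.
move=> hP P4 sa e0 eS N.
pose R : proj_res M := @ProjRes _ M (fun i => Fobj T (P i)) (fun i =>
  Fmap (T := T) (d i)) aug
  (fun i => Fobj_projmod (in_add_power_retract (hP i))) sa e0 eS.
have B i : exists h (e : 'I_h -> pr_mod R i -> fd_mod N),
    hom_basis e /\ h%:R = hattori N (cl T (P i)).
  have [m [u [v uv]]] := in_add_power_retract (hP i).
  have [h [e [he ht]]] := hom_basis_trace N uv.
  exists h, e; split=> //.
  by apply: esym; apply: hattoriE => //; exists 'I_m, u, v.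
have [h [e [he hh]]] : exists (h : nat -> nat)
    (e : forall i, 'I_(h i) -> pr_mod R i -> fd_mod N),
    (forall i, hom_basis (e i)) /\ forall i, (h i)%:R = hattori N (cl T (P i)).
  exists (fun i => sval (cid (B i))), (fun i => sval (cid (svalP (cid (B i))))).
  by split=> i; have [] := svalP (cid (svalP (cid (B i)))).
have HD i : exists D : 'M[K]_(h i, h i.+1), forall k x,
    e i k (pr_d R i x) = kcomb ((e i.+1)^~ x) (row k D).
  have [le _] := he i; have [_ H] := he i.+1.
  have lc k : linear (fun x => e i k (pr_d R i x)).
    by move=> a x y; rewrite linearP le.
  have [c hc] := choice (fun k => H _ (lc k)).
  by exists (\matrix_k c k) => k x; rewrite rowK; have [-> _] := hc k.
have [D hD] : exists D : forall i, 'M[K]_(h i, h i.+1), forall i k x,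
    e i k (pr_d R i x) = kcomb ((e i.+1)^~ x) (row k (D i)).
  by exists (fun i => sval (cid (HD i))) => i; exact: (svalP (cid (HD i))).
have h4 i : (3 < i)%N -> h i = 0%N.
  move=> i4; apply/eqP; rewrite -(pnatr_eq0 K) hh cl_zero ?raddf0 //.
  exact: P4.
rewrite (euler_bases he hD h4) rmorph_sum raddf_sum /=; apply: eq_bigr => i _.
by rewrite raddfMz /= -hh rmorphM /= mulrC mulrzr.
Qed.

End EulerResolution.

(** * Gradings and the Euler form *)

Section Tensor.
Variables (V W : zmodType).

Lemma tensDl (w : W) : {morph (fun v : V => tens v w) : x y / x + y}.
Proof.
move=> x y; apply/eqP; rewrite -subr_eq0 opprD addrA -!raddfB;
  apply/eqP/zpi_rel.
by left; exists x, y, w.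
Qed.

Lemma tensDr (v : V) : {morph (fun w : W => tens v w) : x y / x + y}.
Proof.
move=> x y; apply/eqP; rewrite -subr_eq0 opprD addrA -!raddfB;
  apply/eqP/zpi_rel.
by right; exists v, x, y.
Qed.

Lemma tens0l (w : W) : tens (0 : V) w = 0.
Proof. by apply: (@addrI _ (tens 0 w)); rewrite -tensDl !addr0. Qed.

Lemma tens0r (v : V) : tens v (0 : W) = 0.
Proof. by apply: (@addrI _ (tens v 0)); rewrite -tensDr !addr0. Qed.

Lemma tensNl (v : V) (w : W) : tens (- v) w = - tens v w.
Proof. by apply/eqP; rewrite -addr_eq0 -tensDl addNr tens0l. Qed.

Lemma tensNr (v : V) (w : W) : tens v (- w) = - tens v w.
Proof. by apply/eqP; rewrite -addr_eq0 -tensDr addNr tens0r. Qed.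

Lemma tens_mulz (v : V) (w : W) (c : int) : tens (v *~ c) w = tens v (w *~ c).
Proof.
elim/int_rec: c => [|m IH|m IH]; first by rewrite !mulr0z tens0l tens0r.
  by rewrite intS !mulrzDr !mulr1z tensDl tensDr IH.
by rewrite -addn1 PoszD opprD !mulrzDr !mulrN1z tensDl tensDr IH tensNl tensNr.
Qed.

Lemma tensor_ind (P : tensor V W -> Prop) :
  P 0 -> (forall x y, P x -> P y -> P (x - y)) -> (forall v w, P (tens v w)) ->
  forall u, P u.
Proof. by move=> P0 PB Pt; apply: zquot_gen_ind => // -[v w]; exact: Pt. Qed.

Lemma tensor_map (A : zmodType) (b : V -> W -> A) :
  (forall v v' w, b (v + v') w = b v w + b v' w) ->
  (forall v w w', b v (w + w') = b v w + b v w') ->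
  exists h : {additive tensor V W -> A},
    tensor_lift b =1 h /\ forall v w, h (tens v w) = b v w.
Proof.
move=> bl br; pose g := fext (fun p : V * W => b p.1 p.2).
have g0 u : tensor_rel u -> g u = 0.
  by case=> [[v [v' [w ->]]]|[v [w [w' ->]]]];
    rewrite /g !raddfB /= !fext_gen /=
    ?bl ?br -addrA -opprD subrr.
have [h hh] := zquot_map g0; exists h; split=> [|v w]; last first.
  by rewrite [LHS]hh /= fext_gen.
by elim/zquot_ind => u; rewrite /tensor_lift zliftE // hh.
Qed.

End Tensor.

Section ShortExactTrace.
Variables (K : fieldType) (A : algebra K).

Lemma fd_linear_mx (N N' : fdmod A) (f : {linear fd_mod N -> fd_mod N'}) :
  exists F : 'M[K]_(fd_dim N', fd_dim N),
    (forall x, f x = (F *m (x : 'cV_(fd_dim N)) : 'cV_(fd_dim N'))) /\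
    forall a, F *m fd_act N a = fd_act N' a *m F.
Proof.
have fZ c (x : fd_mod N) : f (c *: (x : 'cV_(fd_dim N)) : 'cV_(fd_dim N)) =
    (c *: (f x : 'cV_(fd_dim N')) : 'cV_(fd_dim N')).
  by rewrite -mul_scalar_mx -fd_unit -[LHS]/(f (alg_unit c *: x)) linearZZ
    -mul_scalar_mx -fd_unit.
pose F : 'M[K]_(fd_dim N', fd_dim N) :=
  \matrix_(i, j) (f (delta_mx j 0 : 'cV_(fd_dim N)) : 'cV_(fd_dim N')) i 0.
have fd j : f (delta_mx j 0 : 'cV_(fd_dim N)) =
    (F *m delta_mx j 0 : 'cV_(fd_dim N')).
  by apply/colP => i; rewrite -colE !mxE.
have FE (x : fd_mod N) : f x = (F *m (x : 'cV_(fd_dim N)) : 'cV_(fd_dim N')).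
  have -> : x = (\sum_j (x : 'cV_(fd_dim N)) j 0 *: delta_mx j 0 : 'cV_(fd_dim
    N)).
    rewrite [LHS](matrix_sum_delta (x : 'cV_(fd_dim N))).
    by apply: eq_bigr => j _; rewrite big_ord1.
  rewrite linear_sum mulmx_sumr; apply: eq_bigr => j _.
  by rewrite fZ -scalemxAr fd.
exists F; split=> // a; apply/matrixP => i j.
have : F *m (fd_act N a *m delta_mx j (0 : 'I_1)) =
    fd_act N' a *m (F *m delta_mx j 0).
  pose x : fd_mod N := (delta_mx j 0 : 'cV_(fd_dim N)).
  have e1 : f (a *: x) = (F *m (fd_act N a *m delta_mx j 0) : 'cV_(fd_dim N')).
    exact: FE.
  have e2 : f (a *: x) = (fd_act N' a *m (F *m delta_mx j 0) : 'cV_(fd_dim N')).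
    rewrite linearZZ.
    exact: (congr1 (fun z : 'cV_(fd_dim N') => fd_act N' a *m z) (fd j)).
  exact: etrans (esym e1) e2.
by rewrite !mulmxA -!colE => /colP /(_ i); rewrite !mxE.
Qed.

(** A splitting over K, S of g and L of f with 1 = F L + S G, and cyclicity of the trace. *)
Lemma short_exact_trace (N' N N'' : fdmod A) (f : {linear fd_mod N' ->
  fd_mod N})
    (g : {linear fd_mod N -> fd_mod N''}) a :
  short_exact f g ->
  \tr (fd_act N a) = \tr (fd_act N' a) + \tr (fd_act N'' a).
Proof.
move=> [injf kerg sg].
have [F [fE Fa]] := fd_linear_mx f; have [G [gE Ga]] := fd_linear_mx g.
have solve m n p (M : 'M[K]_(m, n)) (C : 'M[K]_(m, p)) :
    (forall j, exists x : 'cV_n, M *m x = col j C) -> exists S, M *m S = C.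
  move=> /choice [s hs]; exists (\matrix_(i, j) s j i 0); apply/matrixP => i j.
  have /colP /(_ i) := hs j; rewrite !mxE => <-; apply: eq_bigr => k _.
  by rewrite mxE.
have [S GS] : exists S, G *m S = 1%:M.
  by apply: solve => j; have [y hy] := sg (col j 1%:M : 'cV_(fd_dim N''));
    exists y;
    rewrite -hy gE.
have [L FL] : exists L, F *m L = 1%:M - S *m G.
  apply: solve => j; pose y : fd_mod N := col j (1%:M - S *m G).
  have /kerg [x hx] : g y = 0.
    by rewrite gE /y colE !mulmxA mulmxBr mulmx1 mulmxA GS mul1mx subrr mul0mx.
  by exists x; rewrite -fE hx.
have GF : G *m F = 0.
  apply/matrixP => i j; have : g (f (delta_mx j 0 : 'cV_(fd_dim N'))) = 0.
    by apply/kerg; exists (delta_mx j 0 : 'cV_(fd_dim N')).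
  by rewrite fE gE mulmxA -colE => /colP /(_ i); rewrite !mxE.
have LF : L *m F = 1%:M.
  apply/matrixP => i j; have : F *m (L *m F) = F *m 1%:M.
    by rewrite mulmxA FL mulmxBl mul1mx -mulmxA GF mulmx0 subr0 mulmx1.
  move=> e; have /injf : f ((L *m F) *m delta_mx j 0 : 'cV_(fd_dim N')) =
      f (1%:M *m delta_mx j 0 : 'cV_(fd_dim N')).
    by rewrite !fE ![F *m (_ *m delta_mx j 0)]mulmxA e.
  by rewrite -!colE => /colP /(_ i); rewrite !mxE.
have -> : fd_act N a = fd_act N a *m (F *m L) + fd_act N a *m (S *m G).
  by rewrite -mulmxDr FL subrK mulmx1.
rewrite mxtraceD mulmxA -Fa -mulmxA mxtrace_mulC -mulmxA LF mulmx1;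
  congr (_ + _).
by rewrite mulmxA mxtrace_mulC mulmxA Ga -mulmxA GS mulmx1.
Qed.

End ShortExactTrace.

Section EulerClass.
Variables (K : numFieldType) (E : exactCat K) (T : E).

Lemma hattori_short_exact (N' N N'' : fdmod (end_op T))
    (f : {linear fd_mod N' -> fd_mod N}) (g : {linear fd_mod N ->
      fd_mod N''}) v :
  short_exact f g -> hattori N v = hattori N' v + hattori N'' v.
Proof.
move=> ses; rewrite -[RHS]/((hattori N' \+ hattori N'') v).
apply: K0add_ext => X hX; have [m [u [w uw]]] := in_add_power_retract hX.
have tr N0 : is_trace N0 X (\sum_k \tr (rho N0 (u k \c w k))) by exists 'I_m,
  u, w.
rewrite /= !(hattoriE hX (tr _)) -big_split; apply: eq_bigr => k _ /=.
exact: short_exact_trace ses.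
Qed.

(** Additivity of the pairing on short exact sequences is inherited from traces, after embedding the
    integers in K; only then does [zlift] describe a map on K_0(fd). *)
Lemma euler_K0_additive (M : lmodType (end_op T)) v : has_euler_class M v ->
  exists g : {additive K0fd (end_op T) -> int}, euler_K0 M =1 g /\
    forall N, g (K0fd_class N) = euler M (fd_mod N).
Proof.
move=> hv; pose h := fext (fun N : fdmod (end_op T) => euler M (fd_mod N)).
have h0 u : K0fd_rel u -> h u = 0.
  move=> [N' [N [N'' [f [g [ses ->]]]]]]; rewrite /h !raddfB /= !fext_gen.
  have : euler M (fd_mod N) = euler M (fd_mod N') + euler M (fd_mod N'').
    apply: (@intr_inj K); rewrite intrD !hv; exact: hattori_short_exact ses.
  by move=> ->; rewrite -addrA -opprD subrr.
have [g hg] := zquot_map h0; exists g; split=> [|N];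
  last by rewrite hg /= fext_gen.
by elim/zquot_ind => u; rewrite /euler_K0 zliftE // hg.
Qed.

Lemma euler_tensor_additive (M : lmodType (end_op T)) v (A : zmodType) :
  has_euler_class M v ->
  exists h : {additive tensor (K0fd (end_op T)) A -> A}, euler_tensor M =1 h /\
    forall N a, h (tens (K0fd_class N) a) = a *~ euler M (fd_mod N).
Proof.
move=> /euler_K0_additive [g [gE gN]].
have [||h [hE ht]] :=
    @tensor_map (K0fd (end_op T)) A A (fun y b => b *~ euler_K0 M y).
- by move=> y y' w; rewrite !gE raddfD mulrzDr.
- by move=> y w w'; rewrite mulrzDl.
by exists h; split=> // N a; rewrite ht gE gN.
Qed.

Lemma K0fd_tensor_ext (A B : zmodType)
    (f g : {additive tensor (K0fd (end_op T)) A -> B}) :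
  (forall N a, f (tens (K0fd_class N) a) = g (tens (K0fd_class N) a)) -> f =1 g.
Proof.
move=> fg; apply: tensor_ind => [|x y hx hy|y a]; first by rewrite !raddf0.
  by rewrite !raddfB hx hy.
elim/zquot_gen_ind : y => [|x y hx hy|N]; first by rewrite tens0l !raddf0.
  by rewrite tensDl tensNl !raddfB hx hy.
exact: fg.
Qed.

Lemma euler_tensor_comb (M M1 M2 M3 : lmodType (end_op T)) v v1 v2 v3
    (A : zmodType) (G : tensor (K0fd (end_op T)) A) :
  has_euler_class M v -> has_euler_class M1 v1 -> has_euler_class M2 v2 ->
  has_euler_class M3 v3 -> v = v1 - v2 + v3 ->
  euler_tensor M G = euler_tensor M1 G - euler_tensor M2 G + euler_tensor M3 G.
Proof.
move=> hv hv1 hv2 hv3 e.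
have [h [hE ht]] := euler_tensor_additive A hv.
have [h1 [hE1 ht1]] := euler_tensor_additive A hv1.
have [h2 [hE2 ht2]] := euler_tensor_additive A hv2.
have [h3 [hE3 ht3]] := euler_tensor_additive A hv3.
rewrite hE hE1 hE2 hE3.
rewrite -[RHS]/(((h1 \- h2) \+ h3) G); apply: K0fd_tensor_ext => N a /=.
rewrite ht ht1 ht2 ht3 -mulrzBr -mulrzDr; congr (_ *~ _).
apply: (@intr_inj K); rewrite intrD rmorphB /= hv hv1 hv2 hv3 e.
by rewrite raddfD raddfB.
Qed.

End EulerClass.

Section EulerCategory.
Variables (K : numFieldType) (E : exactCat K) (T : E).
Hypotheses (hT : cluster_tilting T) (hfrob : frobenius E)
  (hfin : forall X Y : E, fin_dim (stab_hom X Y)).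

Lemma euler_class4 (M : lmodType (end_op T)) (T0 T1 T2 T3 : E) (d0 : hom T1 T0)
    (d1 : hom T2 T1) (d2 : hom T3 T2) (aug : {linear Fobj T T0 -> M}) :
  in_add T T0 -> in_add T T1 -> in_add T T2 -> in_add T T3 ->
  (forall y, exists x, aug x = y) ->
  (forall x, aug x = 0 <-> exists y : hom T T1, d0 \c y = x) ->
  (forall x : hom T T1, d0 \c x = 0 <-> exists y : hom T T2, d1 \c y = x) ->
  (forall x : hom T T2, d1 \c x = 0 <-> exists y : hom T T3, d2 \c y = x) ->
  (forall x : hom T T3, d2 \c x = 0 -> x = 0) ->
  has_euler_class M (cl T T0 - cl T T1 + cl T T2 - cl T T3).
Proof.
move=> h0 h1 h2 h3 sa e0 e1 e2 e3.
have [[Z Z0] _] := exact_additive E; have hZ := add_zero hT Z0.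
pose P i := match i with 0 => T0 | 1 => T1 | 2 => T2 | 3 => T3 | _ => Z end.
pose d i : hom (P i.+1) (P i) :=
  match i with 0 => d0 | 1 => d1 | 2 => d2 | _ => 0 end.
have := @euler_class_resolution K E T M P d aug _ _ sa e0 _.
rewrite !big_ord_recl big_ord0 /= /bump /= expr0 expr1 sqrrN expr1n exprS.
rewrite sqrrN expr1n mulr1 !mulrN1z !mulr1z addr0 !addrA; apply.
- by case=> [|[|[|[|i]]]].
- by case=> [|[|[|[|i]]]].
case=> [|[|[|i]]] x //=; split=> [e|[y <-]]; rewrite ?comp0m ?compm0 //.
- by exists 0; rewrite comp0m; apply: esym; exact: e3.
- by exists 0; rewrite (zero_tgt x Z0) comp0m.
Qed.

Lemma euler_class_Fobj X : has_euler_class (Fobj T X) (index T X).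
Proof.
have [A [B [i [p [hA hB c ->]]]]] := indexP hT hfrob hfin X.
have [[Z Z0] _] := exact_additive E; have hZ := add_zero hT Z0.
have := @euler_class4 (Fobj T X) B A Z Z i 0 0 (Fmap (T := T) p) hB hA hZ hZ.
rewrite !(cl_zero Z0 hZ) subr0 addr0; apply.
- exact: confl_add_Tsurj hA c.
- move=> x; split=> [|[y <-]]; first exact: (ker_fact (confl_ker c)).
  by rewrite /= /Fmap compA (confl_comp0 c) comp0m.
- move=> x; split=> [e|[y <-]]; last by rewrite comp0m compm0.
  exists 0; rewrite compm0; apply: (ker_mono (confl_ker c)).
  by rewrite e compm0.
- by move=> x; split=> _; [exists 0; rewrite compm0 (zero_tgt x Z0) | rewrite
  comp0m].
- by move=> x _; exact: zero_tgt.
Qed.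

(** Splicing A -> B -> X with X -> T1 -> T0 gives a resolution of M of length 3 with terms FT0, FT1,
    FB, FA. *)
Lemma euler_class_coker (M : lmodType (end_op T)) (X T1 T0 : E) (i : hom X T1)
    (p : hom T1 T0) (aug : {linear Fobj T T0 -> M}) :
  in_add T T0 -> in_add T T1 -> confl i p ->
  (forall y, exists x, aug x = y) ->
  (forall x, aug x = 0 <-> exists y : hom T T1, p \c y = x) ->
  has_euler_class M (index T X - cl T T1 + cl T T0).
Proof.
move=> h0 h1 c sa e0.
have [A [B [j [q [hA hB cj ->]]]]] := indexP hT hfrob hfin X.
rewrite (_ : _ + _ = cl T T0 - cl T T1 + cl T B - cl T A); last first.
  by rewrite -[RHS]addrA [LHS]addrC [_ - cl T T1]addrC [LHS]addrA.
apply: (@euler_class4 _ _ _ _ _ p (i \c q) j aug h0 h1 hB hA sa e0).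
- move=> x; split=> [/(ker_fact (confl_ker c)) [y <-]|[y <-]].
    by have [z <-] := confl_add_Tsurj hT hA cj y; exists z; rewrite compA.
  by rewrite !compA (confl_comp0 c) !comp0m.
- move=> x; rewrite -compA; split=> [e|[y <-]].
    apply: (ker_fact (confl_ker cj)); apply: (ker_mono (confl_ker c)).
    by rewrite e compm0.
  by rewrite !compA -(compA i) (confl_comp0 cj) compm0 comp0m.
- by move=> x e; apply: (ker_mono (confl_ker cj)); rewrite e compm0.
Qed.

Variable A : zmodType.
Implicit Types G : tensor (K0fd (end_op T)) A.

Lemma stab_end_act (M : lmodType (end_op (T : stable E))) (f : hom T T)
    (x : restr (@stab_end_pi K E T) M) :
  act f x = (stab_end_pi (f : end_op T)) *: (x : M).
Proof. by []. Qed.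

Lemma stab_piD (X Y : E) (f g : hom X Y) :
  stab_pi (f + g) = stab_pi f + stab_pi g.
Proof. by rewrite -[f]scale1r stab_pi_linear !scale1r. Qed.

Lemma stab_pi_proj0 (X Y : E) (f : hom X Y) : factors_proj f -> stab_pi f = 0.
Proof.
move=> hf; have := stab_pi_sum (n := 0) (fun=> 0) (fun=> 0 : hom X Y).
by rewrite !big_ord0 => <-; apply/stab_pi_eq; rewrite subr0.
Qed.

(* The defect of additivity is the class of the cokernel of
   Hom(T, Y) -> Hom(T, Z), a module over the stable endomorphism algebra. *)
Lemma degree_confl G (X Y Z : E) (i : hom X Y) (p : hom Y Z) :
  is_grading (T := T) G -> confl i p ->
  degree (T := T) G Y = degree (T := T) G X + degree (T := T) G Z.
Proof.
move=> hG c; have [A0 [B [a [q [hA0 hB cq eZ]]]]] := indexP hT hfrob hfin Z.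
have [|Q [f [g P]]] := pullback_exists q (p := p); first by exists X, i.
have [i' [ci' _]] := pullback_confl P c.
have [a' [ca' _]] := pullback_confl (is_pullback_sym P) cq.
have [C [D [b [t [hC hD ct eQ]]]]] := indexP hT hfrob hfin Q.
have [U [k [b' [t' [ck cb']]]]] := confl_comp ct ci'.
pose w := g \c t; have dw : deflation (@confl K E) w by exists U, k.
(* Forming the cokernel from stable maps makes M a module over the stable endomorphism algebra.
   Nothing is lost, as [e0] shows: stably zero maps lift along the deflation w. *)
pose F := Fobj (T : stable E) (B : stable E).
pose S := im_submodule (E := stable E) (T : stable E) (stab_pi w).
pose M := lquot S.
pose aug0 (x : Fobj T B) : restr (@stab_end_pi K E T) M :=
  lpi S (stab_pi (x : hom T B) : F).
have laug : linear aug0.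
  move=> c0 x y; rewrite /aug0.
  have -> : stab_pi (c0 *: x + y : hom T B) =
      (stab_end_pi c0 *: (stab_pi (x : hom T B) : F) + (stab_pi (y : hom T B) :
        F)).
    have e : stab_end_pi c0 *: (stab_pi (x : hom T B) : F) =
      stab_pi (c0 *: x : hom T B) by exact: stab_comp_pi.
    by rewrite e stab_piD.
  by rewrite lpiD lpiZ.
have [aug haug] := linear_pack laug.
have sa y : exists x, aug x = y.
  have [x ex] := stab_piP (lrepr (y : M) : stab_hom T B).
  exists x; rewrite haug /aug0 -ex; exact: lreprK.
have e0 x : aug x = 0 <-> exists y : hom T D, w \c y = x.
  rewrite haug /aug0; split=> [/lpi_eq0 [h eh]|[y <-]].
    have [h' eh'] := stab_piP h; move: eh; rewrite eh' [LHS]stab_comp_pi.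
    move=> /esym /stab_pi_eq /(factors_proj_lift dw) [h'' eh''].
    by exists (h' + h''); rewrite compDr eh'' addrC subrK.
  by apply/lpi_eq0; exists (stab_pi y); exact: stab_comp_pi.
have hM := euler_class_coker hB hD ck sa e0.
have fM : fin_gen (A := end_op (T : stable E)) M.
  have [m [u [v uv]]] := in_add_power_retract hB.
  exists m, (fun l => lpi S (stab_pi (v l) : F)) => y.
  have [x ex] := sa y; exists (fun l => stab_end_pi (u l \c (x : hom T B) :
    end_op T)).
  rewrite -ex -[x in LHS]comp1m -uv comp_suml linear_sum.
  apply: eq_bigr => l _; rewrite -compA.
  by rewrite -[_ \c _]/((u l \c (x : hom T B) : end_op T) *: (v l : Fobj T B))
    linearZZ haug.
have := hG M fM.
rewrite (euler_tensor_comb G hM (euler_class_Fobj X) (euler_class_Fobj Y)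
  (euler_class_Fobj Z)).
  by rewrite -/(degree G X) -/(degree G Y) -/(degree G Z) addrAC => /eqP;
    rewrite subr_eq0 => /eqP.
rewrite (index_confl_kernel hT hfrob hfin hC cb').
have -> : index T Y = index T Q - cl T A0.
  by rewrite (index_confl_kernel hT hfrob hfin hA0 ca') addrK.
rewrite eQ eZ opprB opprB [cl T A0 + _]addrC !addrA.
by rewrite [_ + cl T A0 + cl T B]addrAC addrK.
Qed.

(** A free family in S of maximal size spans S, since a vector of S outside its span would enlarge
    it. *)
Lemma closed_rV_subspace m (S : 'rV[K]_m -> Prop) :
  (forall u v, S u -> S v -> S (u + v)) -> (forall c u, S u -> S (c *: u)) ->
  exists q (W : 'M[K]_(q, m)), (forall k, S (row k W)) /\
    forall v, S v -> (v <= W)%MS.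
Proof.
move=> SD SZ.
pose Q q := `[< exists W : 'M[K]_(q, m), row_free W /\ forall k, S (row k W) >].
have Q0 : exists q, Q q.
  by exists 0%N; apply/asboolP; exists 0; split=> [|[]//];
    rewrite /row_free mxrank0.
have Qm q : Q q -> (q <= m)%N.
  by move=> /asboolP [W [/eqP fW _]]; rewrite -{1}fW; exact: rank_leq_col.
case: (ex_maxnP Q0 Qm) => q /asboolP [W [fW SW]] maxq.
exists q, W; split=> // v Sv; apply: contrapT => nvW.
suff : Q (1 + q)%N by move/maxq; rewrite add1n ltnn.
apply/asboolP; exists (col_mx v W); split=> [|k]; last first.
  case: (split_ordP k) => j ->; last by rewrite rowKd.
  by rewrite rowKu ord1 row_id.
rewrite -kermx_eq0; apply/rowV0P => c /sub_kermxP.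
rewrite -(hsubmxK c) mul_row_col; set a := lsubmx c; set b := rsubmx c => e.
have a0 : a = 0.
  rewrite [a]mx11_scalar; have [->|na] := eqVneq (a 0 0) 0;
    first by rewrite raddf0.
  case: nvW; have : a 0 0 *: v = - b *m W.
    by apply/eqP; rewrite mulNmx -addr_eq0 -mul_scalar_mx -mx11_scalar e.
  move/(congr1 (fun z => (a 0 0)^-1 *: z)); rewrite scalerA mulVf // scale1r =>
    ->.
  by rewrite scalemx_sub // submxMl.
move: e; rewrite a0 mul0mx add0r => /eqP.
by rewrite mulmx_free_eq0 // => /eqP ->; rewrite row_mx0.
Qed.

(* Modulo the maps factoring through projectives, which M kills, the kernel of
   FT0 -> M is finite dimensional, so T1 only has to be a projective cover of T0
   plus finitely many copies of T. *)
Lemma stable_module_coker (M : lmodType (end_op (T : stable E))) :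
  fin_gen M -> exists X T1 T0 (i : hom X T1) (p : hom T1 T0)
    (aug : {linear Fobj T T0 -> restr (@stab_end_pi K E T) M}),
    [/\ in_add T T0, in_add T T1, confl i p, forall y, exists x, aug x = y
      & forall x, aug x = 0 <-> exists y : hom T T1, p \c y = x].
Proof.
move=> [m [b hb]]; pose M' := restr (@stab_end_pi K E T) M.
have [T0 [v [u [h1 h2 h3]]]] := dsum_exists (exact_additive E) (fun _ : 'I_m =>
  T).
have hT0 : in_add T T0 by apply/addP => //; exists m, u, v.
have laug : linear (fun x : Fobj T T0 => \sum_k act (u k \c (x : hom T T0)) (b
  k : M')).
  move=> a x x'; rewrite scaler_sumr -big_split; apply: eq_bigr => k _ /=.
  rewrite -[a *: act _ _]/(act a _) actA -actDl.
  by rewrite [u k \c _]compDr compA.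
have [aug haug] := linear_pack laug.
have sa y : exists x, aug x = y.
  have [c hc] := hb y; have [f hf] := choice (fun k =>
    stab_piP (c k : stab_hom T T)).
  exists (\sum_k v k \c f k); rewrite haug hc; apply: eq_bigr => k _.
  rewrite comp_sumr (bigD1 k) //= compA h1 comp1m big1 ?addr0 => [|l nlk].
    by rewrite stab_end_act hf.
  by rewrite compA h2 ?comp0m // => e; rewrite e eqxx in nlk.
have aug_proj (x : hom T T0) : factors_proj x -> aug x = 0.
  move=> hx; rewrite haug big1 // => k _; rewrite stab_end_act.
  rewrite -[stab_end_pi _]/(stab_pi (u k \c x)) stab_pi_proj0 ?scale0r //.
  exact: factors_proj_compl.
have [/(_ T0) [P [p0 [pP dp0]]] _ hpi] := hfrob.
have iP := proj1 (hpi P) pP.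
have [q [s hs]] := stab_span T hfin dp0.
(* Since [aug] kills maps through P, whether a map lies in its kernel is decided by coefficients on
   the s k. The rows of W span the admissible coefficient vectors and prescribe the copies of T to
   add to P. *)
have [||l [W [SW hW]]] := @closed_rV_subspace q
    (fun c => aug (\sum_k c 0 k *: s k : hom T T0) = 0).
- move=> c c' e e'; rewrite (_ : \sum_k _ =
    (\sum_k c 0 k *: s k : hom T T0) + (\sum_k c' 0 k *: s k : hom T T0)).
    by rewrite [LHS]linearD e e' addr0.
  by rewrite -big_split; apply: eq_bigr => k _; rewrite mxE scalerDl.
- move=> a c e; rewrite (_ : \sum_k _ =
    (alg_unit a : end_op T) *: (\sum_k c 0 k *: s k : Fobj T T0)).
    by rewrite linearZZ e scaler0.
  rewrite Fobj_alg_unit scaler_sumr; apply: eq_bigr => k _.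
  by rewrite mxE scalerA.
pose t j : hom T T0 := \sum_k W j k *: s k.
have [T1 [p [hT1 dp hp]]] := deflation_extend hT t (injective_in_add hT iP) dp0.
have [X [i ci]] := dp; exists X, T1, T0, i, p, aug; split=> // x.
have aug_p0 (h : hom T P) : aug (p0 \c h) = 0 by apply: aug_proj;
  exists P, h, p0.
rewrite hp; split=> [ex|[f [h ->]]]; last first.
  rewrite [LHS](linearD aug (\sum_k t k \c f k : Fobj T T0)) aug_p0 addr0.
  rewrite [LHS](linear_sum aug) big1 // => k _.
  rewrite -[t k \c f k]/((f k : end_op T) *: (t k : Fobj T T0)) linearZZ.
  rewrite -[X in _ *: X = _](_ : 0 = _) ?scaler0 // -(SW k); congr (aug _).
  by apply: eq_bigr => j _; rewrite mxE.
have [c [h e]] := hs x; pose w := \row_k c k.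
have : aug (\sum_k w 0 k *: s k : hom T T0) = 0.
  rewrite -ex e [RHS](linearD aug (\sum_k c k *: s k : Fobj T T0)) aug_p0 addr0.
  by congr (aug _); apply: eq_bigr => k _; rewrite mxE.
move=> /hW /submxP [D eD]; exists (fun j => D 0 j *: idm T), h.
rewrite e; congr (_ + _).
under [RHS]eq_bigr do rewrite compZr compm1 scaler_sumr.
rewrite exchange_big; apply: eq_bigr => k _ /=.
have -> : c k = w 0 k by rewrite mxE.
rewrite eD mxE scaler_suml; apply: eq_bigr => j _.
by rewrite scalerA.
Qed.

End EulerCategory.

(** * Simple modules and the dual basis *)

Section Simples.
Variables (C : closedFieldType) (E : linCat C) (n : nat) (T_ : 'I_n ->
  E) (T : E).
Variables (i_ : forall k, hom (T_ k) T) (p_ : forall k, hom T (T_ k)).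
Hypotheses (hpi : forall k, p_ k \c i_ k = idm (T_ k))
  (horth : forall k l, k <> l -> p_ k \c i_ l = 0)
  (hsum : \sum_k i_ k \c p_ k = idm T) (hloc : forall k, local_end (T_ k))
  (hbasic : forall k l, k <> l -> ~ iso (T_ k) (T_ l))
  (hsimple : forall S : lmodType (end_op T), simple_mod S -> fin_dim_mod S).

Lemma nonsplit_neq k l (g : hom (T_ l) (T_ k)) : l <> k -> ~ split_epi g.
Proof.
move=> nlk sg; apply: (hbasic nlk); exists g.
by apply: local_split_epi_iso sg => //; case: (hloc k).
Qed.

Let rad0 k : ~ split_epi (0 : hom T (T_ k)).
Proof. exact: local_nonsplit0. Qed.

Let radD k (x y : Fobj T (T_ k)) : ~ split_epi (x : hom T (T_ k)) ->
  ~ split_epi (y : hom T (T_ k)) -> ~ split_epi (x + y : hom T (T_ k)).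
Proof. exact: local_split_epiD. Qed.

Let radZ k (a : end_op T) (x : Fobj T (T_ k)) : ~ split_epi (x : hom T (T_ k))
  ->
  ~ split_epi (a *: x : hom T (T_ k)).
Proof. by move=> nx /split_epi_compl. Qed.

Definition rad_submodule k : submodule (Fobj T (T_ k)) :=
  Submodule (@rad0 k) (@radD k) (@radZ k).

Lemma top_simple k : simple_mod (lquot (rad_submodule k)).
Proof.
split=> [|S].
  exists (lpi (rad_submodule k) (p_ k)) => /lpi_eq0 /=; apply.
  by exists (i_ k); exact: hpi.
have [h0|] := pselect (forall x, S x -> x = 0); first by left.
move=> /existsNP [y /not_implyP [Sy ny]]; right => z.
have [s ys] : split_epi (lrepr y : hom T (T_ k)).
  by apply: contrapT => /= h; apply: ny; rewrite -(lreprK y); apply/lpi_eq0.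
have -> : z = ((s \c (lrepr z : hom T (T_ k)) : hom T T) : end_op T) *: y.
  rewrite -[y in RHS]lreprK -lpiZ -[LHS]lreprK; congr (lpi _ _).
  by rewrite [RHS]compA ys comp1m.
exact: submoduleZ.
Qed.

(** An eigenvalue argument on the top of Hom(T, T_k), which is finite dimensional because it is
    simple: the characteristic polynomial of composition with u splits, so u - z cannot be
    invertible for every z. *)
Lemma residue_exists k (u : hom (T_ k) (T_ k)) :
  exists z : C, ~ split_epi (u - z *: idm (T_ k)).
Proof.
apply: contrapT => /forallNP H.
have Hi z : is_iso (u - z *: idm (T_ k)).
  apply: local_split_epi_iso => //; first by case: (hloc k).
  exact: contrapT (H z).
pose J := rad_submodule k; have [m [b hb]] := hsimple (top_simple k).
pose X (c : 'rV[C]_m) : hom T (T_ k) := \sum_l c 0 l *: (lrepr (b l) : hom T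
  (T_ k)).
have XE (y : lquot J) : exists c, lpi J (X c) = y.
  have [c hc] := hb y; exists (\row_l c l); rewrite hc lpi_sum.
  apply: eq_bigr => l _.
  by rewrite -[_ *: _]/(_ *: (_ : hom _ _)) -Fobj_alg_unit lpiZ lreprK mxE.
have [A hA] : exists A : 'M[C]_m, forall c, lpi J (X (c *m A)) = lpi J (u \c X
  c).
  have [c hc] := choice (fun l => XE (lpi J (u \c (lrepr (b l) : hom T (T_
    k))))).
  exists (\matrix_l c l) => v.
  have -> : X (v *m \matrix_l c l) = \sum_l v 0 l *: X (c l).
    rewrite /X; under [RHS]eq_bigr do rewrite scaler_sumr.
    rewrite exchange_big; apply: eq_bigr => j _ /=; rewrite mxE scaler_suml.
    by apply: eq_bigr => l _; rewrite mxE scalerA.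
  rewrite comp_sumr !lpi_sum; apply: eq_bigr => l _.
  by rewrite compZr -!Fobj_alg_unit !lpiZ hc.
have X0 : X 0 = 0 by rewrite /X big1 // => l _; rewrite mxE scale0r.
have XB c z : X (c *m (A - z%:M)) = X (c *m A) - z *: X c.
  rewrite mulmxBr mul_mx_scalar /X scaler_sumr -sumrB; apply: eq_bigr => l _.
  by rewrite !mxE scalerBl scalerA.
have np : lpi J (p_ k : Fobj T (T_ k)) <> 0.
  by move=> /lpi_eq0 /=; apply; exists (i_ k); exact: hpi.
have [c hc] := XE (lpi J (p_ k : Fobj T (T_ k))).
(* The family b spans without being known to be independent, so injectivity of A - z is replaced by
   injectivity of composition with the invertible u - z modulo the radical. *)
have step z v : lpi J (X (v *m (A - z%:M))) = 0 -> lpi J (X v) = 0.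
  rewrite XB lpiD hA -lpiD => /lpi_eq0 /= h; apply/lpi_eq0 => /= -[s vs];
    apply: h.
  have [t [_ ht]] := Hi z; exists (s \c t).
  have -> : u \c X v - z *: X v = (u - z *: idm _) \c X v.
    by rewrite compBl compZl comp1m.
  by rewrite compA -(compA (u - _)) vs compm1.
(* [horner_mx] needs matrices of nonzero size; size 0 would put [p_ k] in the radical. *)
case: m => [|m] in b hb X XE A hA X0 XB c hc step *.
  by apply: np; rewrite -hc [c]thinmx0 X0; apply/lpi_eq0; exact: rad0.
have [r hr] := closed_field_poly_normal (char_poly A).
have := Cayley_Hamilton A; rewrite hr (monicP (char_poly_monic A)) scale1r.
rewrite rmorph_prod /= => hA0; apply: np; rewrite -hc.
have {hA0} : lpi J (X (c *m \prod_(z <- r) (A - z%:M))) = 0.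
  rewrite (eq_bigr (fun z => horner_mx A ('X - z%:P))) ?hA0; last first.
    by move=> z _; rewrite rmorphB /= horner_mx_X horner_mx_C.
  by rewrite mulmx0 X0; apply/lpi_eq0; exact: rad0.
elim: r c {hc hr} => [|z r IH] c; first by rewrite big_nil mulmx1.
by rewrite big_cons mulmxA => /IH /step.
Qed.

(** z is the image of the (k, k) entry of a in End(T_k) modulo its radical, which is the field of
    scalars. *)
Definition is_residue k (a : hom T T) (z : C) : Prop :=
  ~ split_epi (p_ k \c a \c i_ k - z *: idm (T_ k)).

Lemma is_residue_unique k a z z' : is_residue k a z -> is_residue k a z' ->
  z = z'.
Proof.
move=> h h'; apply: contrapT => nz.
have h'' := local_split_epiZ (c := -1) (hloc k) h'.
have := local_split_epiD (hloc k) h h''; apply.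
rewrite scaleN1r opprB addrC addrA subrK -scalerBl.
exists ((z' - z)^-1 *: idm _); rewrite compZl comp1m scalerA mulfV ?scale1r //.
by rewrite subr_eq0 eq_sym; apply/eqP.
Qed.

Lemma is_residueB k a b z w :
  is_residue k a z -> is_residue k b w -> is_residue k (a - b) (z - w).
Proof.
move=> h h'; rewrite /is_residue compBr compBl scalerBl.
have := local_split_epiD (hloc k) h (local_split_epiZ (c := -1) (hloc k) h').
rewrite scaleN1r !opprB addrACA [X in _ -> ~ split_epi X]addrACA.
by rewrite [- _ - _]addrC.
Qed.

(** The (k, k) entry of a product is the product of the (k, k) entries up to terms through T_j with
    j <> k, which are radical because T is basic. *)
Lemma is_residueM k a b z w :
  is_residue k a z -> is_residue k b w -> is_residue k (b \c a) (w * z).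
Proof.
rewrite /is_residue => h h'.
set f := p_ k \c a \c i_ k in h; set g := p_ k \c b \c i_ k in h'.
have -> : p_ k \c (b \c a) \c i_ k =
    \sum_j p_ k \c b \c i_ j \c (p_ j \c a \c i_ k).
  rewrite -[b in LHS]compm1 -hsum comp_sumr !comp_suml comp_sumr comp_suml.
  by apply: eq_bigr => j _; rewrite !compA.
rewrite (bigD1 k) //= -/f -/g addrAC.
apply: local_split_epiD => //; last first.
  rewrite big_mkcond /=; apply: local_split_epi_sum => // j.
  case: eqP => [_|njk]; first exact: local_nonsplit0.
  by move/split_epi_compl; exact: nonsplit_neq.
have -> : g \c f - (w * z) *: idm _ = (g - w *: idm _) \c f + w *: (f - z *:
  idm _).
  by rewrite compBl compZl comp1m scalerBr scalerA addrA subrK.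
apply: local_split_epiD => //; first by move/split_epi_compl.
exact: local_split_epiZ.
Qed.

Lemma is_residue_scalar k z : is_residue k (z *: idm T) z.
Proof.
rewrite /is_residue compZr compm1 compZl hpi subrr; exact: local_nonsplit0.
Qed.

Lemma is_residue_summand k j : is_residue k (i_ j \c p_ j) (j == k)%:R.
Proof.
rewrite /is_residue; have [->|njk] := eqVneq j k.
  by rewrite !compA hpi comp1m hpi scale1r subrr; exact: local_nonsplit0.
rewrite compA horth; last by move/esym/eqP; rewrite (negbTE njk).
by rewrite !comp0m scale0r subr0; exact: local_nonsplit0.
Qed.

(** Uniqueness turns a choice of residues into a ring morphism. Residues commute, which absorbs the
    opposite multiplication of [end_op]. *)
Lemma residue_character k : exists F : {rmorphism end_op T -> 'M[C]_1},
  (forall c, F (alg_unit c) = c%:M) /\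
  forall a : hom T T, exists z, is_residue k a z /\ F a = z%:M.
Proof.
have [chi hchi] := choice (fun a : hom T T => residue_exists (p_ k \c a \c i_
  k)).
pose f (a : end_op T) : 'M[C]_1 := (chi a)%:M.
have fB : zmod_morphism f.
  move=> a b; rewrite /f -raddfB; congr (_%:M).
  exact: is_residue_unique (hchi _) (is_residueB (hchi a) (hchi b)).
have fM : monoid_morphism f.
  split=> [|a b].
    congr (_%:M); apply: is_residue_unique (hchi _) _.
    by have := @is_residue_scalar k 1; rewrite scale1r.
  rewrite -[RHS]/((chi a)%:M *m (chi b)%:M) -scalar_mxM mulrC; congr (_%:M).
  exact: is_residue_unique (hchi _) (is_residueM (hchi a) (hchi b)).
pose B1 := GRing.isZmodMorphism.Build (end_op T) 'M[C]_1 f fB.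
pose B2 := GRing.isMonoidMorphism.Build (end_op T) 'M[C]_1 f fM.
pose F : {rmorphism end_op T -> 'M[C]_1} := HB.pack f B1 B2.
have hF c : F (alg_unit c) = c%:M.
  congr (_%:M); exact: is_residue_unique (hchi _) (@is_residue_scalar k c).
exists F; split=> // a.
by exists (chi a); split; [exact: hchi | ].
Qed.

End Simples.

(** * One-dimensional simple modules span K_0(fd) *)

Section Composition.
Variables (C : closedFieldType) (E : linCat C) (n : nat) (T_ : 'I_n ->
  E) (T : E).
Variables (i_ : forall k, hom (T_ k) T) (p_ : forall k, hom T (T_ k)).
Hypotheses (hpi : forall k, p_ k \c i_ k = idm (T_ k))
  (hsum : \sum_k i_ k \c p_ k = idm T) (hloc : forall k, local_end (T_ k))
  (hbasic : forall k l, k <> l -> ~ iso (T_ k) (T_ l)).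
Variables (F : forall k : 'I_n, {rmorphism end_op T -> 'M[C]_1})
  (hF : forall k c, F k (alg_unit c) = c%:M).
Hypothesis hres : forall k (a : hom T T),
  exists z, is_residue i_ p_ k a z /\ F k a = z%:M.

Definition simple_fd k : fdmod (end_op T) := @Fdmod C (end_op T) 1 (F k) (hF k).

Lemma fd_mod_fin_dim (N : fdmod (end_op T)) : fin_dim_mod (fd_mod N).
Proof.
exists (fd_dim N), (fun j => delta_mx j 0 : 'cV_(fd_dim N)) => x.
exists (fun j => (x : 'cV_(fd_dim N)) j 0).
rewrite [LHS](matrix_sum_delta (x : 'cV_(fd_dim N))).
by apply: eq_bigr => j _; rewrite big_ord1 -fd_alg_unit.
Qed.

(** A socle vector works: if z is the residue of a at k, then [p_ k \c a - z *: p_ k] is radical, on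
    T_k by definition of z and on the other summands because T is basic. *)
Lemma common_eigenvector (N : fdmod (end_op T)) : (0 < fd_dim N)%N ->
  exists k (x : 'cV_(fd_dim N)), x <> 0 /\
    forall a z, is_residue i_ p_ k a z -> rho N a *m x = z *: x.
Proof.
move=> dN; have [|k [x [nx ekx hx]]] :=
    socle_exists hpi hsum hloc (M := fd_mod N) (fd_mod_fin_dim N).
  exists (delta_mx (Ordinal dN) 0 : 'cV_(fd_dim N)) => /colP /(_ (Ordinal dN)).
  by rewrite !mxE !eqxx => /eqP; rewrite oner_eq0.
exists k, x; split=> // a z hz; rewrite -[LHS]act_rho -[x in LHS]ekx actA.
pose g := p_ k \c a - z *: p_ k.
have ng : ~ split_epi g.
  rewrite -[g]compm1 -hsum comp_sumr; apply: local_split_epi_sum => // j.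
  rewrite compA => /split_epi_compl; have [->|njk] := eqVneq j k.
    by rewrite /g compBl compZl hpi; exact: hz.
  by apply: (nonsplit_neq hloc hbasic); exact/eqP.
have -> : i_ k \c p_ k \c a = i_ k \c g + z *: (i_ k \c p_ k).
  by rewrite -compA /g compBr compZr subrK.
have rhoZ c f : rho N (c *: f) = c *: rho N f.
  rewrite -[f in LHS]compm1 -compZr rhoM -mul_scalar_mx; congr (_ *m _).
  exact: fd_unit.
by rewrite actDl hx // add0r act_rho rhoZ -scalemxAl -[rho N _ *m x]act_rho ekx.
Qed.

(* Quotient of N by the line spanned by the eigenvector v: the rows of Q form a
   basis of the linear forms vanishing on v. *)
Lemma simple_subrepresentation (N : fdmod (end_op T)) : (0 < fd_dim N)%N ->
  exists k (N'' : fdmod (end_op T)) (f : {linear fd_mod (simple_fd k) ->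
    fd_mod N})
    (g : {linear fd_mod N -> fd_mod N''}),
    short_exact f g /\ (fd_dim N'' < fd_dim N)%N.
Proof.
move=> dN; have [k [v [nv ev]]] := common_eigenvector dN.
have Ev (a : hom T T) : exists z, F k a = z%:M /\ rho N a *m v = z *: v.
  by have [z [hz ->]] := hres k a; exists z; split=> //; exact: ev.
have rv : \rank v = 1%N.
  apply/eqP; rewrite eqn_leq rank_leq_col lt0n mxrank_eq0; exact/eqP.
have [w wv] : exists w : 'rV_(fd_dim N), w *m v = 1%:M.
  by apply/row_fullP; rewrite /row_full rv.
pose Q := row_base (kermx v).
have Qv : Q *m v = 0 by apply/sub_kermxP; rewrite eq_row_base.
have QP m (M : 'M_(m, fd_dim N)) : M *m v = 0 -> exists D, M = D *m Q.
  by move=> /sub_kermxP; rewrite -(eq_row_base (kermx v)) => /submxP.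
have [B QB] := row_freeP (row_base_free (kermx v)); rewrite -/Q in QB.
pose act'' (a : end_op T) : 'M[C]_(\rank (kermx v)) := Q *m fd_act N a *m B.
have actQ a : Q *m fd_act N a = act'' a *m Q.
  have [z [_ hz]] := Ev a.
  have [|D eD] := QP _ (Q *m fd_act N a).
    by rewrite -mulmxA -[fd_act N a]/(rho N a) hz -scalemxAr Qv scaler0.
  by rewrite /act'' eD -(mulmxA D) QB mulmx1.
have aB : zmod_morphism act''.
  by move=> a b; rewrite /act'' rmorphB mulmxBr mulmxBl.
have aM : monoid_morphism act''.
  split=> [|a b]; first by rewrite /act'' rmorph1 mulmx1 QB.
  rewrite -[RHS]/(act'' a *m act'' b) {1}/act'' rmorphM mulmxA actQ.
  by rewrite -(mulmxA (act'' a) Q) -(mulmxA (act'' a)).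
pose B1 := GRing.isZmodMorphism.Build (end_op T) 'M[C]_(\rank (kermx v)) act''
  aB.
pose B2 := GRing.isMonoidMorphism.Build (end_op T) 'M[C]_(\rank (kermx v))
  act'' aM.
pose A'' : {rmorphism end_op T -> 'M[C]_(\rank (kermx v))} := HB.pack act'' B1
  B2.
have hA c : A'' (alg_unit c) = c%:M.
  rewrite -[LHS]/(act'' (alg_unit c)) /act'' fd_unit mul_mx_scalar -scalemxAl
    QB.
  by rewrite scale_scalar_mx mulr1.
pose N'' := @Fdmod C (end_op T) _ A'' hA.
have lf : linear (fun c : fd_mod (simple_fd k) =>
    v *m (c : 'cV_1) : fd_mod N).
  move=> a c c'; have [z [Fa ra]] := Ev a.
  rewrite -[a *: (_ : fd_mod N)]/(rho N a *m (v *m c)) mulmxA ra.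
  by rewrite -[a *: c]/(F k a *m c) mulmxDr Fa mul_scalar_mx -scalemxAr
    -scalemxAl.
have lg : linear (fun y : fd_mod N => Q *m (y : 'cV_(fd_dim N)) : fd_mod N'').
  move=> a y y'; rewrite -[a *: (_ : fd_mod N'')]/(act'' a *m (Q *m y)) mulmxA
    -actQ.
  by rewrite -[a *: y]/(fd_act N a *m y) mulmxDr mulmxA.
have [f hf] := linear_pack lf; have [g hg] := linear_pack lg.
exists k, N'', f, g; split; last first.
  by rewrite /= mxrank_ker rv subn1 prednK.
split.
- move=> c c'; rewrite !hf => /(congr1 (mulmx w)).
  by rewrite !mulmxA wv !mul1mx.
- move=> y; rewrite hg; split=> [Qy|[c <-]]; last by rewrite hf mulmxA Qv
  mul0mx.
  have [|D eD] := QP _ (1%:M - v *m w).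
    by rewrite mulmxBl mul1mx -mulmxA wv mulmx1 subrr.
  exists (w *m y : 'cV_1); rewrite hf; apply/eqP.
  rewrite eq_sym -subr_eq0 mulmxA -[X in X - _](mul1mx (y : 'cV_(fd_dim N))).
  by rewrite -mulmxBl eD -mulmxA Qy mulmx0.
- by move=> z; exists (B *m z : 'cV_(fd_dim N)); rewrite hg mulmxA QB mul1mx.
Qed.

Lemma K0fd_class_ses (N' N N'' : fdmod (end_op T))
    (f : {linear fd_mod N' -> fd_mod N}) (g : {linear fd_mod N -> fd_mod N''}) :
  short_exact f g -> K0fd_class N = K0fd_class N' + K0fd_class N''.
Proof.
move=> ses; apply/eqP; rewrite -subr_eq0 opprD addrA -!raddfB;
  apply/eqP/zpi_rel.
by exists N', N, N'', f, g.
Qed.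

Lemma K0fd_span (y : K0fd (end_op T)) :
  exists c : 'I_n -> int, y = \sum_k K0fd_class (simple_fd k) *~ c k.
Proof.
have span0 : exists c : 'I_n -> int, 0 = \sum_k K0fd_class (simple_fd k) *~ c k.
  by exists (fun=> 0); rewrite big1 // => k _; rewrite mulr0z.
have spanB (x z : K0fd (end_op T)) :
    (exists c : 'I_n -> int, x = \sum_k K0fd_class (simple_fd k) *~ c k) ->
    (exists c : 'I_n -> int, z = \sum_k K0fd_class (simple_fd k) *~ c k) ->
    exists c : 'I_n -> int, x - z = \sum_k K0fd_class (simple_fd k) *~ c k.
  move=> [c ->] [c' ->]; exists (fun k => c k - c' k).
  by rewrite -sumrB; apply: eq_bigr => k _; rewrite mulrzBr.
elim/zquot_gen_ind : y => [//|//|N]; rewrite -[zpi _ _]/(K0fd_class N).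
have [m] := ubnP (fd_dim N); elim: m N => // m IH N; rewrite ltnS => hN.
have [d0|dN] := posnP (fd_dim N).
  suff -> : K0fd_class N = 0 by [].
  have z0 (x : fd_mod N) : x = 0.
    by apply/colP => -[i hi]; exfalso; rewrite d0 in hi.
  (* For the zero module, N -> N -> N with identity maps is short exact, so [N] = [N] + [N]. *)
  apply: (@addrI _ (K0fd_class N)); rewrite addr0; apply: esym.
  apply: (@K0fd_class_ses N N N idfun idfun); split=> [//|y|z].
    by split=> _; [exists y | exact: z0].
  by exists z.
have [k [N'' [f [g [ses lt]]]]] := simple_subrepresentation dN.
rewrite (K0fd_class_ses ses) -[K0fd_class (simple_fd k)]opprK addrC.
apply: (spanB _ _ _ _); first by apply: IH; exact: leq_trans lt hN.
rewrite -sub0r; apply: spanB => //.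
exists (fun j => (j == k)%:R); rewrite (bigD1 k) //= eqxx mulr1z big1 ?addr0 //.
by move=> j /negbTE ->; rewrite mulr0z.
Qed.

Lemma K0fd_tensor_span (A : zmodType) (G : tensor (K0fd (end_op T)) A) :
  exists a : 'I_n -> A, G = \sum_k tens (K0fd_class (simple_fd k)) (a k).
Proof.
elim/tensor_ind : G => [|x y [a ->] [a' ->]|y a].
- by exists (fun=> 0); rewrite big1 // => k _; rewrite tens0r.
- exists (fun k => a k - a' k); rewrite -sumrB; apply: eq_bigr => k _.
  by rewrite tensDr tensNr.
have [c ->] := K0fd_span y; exists (fun k => a *~ c k).
rewrite (big_morph (fun v => tens v a) (tensDl a) (tens0l _ a)).
by apply: eq_bigr => k _; rewrite tens_mulz.
Qed.

End Composition.

(** * Gradings and additive functions on K_0(E) *)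

Section K0addSummands.
Variables (K : fieldType) (E : exactCat K) (T : E).
Hypotheses (hT : cluster_tilting T) (hKS : krull_schmidt E).
Variables (n : nat) (T_ : 'I_n -> E).
Variables (i_ : forall k, hom (T_ k) T) (p_ : forall k, hom T (T_ k)).
Hypotheses (hsum : \sum_k i_ k \c p_ k = idm T) (hloc : forall k,
  local_end (T_ k)).

(** The identity of X is a sum of maps through the T_k; by locality one of them is split epi, and
    then so is its second factor T_k -> X. *)
Lemma local_summand X : in_add T X -> local_end X -> exists k, iso (T_ k) X.
Proof.
move=> /in_add_power_retract [m [u [v uv]]] lX; apply: contrapT => /forallNP H.
have idX : split_epi (idm X) by exists (idm X); exact: comp1m.
move: idX; rewrite -uv; apply: local_split_epi_sum => // l.
rewrite -[v l]compm1 -hsum comp_sumr comp_suml;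
  apply: local_split_epi_sum => // k.
rewrite compA => /split_epi_compl /split_epi_compl hs; apply: (H k).
by exists (v l \c i_ k); apply: local_split_epi_iso => //; case: lX.
Qed.

Lemma K0add_ext_summands (A : zmodType) (f g : {additive K0add T -> A}) :
  (forall k, f (cl T (T_ k)) = g (cl T (T_ k))) -> f =1 g.
Proof.
move=> fg; apply: K0add_ext => X hX; have [m [F [dF lF]]] := hKS X.
elim: m F X dF lF hX => [|m IH] F X dF lF hX.
  have X0 : is_zero X.
    by have [i [p [_ _ e]]] := dF; rewrite /is_zero -e big_ord0.
  by rewrite (cl_zero X0 hX) !raddf0.
have [S [B [dS eB]]] := dsum_split (exact_additive E) dF; move: hX;
  rewrite -eB => hB.
have hF : in_add T (F ord0) by apply: (add_retract hT hB); exact: bprl_inl.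
have hS : in_add T S by apply: (add_retract hT hB); exact: bprr_inr.
rewrite cl_bsum // !raddfD (IH _ _ dS) //; congr (_ + _).
have [k e] := local_summand hF (lF ord0).
by rewrite -(cl_iso hT _ e) ?fg //; exact: (add_iso hT (iso_sym e)).
Qed.

End K0addSummands.

Section Gradings.
Variables (C : numClosedFieldType) (E : exactCat C) (T : E).
Hypotheses (hT : cluster_tilting T) (hfrob : frobenius E)
  (hfin : forall X Y : E, fin_dim (stab_hom X Y)) (hKS : krull_schmidt E).
Variables (n : nat) (T_ : 'I_n -> E).
Variables (i_ : forall k, hom (T_ k) T) (p_ : forall k, hom T (T_ k)).
Hypotheses (hpi : forall k, p_ k \c i_ k = idm (T_ k))
  (horth : forall k l, k <> l -> p_ k \c i_ l = 0)
  (hsum : \sum_k i_ k \c p_ k = idm T) (hloc : forall k, local_end (T_ k))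
  (hbasic : forall k l, k <> l -> ~ iso (T_ k) (T_ l))
  (hsimple : forall S : lmodType (end_op T), simple_mod S -> fin_dim_mod S).
Variable A : zmodType.
Implicit Types G H : tensor (K0fd (end_op T)) A.

(** Additivity of [euler_tensor] in its tensor argument has to be derived from a presentation of M
    by a conflation. *)
Lemma gradingB G H : is_grading (T := T) G -> is_grading (T := T) H ->
  is_grading (T := T) (G - H).
Proof.
move=> hG hH M fM; have [X [T1 [T0 [i [p [aug [h0 h1 c sa e0]]]]]]] :=
  stable_module_coker hT hfrob hfin fM.
have [h [hE _]] := euler_tensor_additive A
  (euler_class_coker hT hfrob hfin h0 h1 c sa e0).
by rewrite hE raddfB -!hE hG // hH // subrr.
Qed.

Lemma grading0 : is_grading (T := T) (0 : tensor (K0fd (end_op T)) A).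
Proof.
move=> M fM; have [X [T1 [T0 [i [p [aug [h0 h1 c sa e0]]]]]]] :=
  stable_module_coker hT hfrob hfin fM.
have [h [hE _]] := euler_tensor_additive A
  (euler_class_coker hT hfrob hfin h0 h1 c sa e0).
by rewrite hE raddf0.
Qed.

Lemma degreeD G H X :
  degree (T := T) (G + H) X = degree (T := T) G X + degree (T := T) H X.
Proof.
have [h [hE _]] := euler_tensor_additive A (euler_class_Fobj hT hfrob hfin X).
by rewrite /degree !hE raddfD.
Qed.

(** The pairing of FT_j with S_k is the trace of the idempotent [i_ j \c p_ j] on S_k, that is, its
    residue at k. *)
Lemma dual_basis : exists S : 'I_n -> fdmod (end_op T),
  (forall j k, euler (Fobj T (T_ j)) (fd_mod (S k)) = (j == k)%:R) /\
  forall G, exists a, G = \sum_k tens (K0fd_class (S k)) (a k).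
Proof.
have [F hF] := choice (residue_character hpi hsum hloc hbasic hsimple).
pose hF1 k := proj1 (hF k); pose hF2 k := proj2 (hF k).
exists (simple_fd hF1); split; last first.
  exact: (K0fd_tensor_span hpi hsum hloc hbasic hF1 hF2).
move=> j k; have hj := summand_in_add hT hpi j.
apply: (@intr_inj C); rewrite (euler_class_Fobj hT hfrob hfin).
rewrite (index_add hT hfrob hfin hj).
have [z [hz Fz]] := hF2 k (i_ j \c p_ j).
have hjk : is_residue i_ p_ k (i_ j \c p_ j) (j == k)%:R.
  exact: is_residue_summand.
have ez := is_residue_unique hloc hz hjk.
rewrite (@hattoriE _ _ _ _ _ (j == k)%:R hj); first by case: (j == k).
exists 'I_1, (fun=> i_ j), (fun=> p_ j); rewrite !big_ord1; split;
  first exact: hpi.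
by rewrite -[rho _ _]/(F k (i_ j \c p_ j)) Fz mxtrace_scalar ez mulr1n.
Qed.

Lemma degree_tens_sum (S : 'I_n -> fdmod (end_op T)) a X :
  degree (T := T) (\sum_k tens (K0fd_class (S k)) (a k) :
    tensor (K0fd (end_op T)) A) X =
  \sum_k a k *~ euler (Fobj T X) (fd_mod (S k)).
Proof.
have [h [hE hN]] := euler_tensor_additive A (euler_class_Fobj hT hfrob hfin X).
by rewrite /degree hE raddf_sum; apply: eq_bigr => k _; rewrite hN.
Qed.

(** By duality the degree of T_k is the k-th coefficient of the tensor. *)
Lemma degree_inj G H :
  (forall X, degree (T := T) G X = degree (T := T) H X) -> G = H.
Proof.
have [S [dS spanS]] := dual_basis => e.
have [a eG] := spanS G; have [b eH] := spanS H.
rewrite eG eH; apply: eq_bigr => k _; congr (tens _ _).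
have := e (T_ k); rewrite eG eH !degree_tens_sum.
have sum1 (c : 'I_n -> A) : \sum_j c j *~ euler (Fobj T (T_ k)) (fd_mod (S j))
  = c k.
  rewrite (bigD1 k) //= dS eqxx mulr1z big1 ?addr0 // => j njk.
  by rewrite dS eq_sym (negbTE njk) mulr0z.
by rewrite !sum1.
Qed.

(** With coefficients f([T_k]), duality makes the degree agree with f on each T_k, hence on add
    T. *)
Lemma grading_of_additive (f : {additive K0 E -> A}) :
  exists G, is_grading (T := T) G /\ forall X,
    degree (T := T) G X = f (K0_class X).
Proof.
have [S [dS _]] := dual_basis.
pose G : tensor (K0fd (end_op T)) A :=
  \sum_k tens (K0fd_class (S k)) (f (K0_class (T_ k))).
have [f0 hf0] := @K0add_map C E T A (fun X => f (K0_class X))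
  (fun X Y Z B _ _ _ e => etrans (congr1 f (K0_class_iso_bsum e)) (raddfD f _
    _)).
pose g X := \sum_k f (K0_class (T_ k)) *~ euler (Fobj T X) (fd_mod (S k)).
(* The pairings depend on X only through its index, so g is additive wherever the index is. *)
have gB X Y Z : index T Y = index T X + index T Z -> g Y = g X + g Z.
  move=> e; rewrite /g -big_split; apply: eq_bigr => k _ /=.
  rewrite -mulrzDr; congr (_ *~ _); apply: (@intr_inj C).
  by rewrite intrD !(euler_class_Fobj hT hfrob hfin) e raddfD.
have [|g0 hg0] := @K0add_map C E T A g.
  move=> X Y Z B hX hY hZ e; apply: gB.
  by rewrite !(index_add hT hfrob hfin) // (cl_iso_bsum hX hY hZ e).
have fg W : in_add T W -> g W = f (K0_class W).
  move=> hW; rewrite -hg0 // -hf0 //.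
  apply: (K0add_ext_summands hT hKS hsum hloc) => k.
  have hk := summand_in_add hT hpi k.
  rewrite hg0 // hf0 // /g (bigD1 k) //= dS eqxx mulr1z big1 ?addr0 // => j njk.
  by rewrite dS eq_sym (negbTE njk) mulr0z.
have degE X : degree (T := T) G X = f (K0_class X).
  rewrite degree_tens_sum -/(g X).
  (* Both g and f are additive on the index conflation W1 -> W0 -> X, so agreement on add T spreads
     to X. *)
  have [W1 [W0 [i [p [h1 h0 c e]]]]] := indexP hT hfrob hfin X.
  apply: (@addrI _ (g W1)); rewrite -(gB W1 W0 X); last first.
    by rewrite e !(index_add hT hfrob hfin) // addrC subrK.
  by rewrite !fg // (K0_class_confl c) raddfD.
exists G; split=> // M fM.
have [X [T1 [T0 [i [p [aug [h0 h1 c sa e0]]]]]]] :=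
  stable_module_coker hT hfrob hfin fM.
have hM := euler_class_coker hT hfrob hfin h0 h1 c sa e0.
have cE := euler_class_Fobj hT hfrob hfin.
rewrite (euler_tensor_comb G hM (cE X) (cE T1) (cE T0)); last first.
  by rewrite (index_add hT hfrob hfin h1) (index_add hT hfrob hfin h0).
rewrite -/(degree G X) -/(degree G T1) -/(degree G T0) !degE (K0_class_confl c).
by rewrite raddfD addrAC subrr.
Qed.

End Gradings.

Theorem theorem3p12 (R : realType) (E : exactCat R[i])
    (hE : frobenius_cluster E)
    (n r : nat) (hr : (r <= n)%N) (T : E) (T_ : 'I_n -> E)
    (hT : cluster_tilting T)
    (hsum : is_dsum T_ T)
    (hindec : forall i, indecomposable (T_ i))
    (hbasic : forall i j, i <> j -> ~ iso (T_ i) (T_ j))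
    (hproj : forall i : 'I_n, proj_inj (T_ i) <-> (r <= i)%N)
    (hnoeth : noetherian (end_op T)) :
  (forall ex : forall k : 'I_n, (k < r)%N -> exchange T_ T k,
     zmod_iso (K0 E) (zquot (exchange_rel ex)))
  /\
  ((forall S : lmodType (end_op T), simple_mod S -> fin_dim_mod S) ->
   forall A : zmodType,
     (is_grading (T := T) (0 : tensor _ A) /\
      forall G H : tensor _ A,
        is_grading (T := T) G -> is_grading H -> is_grading (G - H)) /\
     exists Phi : {G : tensor (K0fd (end_op T)) A | is_grading G} ->
                  {additive K0 E -> A},
       [/\ forall G X, Phi G (K0_class X) = degree (sval G) X,
           forall G G' H, sval H = sval G + sval G' ->
             forall x, Phi H x = Phi G x + Phi G' x,
           forall G G', (forall x, Phi G x = Phi G' x) -> sval G = sval G'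
         & forall f : {additive K0 E -> A},
             exists G, forall x, Phi G x = f x]).
Proof.
have [hfrob hKS [hfin _] _ _] := hE.
have [i_ [p_ [hpi horth hid]]] := hsum.
have hloc k : local_end (T_ k).
  exact: indecomposable_local (exact_additive E) hKS _ (hindec k).
split=> [ex|hsimple A].
  exact: (K0_exchange_iso hT hfrob hfin hpi hid hloc hproj ex).
split; first by split=> [|G H]; [exact: grading0 | exact: gradingB].
have ext (f g : {additive K0 E -> A}) :
    (forall X, f (K0_class X) = g (K0_class X)) -> f =1 g.
  by move=> fg; apply: additive_zquot_ext => X; exact: fg.
have [Phi hPhi] := choice
  (fun G : {G : tensor (K0fd (end_op T)) A | is_grading G} =>
  K0_map (fun X Y Z i p c => degree_confl hT hfrob hfin (svalP G) c)).
exists Phi; split=> [//|G G' H e|G G' e|f].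
- apply: (ext (Phi H) (Phi G \+ Phi G')) => X /=.
  by rewrite !hPhi e degreeD.
- apply: (degree_inj hT hfrob hfin hpi horth hid hloc hbasic hsimple) => X.
  by rewrite -!hPhi e.
have [G [hG dG]] :=
  grading_of_additive hT hfrob hfin hKS hpi horth hid hloc hbasic hsimple f.
exists (exist _ G hG); apply: ext => X.
by rewrite hPhi dG.
Qed.
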